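(* Let $\beta>0$. The Laplace transform of the overlap $R_{12}$ has the contour integral representation \[ \langle e^{tR_{12}}\rangle=\frac{\int_{\gamma-i\infty}^{\gamma+i\infty}\int_{\gamma-i\infty}^{\gamma+i\infty}e^{\frac N2\tilde G(z,w)}\,dz\,dw}{\Big(\int_{\gamma-i\infty}^{\gamma+i\infty}e^{\frac N2 G(z)}\,dz\Big)^2}, \] where \[ G(z)=2\beta z-\frac1N\sum_{i=1}^N\log(z-\lambda_i) \] and \[ \tilde G(z,w)=\tilde G(z,w,t)=2\beta(z+w)-\frac1N\sum_{i=1}^N\log\Big((z-\lambda_i)(w-\lambda_i)-\frac{t^2}{4\beta^2N^2}\Big). \]
   Context: Let $g_{ij}$, $1\le i,j\le N$, be independent standard Gaussian random variables. For $\sigma\in\mathbb{S}^{N-1}:=\{\sigma\in\mathbb{R}^N:|\sigma|=\sqrt N\}$ let $H_N(\sigma)=-\frac{1}{\sqrt N}\sum_{1\le i,j\le N}g_{ij}\sigma_i\sigma_j$. Let $d\omega$ be the uniform (surface) measure on $\mathbb{S}^{N-1}$ and $Z_N=Z_N(\beta)=\frac{1}{|\mathbb{S}^{N-1}|}\int_{\mathbb{S}^{N-1}}e^{-\beta H_N(\sigma)}\,d\omega(\sigma)$. The overlap of $\sigma_1,\sigma_2\in\mathbb{S}^{N-1}$ is $R_{12}=\frac1N\langle\sigma_1,\sigma_2\rangle$, and \[ \langle e^{tR_{12}}\rangle=\frac{1}{Z_N^2}\frac{1}{|\mathbb{S}^{N-1}|^2}\int_{(\mathbb{S}^{N-1})^2}e^{-\beta(H_N(\sigma_1)+H_N(\sigma_2))+tR_{12}}\,d\omega(\sigma_1)\,d\omega(\sigma_2).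 \] $\lambda_1\ge\dots\ge\lambda_N$ are the eigenvalues of the symmetric matrix $M$ with entries $M_{ij}=\frac{g_{ij}+g_{ji}}{2\sqrt N}$, so that $-H_N(\sigma)=\langle\sigma,M\sigma\rangle$. The number $\gamma$ fixing the vertical contours is a real number satisfying $\gamma>\lambda_1+\frac{t}{2\beta N}$, and $\log$ is the principal branch.
   Formalization: The contour condition is taken as γ > λ_1 + |t|/(2βN) instead of γ > λ_1 + t/(2βN); the two agree for t ≥ 0, and for t < 0 the original condition lets the contour pass left of singularities, where the formula fails. *)

(* Defs.v *)
From HB Require Import structures.
From mathcomp Require Import all_boot all_order all_algebra.
From mathcomp Require Import all_classical all_reals all_analysis.
From mathcomp Require Import measurable_realfun complex.

Set Implicit Arguments.
Unset Strict Implicit.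
Unset Printing Implicit Defensive.

Import Order.TTheory GRing.Theory Num.Theory.
Import numFieldNormedType.Exports.

Local Open Scope classical_set_scope.
Local Open Scope ring_scope.
Local Open Scope complex_scope.

Section LebesgueTuple.
Variable R : realType.
Local Notation RT := (measurableTypeR R).

Definition tcons n (p : RT * n.-tuple RT) : n.+1.-tuple RT :=
  [the n.+1.-tuple RT of p.1 :: p.2].

Lemma measurable_tcons n : measurable_fun [set: RT * n.-tuple RT] (@tcons n).
Proof. exact: measurable_cons. Qed.

Section Step.
Variables (n : nat) (m : {sigma_finite_measure set (n.-tuple RT) -> \bar R}).

Definition leb_cons : set (n.+1.-tuple RT) -> \bar R :=
  pushforward (@lebesgue_measure R \x m)%E (@tcons n).

Let leb_cons0 : leb_cons set0 = 0%E.
Proof. by rewrite /leb_cons /pushforward preimage_set0 measure0. Qed.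

Let leb_cons_ge0 A : (0 <= leb_cons A)%E.
Proof. by apply: integral_ge0 => x _; exact: measure_ge0. Qed.

Let leb_cons_sigma_additive : semi_sigma_additive leb_cons.
Proof.
have mf := @measurable_tcons n.
exact: (@measure_semi_sigma_additive _ _ _ (pushforward _ (@tcons n))).
Qed.

HB.instance Definition _ := isMeasure.Build _ _ _ leb_cons
  leb_cons0 leb_cons_ge0 leb_cons_sigma_additive.

Lemma leb_cons_sigma_finite : sigma_finite setT leb_cons.
Proof.
pose tuncons (x : n.+1.-tuple RT) : RT * n.-tuple RT :=
  (tnth x ord0, [tuple of behead x]).
have tunconsK x : tcons (tuncons x) = x.
  by rewrite [RHS]tuple_eta; apply/val_inj.
have tconsK p : tuncons (tcons p) = p.
  by case: p => a v; congr pair; apply/val_inj.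
have mtuncons : measurable_fun setT tuncons.
  apply: measurable_fun_pair; [exact: measurable_tnth|exact: measurable_behead].
have /sigma_finiteP[F [FT ndF Foo]] := sigma_finiteT (@lebesgue_measure R).
have /sigma_finiteP[G [GT ndG Goo]] := sigma_finiteT m.
exists (fun i => tuncons @^-1` (F i `*` G i)).
  rewrite -preimage_bigcup; apply/esym; rewrite -[RHS](preimage_setT tuncons).
  congr (_ @^-1` _); rewrite -setXTT FT GT predeqE => -[x y]; split.
    by move=> [k _ []/= ? ?]; split; exists k.
  move=> [/= [k _ Fkx] [l _ Gly]]; exists (maxn k l) => //; split.
    by move: x Fkx; exact/subsetPset/ndF/leq_maxl.
  by move: y Gly; exact/subsetPset/ndG/leq_maxr.
move=> i; have [? ?] := Foo i; have [? ?] := Goo i.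
have mFG : measurable (F i `*` G i) by exact: measurableX.
split; first by rewrite -[X in measurable X]setTI; exact: mtuncons.
rewrite /leb_cons /pushforward -comp_preimage.
rewrite (_ : tuncons \o @tcons n = id); last exact/funext.
by rewrite preimage_id product_measure1E// lte_mul_pinfty// ge0_fin_numE.
Qed.

HB.instance Definition _ :=
  Measure_isSigmaFinite.Build _ _ _ leb_cons leb_cons_sigma_finite.

End Step.

Fixpoint lebesgue_tuple n : {sigma_finite_measure set (n.-tuple RT) -> \bar R} :=
  match n with
  | 0 => \d_[tuple]
  | n'.+1 => leb_cons (lebesgue_tuple n')
  end.

End LebesgueTuple.

Section Sphere.
Variables (R : realType) (N : nat).
Local Notation RT := (measurableTypeR R).
Implicit Types (x s : N.-tuple RT) (A : set (N.-tuple RT)).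

Definition dot x s : R := \sum_(i < N) tnth x i * tnth s i.

Definition enorm x : R := Num.sqrt (dot x x).

Definition sphere : set (N.-tuple RT) := [set s | enorm s = Num.sqrt N%:R].

Definition punctured_ball : set (N.-tuple RT) :=
  [set x | 0 < enorm x <= Num.sqrt N%:R].

Definition radial_proj x : N.-tuple RT :=
  [tuple Num.sqrt N%:R / enorm x * tnth x i | i < N].

Let measurable_coord i : measurable_fun setT (fun x => tnth x i : R).
Proof. exact: measurable_tnth. Qed.

Let dot_ge0 x : 0 <= dot x x.
Proof. by apply: sumr_ge0 => i _; rewrite -expr2 sqr_ge0. Qed.

Lemma measurable_enorm : measurable_fun setT enorm.
Proof.
rewrite (_ : enorm = fun x => dot x x `^ 2^-1); last first.
  by apply/funext => x; rewrite powR12_sqrt.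
apply: (measurableT_comp (measurable_powR _)).
by apply: measurable_sum => i; exact: measurable_funM.
Qed.

Lemma measurable_punctured_ball : measurable punctured_ball.
Proof.
rewrite (_ : punctured_ball = enorm @^-1` `]0, Num.sqrt N%:R]); last first.
  by apply/seteqP; split=> x; rewrite /punctured_ball /= in_itv.
rewrite -[X in measurable X]setTI.
by apply: measurable_enorm => //; exact: measurable_itv.
Qed.

Lemma measurable_radial_proj : measurable_fun setT radial_proj.
Proof.
apply/measurable_fun_tnthP => i.
rewrite (_ : _ \o _ =
    fun x => Num.sqrt N%:R * enorm x `^ (-1) * tnth x i); last first.
  by apply/funext => x /=; rewrite tnth_mktuple powR_inv1// sqrtr_ge0.
apply: (@measurable_funM _ _ R) => //; apply: measurable_funM => //.
exact: (measurableT_comp (measurable_powR _)) measurable_enorm.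
Qed.

(* In dimension N, a sphere of radius r and the cone
   {l a : a in A, 0 < l <= 1} over a part A of it satisfy
   |cone| = (r / N) area(A); here r = sqrt N, so N / r = sqrt N. *)
Definition surface_measure A : \bar R :=
  ((Num.sqrt N%:R)%:E *
   lebesgue_tuple R N (radial_proj @^-1` A `&` punctured_ball))%E.

Let surface_measureE : surface_measure =
  pushforward (mscale (NngNum (sqrtr_ge0 N%:R))
    (mrestr (lebesgue_tuple R N) measurable_punctured_ball)) radial_proj.
Proof. by []. Qed.

Let surface_measure0 : surface_measure set0 = 0%E.
Proof. by rewrite /surface_measure preimage_set0 set0I measure0 mule0. Qed.

Let surface_measure_ge0 A : (0 <= surface_measure A)%E.
Proof. by rewrite mule_ge0// lee_fin sqrtr_ge0. Qed.

Let surface_measure_sigma_additive : semi_sigma_additive surface_measure.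
Proof.
rewrite surface_measureE; have mp := measurable_radial_proj.
exact: (@measure_semi_sigma_additive _ _ _ (pushforward _ radial_proj)).
Qed.

HB.instance Definition _ := isMeasure.Build _ _ _ surface_measure
  surface_measure0 surface_measure_ge0 surface_measure_sigma_additive.

Definition area : R := fine (surface_measure sphere).

Definition overlap x s : R := N%:R^-1 * dot x s.

End Sphere.
Arguments sphere : clear implicits.
Arguments surface_measure : clear implicits.
Arguments area : clear implicits.

Section Model.
Variables (R : realType) (N : nat) (a : 'M[R]_N).
Local Notation RT := (measurableTypeR R).
Local Notation omega := (surface_measure R N).
Local Notation S := (sphere R N).

Definition hamiltonian (s : N.-tuple RT) : R :=
  - ((Num.sqrt N%:R)^-1 *
     \sum_(i < N) \sum_(j < N) a i j * tnth s i * tnth s j).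

Definition partition_function (beta : R) : R :=
  (area R N)^-1 * \int[omega]_(s in S) expR (- beta * hamiltonian s).

Definition overlap_laplace (beta t : R) : R :=
  (partition_function beta ^+ 2)^-1 * (area R N ^+ 2)^-1 *
  \int[omega]_(s1 in S) \int[omega]_(s2 in S)
    expR (- beta * (hamiltonian s1 + hamiltonian s2) + t * overlap s1 s2).

Definition sym_matrix : 'M[R]_N :=
  \matrix_(i, j) ((a i j + a j i) / (2 * Num.sqrt N%:R)).

End Model.

Definition ordered_eigenvalues (R : realType) (N : nat) (M : 'M[R]_N)
    (lam : 'I_N -> R) : Prop :=
  char_poly M = \prod_(i < N) ('X - (lam i)%:P) /\
  (forall i j : 'I_N, (i <= j)%N -> lam j <= lam i).

Section Complex.
Variable R : realType.
(* componentwise, not the Num.Re / Num.Im valued in R[i] *)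
Local Notation Re := (@complex.Re R).
Local Notation Im := (@complex.Im R).
Implicit Types (z w : R[i]) (f : R[i] -> R[i]).

Definition cexp z : R[i] :=
  (expR (Re z) * cos (Im z)) +i* (expR (Re z) * sin (Im z)).

Definition cmod z : R := Num.sqrt (Re z ^+ 2 + Im z ^+ 2).

(* principal argument, in ]-pi, pi] *)
Definition carg z : R :=
  if 0 <= Im z then acos (Re z / cmod z) else - acos (Re z / cmod z).

Definition clog z : R[i] := ln (cmod z) +i* carg z.

Definition segment_integral (gamma : R) f (T : R) : R[i] :=
  'i * ((\int[@lebesgue_measure R]_(y in `[- T, T]) Re (f (gamma +i* y))) +i*
        (\int[@lebesgue_measure R]_(y in `[- T, T]) Im (f (gamma +i* y)))).

(* The integral over the vertical line is improper: the limit, as T tends to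
   +oo, of the integrals from gamma - iT to gamma + iT.  The limit is taken on
   real and imaginary parts. *)
Definition vertical_integral (gamma : R) f : R[i] :=
  lim (Re (segment_integral gamma f T) @[T --> +oo]) +i*
  lim (Im (segment_integral gamma f T) @[T --> +oo]).

Definition vertical_integrable (gamma : R) f : Prop :=
  [/\ forall T : R,
        (@lebesgue_measure R).-integrable `[- T, T]
          (fun y => (Re (f (gamma +i* y)))%:E) /\
        (@lebesgue_measure R).-integrable `[- T, T]
          (fun y => (Im (f (gamma +i* y)))%:E),
      cvg (Re (segment_integral gamma f T) @[T --> +oo]) &
      cvg (Im (segment_integral gamma f T) @[T --> +oo])].

Variables (N : nat) (lam : 'I_N -> R) (beta t : R).

Definition G z : R[i] :=
  (2 * beta)%:C * z - (N%:R^-1)%:C * \sum_(i < N) clog (z - (lam i)%:C).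

Definition Gtilde z w : R[i] :=
  (2 * beta)%:C * (z + w) -
  (N%:R^-1)%:C * \sum_(i < N)
    clog ((z - (lam i)%:C) * (w - (lam i)%:C)
          - (t ^+ 2 / (4 * beta ^+ 2 * N%:R ^+ 2))%:C).

Definition expG z : R[i] := cexp ((N%:R / 2)%:C * G z).

Definition expGtilde z w : R[i] := cexp ((N%:R / 2)%:C * Gtilde z w).

End Complex.

Section Disorder.
Context d (Omega : measurableType d) (R : realType) (P : probability Omega R).

Definition mutually_independent (I : finType) (X : I -> {RV P >-> R}) : Prop :=
  forall (J : {set I}) (B : I -> set R), (forall i, measurable (B i)) ->
    P [set o | forall i, i \in J -> B i (X i o)] =
    (\prod_(i in J) P (X i @^-1` B i))%E.

Definition standard_gaussian (X : {RV P >-> R}) : Prop :=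
  forall B : set R, measurable B -> distribution P X B = normal_prob 0 1 B.

End Disorder.

(* Main.v *)
(* The Gaussian integral of exp(sum_i lam_i x_i^2 - z |x|^2) over R^N is
   pi^(N/2) prod_i (z - lam_i)^(-1/2).  In polar coordinates it is also the
   Laplace transform, in rho = |x|^2, of a power of rho times the integral over
   the sphere of exp((rho / N) sum_i lam_i s_i^2).  Fourier inversion along the
   line Re z = gamma, evaluated at rho = N beta, therefore turns the vertical
   integral of exp(N G(z) / 2) into the partition function, after M has been
   diagonalised by a rotation.

   For two replicas and w fixed on the line, z -> exp(N Gtilde(z, w) / 2) has
   the same shape, with lam_i replaced by lam_i + c / (w - lam_i), where
   c = t^2 / (4 beta^2 N^2); the condition on gamma keeps the real parts of
   these points below gamma.  The inversion in z produces, for each coordinate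
   of the point s of the sphere, the factor
   (w - lam_i)^(-1/2) exp(beta c s_i^2 / (w - lam_i)), which is a Gaussian
   integral over a new variable y_i coupled to s_i.  So the result is again a
   Laplace transform, now in |y|^2, and the inversion in w puts y on the sphere
   as well, coupled to s through exp(t R_12).  The normalising constants are
   those of one replica, squared, and cancel. *)

Require Import Defs.
From HB Require Import structures.
From mathcomp Require Import all_boot all_order all_algebra.
From mathcomp Require Import all_classical all_reals all_analysis.
From mathcomp Require Import measurable_realfun complex.
From mathcomp Require Import ring lra.

Set Implicit Arguments.
Unset Strict Implicit.
Unset Printing Implicit Defensive.

Import Order.TTheory GRing.Theory Num.Theory.
Import numFieldNormedType.Exports.

Local Open Scope classical_set_scope.
Local Open Scope ring_scope.
Local Open Scope complex_scope.

(** Two obstacles shape the proof. On the line a product of N inverse square roots decays only like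
    |Im z|^(-N/2), so for N at most 2 the contour integrals do not converge absolutely. Inversion is
    therefore carried out under symmetric truncation, with the Dirichlet kernel and the
    Riemann-Lebesgue lemma, and it needs a Lipschitz bound only at the single point rho = N beta.
    The other obstacle is the branch: [Gtilde] takes the principal logarithm of a whole product,
    whereas the inversion in each variable handles one factor. The principal u^(-1/2) is therefore
    characterised as the inverse square root with positive real part, a description under which the
    two factors can be multiplied.

    No Jacobian is computed on R^N. The effect of dilations and rotations on Lebesgue measure
    follows from translation invariance, by testing on a Gaussian, and polar coordinates then need
    only dilations and Tonelli's theorem. Complex Gaussian integrals come from real ones through
    differential equations in their parameters, without moving a contour. *)

Local Notation Re := (@complex.Re _).
Local Notation Im := (@complex.Im _).

(** * Complex exponential and principal square root *)

Section ComplexBasics.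
Variable R : realType.
Implicit Types u v z w r : R[i].

Lemma eq_complexE z w : Re z = Re w -> Im z = Im w -> z = w.
Proof. by case: z => a b; case: w => c e /= -> ->. Qed.

Lemma cReD z w : Re (z + w) = Re z + Re w. Proof. by case: z; case: w. Qed.
Lemma cImD z w : Im (z + w) = Im z + Im w. Proof. by case: z; case: w. Qed.
Lemma cReN z : Re (- z) = - Re z. Proof. by case: z. Qed.
Lemma cImN z : Im (- z) = - Im z. Proof. by case: z. Qed.
Lemma cReM z w : Re (z * w) = Re z * Re w - Im z * Im w.
Proof. by case: z; case: w. Qed.
Lemma cImM z w : Im (z * w) = Re z * Im w + Im z * Re w.
Proof. by case: z; case: w. Qed.

Lemma cReMl (a : R) z : Re (a%:C * z) = a * Re z.
Proof. by rewrite cReM /= mul0r subr0. Qed.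
Lemma cImMl (a : R) z : Im (a%:C * z) = a * Im z.
Proof. by rewrite cImM /= mul0r addr0. Qed.

Definition complexE := (cReD, cImD, cReN, cImN, cReMl, cImMl, cReM, cImM).

Lemma Re_sum I (s : seq I) (P : pred I) (f : I -> R[i]) :
  Re (\sum_(i <- s | P i) f i) = \sum_(i <- s | P i) Re (f i).
Proof. by apply: (big_morph Re cReD). Qed.

Lemma Im_sum I (s : seq I) (P : pred I) (f : I -> R[i]) :
  Im (\sum_(i <- s | P i) f i) = \sum_(i <- s | P i) Im (f i).
Proof. by apply: (big_morph Im cImD). Qed.

Lemma cexpD z w : cexp (z + w) = cexp z * cexp w.
Proof.
case: z => a b; case: w => c e; rewrite /cexp /= expRD cosD sinD.
by apply: eq_complexE => /=; ring.
Qed.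

Lemma cexp0 : cexp 0 = 1 :> R[i].
Proof. by rewrite /cexp/= expR0 cos0 sin0 mulr1 mulr0. Qed.

Lemma cexp_sum I (s : seq I) (P : pred I) (f : I -> R[i]) :
  cexp (\sum_(i <- s | P i) f i) = \prod_(i <- s | P i) cexp (f i).
Proof. by apply: (big_morph _ cexpD cexp0). Qed.

Lemma cexpR (x : R) : cexp x%:C = (expR x)%:C.
Proof. by rewrite /cexp/= cos0 sin0 mulr1 mulr0. Qed.

Lemma norm_cos_le1 (x : R) : `|cos x| <= 1.
Proof. by rewrite ler_norml cos_geN1 cos_le1. Qed.

Lemma norm_sin_le1 (x : R) : `|sin x| <= 1.
Proof. by rewrite ler_norml sin_geN1 sin_le1. Qed.

Lemma norm_Re_cexp z : `|Re (cexp z)| <= expR (Re z).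
Proof.
rewrite /cexp/= normrM ger0_norm ?expR_ge0// ler_piMr ?expR_ge0 ?norm_cos_le1//.
Qed.

Lemma norm_Im_cexp z : `|Im (cexp z)| <= expR (Re z).
Proof.
rewrite /cexp/= normrM ger0_norm ?expR_ge0// ler_piMr ?expR_ge0 ?norm_sin_le1//.
Qed.

Lemma norm_ReM_cexp w z :
  `|Re (w * cexp z)| <= (`|Re w| + `|Im w|) * expR (Re z).
Proof.
rewrite cReM mulrDl; apply: le_trans (ler_normB _ _) (lerD _ _).
  by rewrite normrM ler_wpM2l// norm_Re_cexp.
by rewrite normrM ler_wpM2l// norm_Im_cexp.
Qed.

Lemma norm_ImM_cexp w z :
  `|Im (w * cexp z)| <= (`|Re w| + `|Im w|) * expR (Re z).
Proof.
rewrite cImM mulrDl; apply: le_trans (ler_normD _ _) (lerD _ _).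
  by rewrite normrM ler_wpM2l// norm_Im_cexp.
by rewrite normrM ler_wpM2l// norm_Re_cexp.
Qed.

Lemma cmod_gt0 u : u != 0 -> 0 < cmod u.
Proof.
case: u => a b; rewrite /cmod /= sqrtr_gt0 => u0.
rewrite lt_neqAle addr_ge0 ?sqr_ge0// andbT eq_sym paddr_eq0 ?sqr_ge0//.
rewrite !sqrf_eq0; apply: contra_neqN u0 => /andP[/eqP -> /eqP ->].
exact: eq_complexE.
Qed.

Lemma sqr_cmod u : cmod u ^+ 2 = Re u ^+ 2 + Im u ^+ 2.
Proof. by rewrite sqr_sqrtr// addr_ge0 ?sqr_ge0. Qed.

Lemma Re_cmod_itv u : u != 0 -> -1 <= Re u / cmod u <= 1.
Proof.
move=> u0; have c0 := cmod_gt0 u0.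
rewrite ler_pdivrMr// ler_pdivlMr// mulN1r mul1r -ler_norml.
by rewrite -sqrtr_sqr ler_sqrt ?addr_ge0 ?sqr_ge0// lerDl sqr_ge0.
Qed.

Lemma cos_carg u : u != 0 -> cos (carg u) = Re u / cmod u.
Proof.
move=> u0; have hu := Re_cmod_itv u0.
by rewrite /carg; case: ifP => _; rewrite ?cosN acosK.
Qed.

Lemma sin_carg u : u != 0 -> sin (carg u) = Im u / cmod u.
Proof.
move=> u0; have hu := Re_cmod_itv u0; have c0 := cmod_gt0 u0.
have e : 1 - (Re u / cmod u) ^+ 2 = (Im u / cmod u) ^+ 2.
  have c1 : cmod u != 0 by rewrite gt_eqF.
  rewrite !expr_div_n -[X in X - _](@divff _ (cmod u ^+ 2)) ?sqrf_eq0//.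
  by rewrite -mulrBl sqr_cmod addrAC subrr add0r.
rewrite /carg; case: ifPn => [I0|]; rewrite ?sinN sin_acos// e sqrtr_sqr.
  by rewrite ger0_norm// divr_ge0// ltW.
by rewrite -ltNge => I0; rewrite ltr0_norm ?opprK// pmulr_llt0 ?invr_gt0.
Qed.

Lemma clogK u : u != 0 -> cexp (clog u) = u.
Proof.
move=> u0; have c0 := cmod_gt0 u0.
rewrite /cexp /clog/= lnK ?posrE// cos_carg// sin_carg//.
by apply: eq_complexE => /=; rewrite mulrCA divff ?mulr1// gt_eqF.
Qed.

(* The plane slit along the half-line where the principal branch jumps. *)
Definition slit u := 0 < Re u \/ Im u != 0.

Lemma slit_neq0 u : slit u -> u != 0.
Proof.
move=> su; apply/eqP => u0; move: su; rewrite u0 /slit /= ltxx eqxx.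
by case.
Qed.

(** The value pi is reached only on the negative half-line, which the slit removes. Strictness puts
    half the argument in ]-pi/2, pi/2[, hence the principal square root in the open right
    half-plane. *)
Lemma carg_itv u : slit u -> - pi < carg u < pi.
Proof.
move=> su; have u0 := slit_neq0 su.
have hu := Re_cmod_itv u0; have c0 := cmod_gt0 u0.
have lt_pi : acos (Re u / cmod u) < pi.
  rewrite lt_neqAle acos_lepi// andbT; apply/eqP => api.
  have := cos_carg u0; have := sin_carg u0.
  rewrite /carg api; case: ifP => _; rewrite ?sinN ?cosN sinpi cospi ?oppr0 => h1 h2.
    move/eqP: h1; rewrite eq_sym mulf_eq0 invr_eq0 (gt_eqF c0) orbF => /eqP I0.
    case: su; rewrite ?I0 ?eqxx// => R0.
    by have := divr_gt0 R0 c0; rewrite -h2; lra.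
  move/eqP: h1; rewrite eq_sym mulf_eq0 invr_eq0 (gt_eqF c0) orbF => /eqP I0.
  case: su; rewrite ?I0 ?eqxx// => R0.
  by have := divr_gt0 R0 c0; rewrite -h2; lra.
have := acos_ge0 hu; have := pi_gt0 R.
by rewrite /carg; case: ifP => _; lra.
Qed.

(** The principal inverse square root u^(-1/2). The exponent N G / 2 attaches the factor -1/2 to
    each logarithm, so every eigenvalue contributes one such root. *)
Definition csqi u : R[i] := cexp (- (2^-1)%:C * clog u).

Lemma csqi_sqr u : u != 0 -> csqi u ^+ 2 * u = 1.
Proof.
move=> u0; rewrite /csqi expr2 -cexpD -mulrDl -[X in _ * X]clogK// -cexpD.
rewrite (_ : _ + _ = 0) ?cexp0//; apply: eq_complexE; rewrite !complexE /=; lra.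
Qed.

Lemma Re_csqi_gt0 u : slit u -> 0 < Re (csqi u).
Proof.
move=> su; rewrite /csqi /cexp/= mulr_gt0 ?expR_gt0//.
have /andP[h1 h2] := carg_itv su.
by apply: cos_gt0_pihalf; rewrite !(mul0r, addr0, oppr0, subr0); lra.
Qed.

(** The two inverse square roots of u are opposite, and only one lies in the right half-plane. This
    replaces all later computation with arguments. *)
Lemma csqi_unique u r : slit u -> r ^+ 2 * u = 1 -> 0 < Re r -> r = csqi u.
Proof.
move=> su ru r0; have u0 := slit_neq0 su; have s0 := Re_csqi_gt0 su.
have : r ^+ 2 = csqi u ^+ 2 by apply: (mulIf u0); rewrite ru csqi_sqr.
move/eqP; rewrite eqf_sqr => /orP[/eqP//|/eqP rE].
by move: r0; rewrite rE cReN oppr_gt0 ltNge (ltW s0).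
Qed.

(** With q = [csqi u], the square q^2 = 1/u has positive real part (Re q)^2 - (Im q)^2. *)
Lemma Re_csqi_gt_Im u : 0 < Re u -> `|Im (csqi u)| < Re (csqi u).
Proof.
move=> u0; have su : slit u by left.
have s0 := Re_csqi_gt0 su; have un0 := slit_neq0 su.
have := csqi_sqr un0; move: s0; move: (csqi u) => q s0 h.
rewrite -[ltRHS]gtr0_norm// -ltr_sqr ?nnegrE// !real_normK ?num_real//.
have h1 := congr1 Re h; have h2 := congr1 Im h.
move: h1 h2; rewrite expr2 !complexE /=.
move: u0 s0; move: (Re q) (Im q) (Re u) (Im u) => a b c e u0 s0 h1 h2.
have : (a ^+ 2 - b ^+ 2) * (c ^+ 2 + e ^+ 2) = c.
  transitivity (c * 1 + e * 0); last by ring.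
  rewrite -[in c * 1]h1 -[in e * 0]h2; ring.
move=> h3; rewrite -subr_gt0.
by rewrite -(pmulr_lgt0 _ (_ : 0 < c ^+ 2 + e ^+ 2)) ?h3// ltr_wpDr ?sqr_ge0// exprn_gt0.
Qed.

(* Both factors lie in the sector |Im| < Re, so that the product has positive
   real part: this is why the principal square roots multiply. *)
Lemma csqiM u v : 0 < Re u -> 0 < Re v -> slit (u * v) ->
  csqi (u * v) = csqi u * csqi v.
Proof.
move=> u0 v0 suv; apply/esym/csqi_unique => //.
  have su : slit u by left. have sv : slit v by left.
  have h1 := csqi_sqr (slit_neq0 su); have h2 := csqi_sqr (slit_neq0 sv).
  transitivity ((csqi u ^+ 2 * u) * (csqi v ^+ 2 * v)); first by ring.
  by rewrite h1 h2 mulr1.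
have := Re_csqi_gt_Im u0; have := Re_csqi_gt_Im v0.
rewrite cReM subr_gt0 => h1 h2; apply: le_lt_trans (ler_norm _) _; rewrite normrM.
by apply: ltr_pM.
Qed.

End ComplexBasics.

(** * Diagonalisation of real symmetric matrices *)

Section SpectralTheorem.
Variable R : rcfType.

Lemma row_sqrE n (v : 'rV[R]_n) : (v *m v^T) 0 0 = \sum_i v 0 i ^+ 2.
Proof. by rewrite mxE; apply: eq_bigr => i _; rewrite [v^T _ _]mxE expr2. Qed.

Lemma row_sqr_eq0 n (v : 'rV[R]_n) : (v *m v^T) 0 0 = 0 -> v = 0.
Proof.
rewrite row_sqrE => /eqP; rewrite psumr_eq0; last by move=> i _; exact: sqr_ge0.
move=> /allP v0; apply/rowP => j; rewrite [RHS]mxE; apply/eqP.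
by rewrite -sqrf_eq0; apply: (v0 j); rewrite mem_index_enum.
Qed.

(** The Householder reflection along w = v - e exchanges the unit vectors e and v, and is symmetric
    and involutive. Its normalisation q = |w|^2 = 2 - 2a vanishes when v = e, where the identity
    serves. *)
Lemma reflection_to_axis n (v : 'rV[R]_n.+1) : v *m v^T = 1%:M ->
  exists Q : 'M[R]_n.+1,
    [/\ Q^T = Q, Q *m Q = 1%:M & delta_mx 0 0 *m Q = v].
Proof.
move=> vv; pose e : 'rV[R]_n.+1 := delta_mx 0 0.
have ee : e *m e^T = 1%:M.
  by rewrite /e trmx_delta mul_delta_mx; apply/matrixP => i j;
     rewrite !mxE !ord1 !eqxx.
have eve : e *m v^T = v *m e^T.
  by apply/matrixP => i j; rewrite !ord1 -[e *m _]trmxK trmx_mul trmxK mxE.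
have [w wE] : exists w, w = v - e by exists (v - e).
pose a := (v *m e^T) 0 0; pose q := 2 - 2 * a.
have ve : v *m e^T = a%:M by rewrite [LHS]mx11_scalar.
have ww : w *m w^T = q%:M.
  rewrite wE linearB/= mulmxBl !mulmxBr vv ee eve ve.
  by apply/matrixP => i j; rewrite !ord1 !mxE/= /q; ring.
have ew : e *m w^T = (a - 1)%:M.
  by rewrite wE linearB/= mulmxBr ee eve ve; apply/matrixP => i j; rewrite !ord1 !mxE/=.
have [q0|q0] := eqVneq q 0.
  exists 1%:M; rewrite trmx1 !mul1mx mulmx1; split=> //.
  have w0 : w = 0.
    by apply: row_sqr_eq0; rewrite ww q0 !mxE.
  by apply/eqP; rewrite eq_sym -subr_eq0 -wE w0.
exists (1%:M - (2 / q) *: (w^T *m w)); split.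
- by rewrite linearB linearZ/= trmx_mul trmxK trmx1.
- rewrite mulmxBl !mulmxBr !mul1mx mulmx1 -!scalemxAl -!scalemxAr.
  rewrite mulmxA -(mulmxA w^T) ww mul_mx_scalar -scalemxAl !scalerA.
  have sq : 2 / q * q = 2 by rewrite divfK.
  rewrite sq; set s := 2 / q; rewrite mulr_natr mulr2n scalerDl.
  by rewrite opprB addrK subrK.
- rewrite mulmxBr mulmx1 -scalemxAr mulmxA ew mul_scalar_mx scalerA.
  have -> : 2 / q * (a - 1) = -1 by move: q0; rewrite /q => q0; field.
  by rewrite scaleN1r opprK wE addrC subrK.
Qed.

(** Deflation: reflecting the first axis onto a unit eigenvector for [lam ord0] clears the first row
    of M off the diagonal, and by symmetry the first column. The remaining block is symmetric, with
    the remaining roots. Since [lam] is prescribed, the diagonal comes out in the given order and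
    with multiplicities. *)
Lemma symmetric_spectral n (M : 'M[R]_n) (lam : 'I_n -> R) :
  M^T = M -> char_poly M = \prod_(i < n) ('X - (lam i)%:P) ->
  exists U : 'M[R]_n,
    U *m U^T = 1%:M /\ M = U^T *m diag_mx (\row_i lam i) *m U.
Proof.
elim: n => [|n IHn] in M lam *.
  by move=> _ _; exists 1%:M; split; apply/matrixP => -[].
move=> Msym chM.
have : eigenvalue M (lam ord0).
  rewrite eigenvalue_root_char chM; apply/rootP.
  by rewrite horner_prod big_ord_recl hornerXsubC subrr mul0r.
case/eigenvalueP => v0 v0M v0_neq0.
pose r := Num.sqrt ((v0 *m v0^T) 0 0).
have vv_gt0 : 0 < (v0 *m v0^T) 0 0.
  rewrite lt_neqAle [leRHS]row_sqrE sumr_ge0 ?andbT; last by move=> k _; exact: sqr_ge0.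
  by apply: contra_neqN v0_neq0 => /eqP/esym; exact: row_sqr_eq0.
have r_gt0 : 0 < r by rewrite sqrtr_gt0.
pose v := r^-1 *: v0.
have vM : v *m M = lam ord0 *: v by rewrite -scalemxAl v0M !scalerA mulrC.
have vv : v *m v^T = 1%:M.
  rewrite linearZ/= -scalemxAl -scalemxAr [v0 *m _]mx11_scalar !scalerA scale_scalar_mx.
  rewrite -[X in _ * X]sqr_sqrtr ?ltW// -/r.
  by congr (_%:M); field; rewrite gt_eqF.
have [Q [Qt QQ eQ]] := reflection_to_axis vv.
(* [A] is made opaque and typed at [1 + n] so that it can be cut into blocks. *)
have [A AQ] : exists A : 'M[R]_(1 + n), A = Q *m M *m Q by exists (Q *m M *m Q).
have At : A^T = A by rewrite AQ !trmx_mul Qt Msym mulmxA.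
have rA : row 0 A = lam ord0 *: delta_mx 0 0.
  rewrite rowE AQ 2!mulmxA eQ vM -scalemxAl; congr (_ *: _).
  by rewrite -eQ -mulmxA QQ mulmx1.
pose A' : 'M[R]_n := drsubmx A.
have AE : A = block_mx (lam ord0)%:M 0 0 A'.
  rewrite -[LHS]submxK; congr block_mx.
  - apply/matrixP => i j; rewrite !ord1 !mxE.
    have /matrixP/(_ 0 0) := rA; rewrite !mxE/= mulr1 mulr1n => <-.
    by congr (A _ _); exact/val_inj.
  - apply/matrixP => i j; rewrite !ord1 [RHS]mxE.
    have /matrixP/(_ 0 (rshift 1 j)) := rA; rewrite !mxE/= mulr0 => <-.
    by congr (A _ _); exact/val_inj.
  - apply/matrixP => i j; rewrite !ord1 [RHS]mxE -At !mxE.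
    have /matrixP/(_ 0 (rshift 1 i)) := rA; rewrite !mxE/= mulr0 => <-.
    by congr (A _ _); exact/val_inj.
have MA : M = Q *m A *m Q.
  by rewrite AQ !mulmxA QQ mul1mx -mulmxA QQ mulmx1.
have A't : A'^T = A'.
  by rewrite /A' trmx_drsub At.
have chA : char_poly A = char_poly M.
  rewrite MA /char_poly /char_poly_mx !map_mxM.
  have QQp : map_mx polyC Q *m map_mx polyC Q = 1%:M by rewrite -map_mxM QQ map_mx1.
  rewrite (_ : 'X%:M - _ = map_mx polyC Q *m ('X%:M - map_mx polyC A) *m map_mx polyC Q).
    by rewrite !det_mulmx mulrAC -det_mulmx QQp det1 mul1r.
  rewrite mulmxBr mulmxBl; congr (_ - _).
  by rewrite mul_mx_scalar -scalemxAl QQp scalemx1.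
have chA' : char_poly A' = \prod_(i < n) ('X - (lam (lift ord0 i))%:P).
  have : char_poly A = ('X - (lam ord0)%:P) * char_poly A'.
    rewrite AE /char_poly (char_block_diag_mx (lam ord0)%:M A') det_ublock; congr (_ * _).
    by rewrite /char_poly_mx det_mx11 !mxE/= !mulr1n.
  have X0 : 'X - (lam ord0)%:P != 0 by rewrite polyXsubC_eq0.
  by rewrite chA chM big_ord_recl => /(mulfI X0).
have [U' [U'U' A'E]] := IHn _ _ A't chA'.
pose V : 'M[R]_(1 + n) := block_mx 1%:M 0 0 U'.
have Vt : V^T = block_mx 1%:M 0 0 U'^T by rewrite /V tr_block_mx trmx1 !trmx0.
exists (V *m Q); split.
  rewrite trmx_mul Qt mulmxA -(mulmxA V) QQ mulmx1 Vt.
  rewrite [LHS](@mulmx_block _ 1 n 1 n 1 n) U'U'.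
  by rewrite !mulmx0 !mul0mx mulmx1 !addr0 add0r -scalar_mx_block.
rewrite MA trmx_mul Qt !mulmxA; congr (_ *m _); rewrite -!mulmxA; congr (_ *m _).
rewrite AE Vt; have -> : diag_mx (\row_i lam i) =
    block_mx (lam ord0)%:M 0 0 (diag_mx (\row_i lam (lift ord0 i))) :> 'M[R]_(1 + n).
  have -> : \row_i lam i = row_mx (lam ord0)%:M (\row_i lam (lift ord0 i)).
    apply/matrixP => i j; rewrite !mxE; case: splitP => k jk; rewrite !mxE.
      rewrite (ord1 i) (ord1 k) eqxx mulr1n; congr lam; apply/val_inj.
      by rewrite /= jk ord1.
    by congr lam; apply/val_inj; rewrite /= jk.
  rewrite [LHS](@diag_mx_row _ n 1); congr block_mx.
  by apply/matrixP => i j; rewrite !ord1 !mxE.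
rewrite /V [X in _ *m X](@mulmx_block _ 1 n 1 n 1 n) [RHS](@mulmx_block _ 1 n 1 n 1 n).
rewrite !mulmx0 !mul0mx !addr0 !add0r !mul1mx mulmx1.
by rewrite A'E -mulmxA mulmx0.
Qed.

End SpectralTheorem.

(** * Complex-valued integrals and derivatives *)

Lemma measurable_cos (R : realType) : measurable_fun setT (@cos R).
Proof. by apply: continuous_measurable_fun; exact: continuous_cos. Qed.

Lemma measurable_sin (R : realType) : measurable_fun setT (@sin R).
Proof. by apply: continuous_measurable_fun; exact: continuous_sin. Qed.

Section ComplexIntegral.
Context d (T : measurableType d) (R : realType) (mu : {measure set T -> \bar R}).
Implicit Types (f g : T -> R[i]) (c : R[i]).

(** Componentwise, to agree with [segment_integral], which integrates real and imaginary parts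
    separately. *)
Definition cintegrable f : Prop :=
  mu.-integrable setT (fun x => (Re (f x))%:E) /\
  mu.-integrable setT (fun x => (Im (f x))%:E).

Definition cint f : R[i] := (\int[mu]_x Re (f x)) +i* (\int[mu]_x Im (f x)).

Definition cmeasurable f : Prop :=
  measurable_fun setT (fun x => Re (f x)) /\ measurable_fun setT (fun x => Im (f x)).

Lemma cintegrable_measurable f : cintegrable f -> cmeasurable f.
Proof.
by move=> [/integrableP[/measurable_EFinP + _] /integrableP[/measurable_EFinP]].
Qed.

Lemma eq_cint f g : f =1 g -> cint f = cint g.
Proof. by move=> fg; congr cint; exact/funext. Qed.

Lemma cmeasurableM f g : cmeasurable f -> cmeasurable g ->
  cmeasurable (fun x => f x * g x).
Proof.
move=> [f1 f2] [g1 g2]; split.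
  under eq_fun do rewrite cReM.
  by apply: measurable_funB; exact: measurable_funM.
under eq_fun do rewrite cImM.
by apply: measurable_funD; exact: measurable_funM.
Qed.

Lemma cmeasurableD f g : cmeasurable f -> cmeasurable g ->
  cmeasurable (fun x => f x + g x).
Proof.
move=> [f1 f2] [g1 g2]; split.
  by under eq_fun do rewrite cReD; exact: measurable_funD.
by under eq_fun do rewrite cImD; exact: measurable_funD.
Qed.

Lemma cmeasurable_cst c : cmeasurable (fun=> c).
Proof. by split; exact: measurable_cst. Qed.

Lemma cmeasurable_cexp f : cmeasurable f -> cmeasurable (fun x => cexp (f x)).
Proof.
move=> [f1 f2]; split; apply: measurable_funM.
- by apply: (measurableT_comp _ f1); exact: measurable_expR.
- by apply: (measurableT_comp _ f2); exact: measurable_cos.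
- by apply: (measurableT_comp _ f1); exact: measurable_expR.
- by apply: (measurableT_comp _ f2); exact: measurable_sin.
Qed.

Lemma le_cintegrable f (g : T -> R) : cmeasurable f ->
  (forall x, `|Re (f x)| <= g x) -> (forall x, `|Im (f x)| <= g x) ->
  mu.-integrable setT (EFin \o g) -> cintegrable f.
Proof.
move=> [f1 f2] h1 h2 ig; split; apply: (le_integrable measurableT _ _ ig).
- exact/measurable_EFinP.
- by move=> x _; rewrite lee_fin; apply: le_trans (h1 x) (ler_norm _).
- exact/measurable_EFinP.
- by move=> x _; rewrite lee_fin; apply: le_trans (h2 x) (ler_norm _).
Qed.

Lemma integrableM_le1 (A : set T) (f k : T -> R) : measurable A ->
  mu.-integrable A (EFin \o f) -> measurable_fun setT k -> (forall x, `|k x| <= 1) ->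
  mu.-integrable A (EFin \o (fun x => f x * k x)).
Proof.
move=> mA fi mk k1; apply: (le_integrable mA _ _ fi).
  apply/measurable_EFinP; apply: measurable_funM; last exact: measurable_funTS.
  by apply/measurable_EFinP; exact: measurable_int fi.
by move=> x _; rewrite lee_fin normrM ler_piMr.
Qed.

Lemma integrable_linear (a b : R) (f g : T -> R) :
  mu.-integrable setT (fun x => (f x)%:E) ->
  mu.-integrable setT (fun x => (g x)%:E) ->
  mu.-integrable setT (fun x => (a * f x + b * g x)%:E) /\
  \int[mu]_x (a * f x + b * g x) = a * \int[mu]_x f x + b * \int[mu]_x g x.
Proof.
move=> h1 h2.
have i1 : mu.-integrable setT (EFin \o (fun x => a * f x)).
  by rewrite /comp; under eq_fun do rewrite EFinM; exact: integrableZl.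
have i2 : mu.-integrable setT (EFin \o (fun x => b * g x)).
  by rewrite /comp; under eq_fun do rewrite EFinM; exact: integrableZl.
split; first by under eq_fun do rewrite EFinD; exact: integrableD.
by rewrite RintegralD// !RintegralZl.
Qed.

Lemma cintegrableZ c f : cintegrable f -> cintegrable (fun x => c * f x).
Proof.
move=> [h1 h2]; split.
  under eq_fun do rewrite cReM -mulNr.
  by case: (integrable_linear (Re c) (- Im c) h1 h2).
under eq_fun do rewrite cImM.
by case: (integrable_linear (Re c) (Im c) h2 h1).
Qed.

Lemma cintZ c f : cintegrable f -> cint (fun x => c * f x) = c * cint f.
Proof.
move=> [h1 h2]; apply: eq_complexE; rewrite ?cReM ?cImM /cint /=.
  under eq_Rintegral do rewrite cReM -mulNr.
  by case: (integrable_linear (Re c) (- Im c) h1 h2) => _ ->; rewrite mulNr.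
under eq_Rintegral do rewrite cImM.
by case: (integrable_linear (Re c) (Im c) h2 h1).
Qed.

Lemma cintegrableD f g : cintegrable f -> cintegrable g ->
  cintegrable (fun x => f x + g x).
Proof.
move=> [h1 h2] [h3 h4]; split.
  by under eq_fun do rewrite cReD EFinD; exact: integrableD.
by under eq_fun do rewrite cImD EFinD; exact: integrableD.
Qed.

Lemma cintD f g : cintegrable f -> cintegrable g ->
  cint (fun x => f x + g x) = cint f + cint g.
Proof.
move=> [h1 h2] [h3 h4]; apply: eq_complexE; rewrite ?cReD ?cImD /cint /=.
  by under eq_Rintegral do rewrite cReD; rewrite RintegralD.
by under eq_Rintegral do rewrite cImD; rewrite RintegralD.
Qed.

End ComplexIntegral.

(** * Derivatives of complex-valued functions of a real variable *)

Section ComplexDerive.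
Variable R : realType.
Implicit Types (f g : R -> R[i]) (l m : R[i]).

Let is_derive_mulf (u v : R -> R) (x a b : R) : is_derive x 1 u a ->
  is_derive x 1 v b -> is_derive x 1 (fun s => u s * v s) (u x * b + a * v x).
Proof.
move=> ua vb; have -> : (fun s => u s * v s) = u * v by [].
by apply: is_derive_eq; rewrite /GRing.scale/= [X in _ + X]mulrC.
Qed.

Let is_derive_addf (u v : R -> R) (x a b : R) : is_derive x 1 u a ->
  is_derive x 1 v b -> is_derive x 1 (fun s => u s + v s) (a + b).
Proof.
by move=> ua vb; have -> : (fun s => u s + v s) = u + v by []; exact: is_deriveD.
Qed.

Let is_derive_subf (u v : R -> R) (x a b : R) : is_derive x 1 u a ->
  is_derive x 1 v b -> is_derive x 1 (fun s => u s - v s) (a - b).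
Proof.
by move=> ua vb; have -> : (fun s => u s - v s) = u - v by []; exact: is_deriveB.
Qed.

Definition is_cderive f (x : R) l : Prop :=
  is_derive x 1 (fun s => Re (f s)) (Re l) /\
  is_derive x 1 (fun s => Im (f s)) (Im l).

Lemma is_cderive_eq f x l m : is_cderive f x l -> l = m -> is_cderive f x m.
Proof. by move=> ? <-. Qed.

Lemma is_cderive_cst l x : is_cderive (fun=> l) x 0.
Proof. by split; exact: is_derive_cst. Qed.

Lemma is_cderiveD f g x l m : is_cderive f x l -> is_cderive g x m ->
  is_cderive (fun s => f s + g s) x (l + m).
Proof.
move=> [f1 f2] [g1 g2]; split; rewrite ?cReD ?cImD.
  by under eq_fun do rewrite cReD; exact: is_derive_addf.
by under eq_fun do rewrite cImD; exact: is_derive_addf.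
Qed.

Lemma is_cderiveM f g x l m : is_cderive f x l -> is_cderive g x m ->
  is_cderive (fun s => f s * g s) x (f x * m + l * g x).
Proof.
move=> [f1 f2] [g1 g2]; split.
  under eq_fun do rewrite cReM.
  refine (is_derive_eq (is_derive_subf (is_derive_mulf f1 g1) (is_derive_mulf f2 g2)) _).
  by rewrite !complexE; ring.
under eq_fun do rewrite cImM.
refine (is_derive_eq (is_derive_addf (is_derive_mulf f1 g2) (is_derive_mulf f2 g1)) _).
by rewrite !complexE; ring.
Qed.

Lemma is_cderive_id x : is_cderive (fun s => s%:C) x 1.
Proof. by split; [exact: is_derive_id|exact: is_derive_cst]. Qed.

Lemma is_cderive_cexp f x l : is_cderive f x l ->
  is_cderive (fun s => cexp (f s)) x (l * cexp (f x)).
Proof.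
move=> [f1 f2].
have e1 := is_derive1_comp (is_derive_expR (Re (f x))) f1.
have e2 := is_derive1_comp (is_derive_cos (Im (f x))) f2.
have e3 := is_derive1_comp (is_derive_sin (Im (f x))) f2.
split; rewrite /cexp /=.
  refine (is_derive_eq (is_derive_mulf e1 e2) _).
  by rewrite /= !complexE /=; ring.
refine (is_derive_eq (is_derive_mulf e1 e3) _).
by rewrite /= !complexE /=; ring.
Qed.

Lemma is_cderive_0_cst f x y : (forall s, is_cderive f s 0) -> f x = f y.
Proof.
move=> h; apply: eq_complexE.
  by apply: (@is_derive_0_is_cst _ (fun s => Re (f s))) => s; case: (h s).
by apply: (@is_derive_0_is_cst _ (fun s => Im (f s))) => s; case: (h s).
Qed.

Lemma is_cderive_continuous f x l : is_cderive f x l ->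
  {for x, continuous (fun s => Re (f s))} /\ {for x, continuous (fun s => Im (f s))}.
Proof.
by move=> [f1 f2]; split; apply/differentiable_continuous/derivable1_diffP;
  exact: ex_derive.
Qed.

End ComplexDerive.

(** * Differentiation under a complex integral *)

Section DifferentiationUnderCint.
Context d (T : measurableType d) (R : realType) (mu : {measure set T -> \bar R}).

Lemma is_derive_under_integral (f df : R -> T -> R) (x : R) (G : T -> R) :
  (forall s, x - 1 < s < x + 1 -> mu.-integrable setT (EFin \o f s)) ->
  (forall (s : R) y, is_derive s 1 (f ^~ y : R -> R) (df s y)) ->
  (forall y, 0 <= G y) -> mu.-integrable setT (EFin \o G) ->
  (forall s y, x - 1 < s < x + 1 -> `|df s y| <= G y) ->
  is_derive x 1 (fun s : R => \int[mu]_y f s y : R) (\int[mu]_y df x y).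
Proof.
move=> fi fd G0 Gi Gb.
have I s : `]x - 1, x + 1[%classic s <-> x - 1 < s < x + 1 by rewrite /= in_itv.
have xI : `]x - 1, x + 1[%classic x by apply/I; lra.
have fi' s : `]x - 1, x + 1[%classic s -> mu.-integrable setT (EFin \o f s).
  by move=> /I; exact: fi.
have fd' s y : `]x - 1, x + 1[%classic s -> setT y -> derivable (f ^~ y) s 1.
  by move=> _ _; apply: ex_derive.
have pE s y : partial1of2 f s y = df s y.
  by rewrite partial1of2E; apply: derive_val.
have Gb' s y : `]x - 1, x + 1[%classic s -> setT y -> `|partial1of2 f s y| <= G y.
  by move=> /I + _; rewrite pE; exact: Gb.
apply: DeriveDef.
  exact: (derivable_under_integral measurableT xI fi' fd' G0 Gi Gb').
rewrite -derive1E (differentiation_under_integral measurableT xI fi' fd' G0 Gi Gb').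
by apply: eq_Rintegral => y _; exact: pE.
Qed.

(** A single [G] dominates both the integrand and its derivative in s. For |s - x| < 1 the real
    exponent is at most Re A + (|x| + 1) |Re B|, and the factor 1 + |Re B| + |Im B| covers the
    constant 1 as well as the B brought down by differentiation. *)
Lemma is_cderive_cint_cexp (A B : T -> R[i]) (x : R) (G : T -> R) :
  cmeasurable A -> cmeasurable B ->
  (forall y, expR (Re (A y) + (`|x| + 1) * `|Re (B y)|) *
             (1 + `|Re (B y)| + `|Im (B y)|) <= G y) ->
  mu.-integrable setT (EFin \o G) ->
  is_cderive (fun s => cint mu (fun y => cexp (A y + s%:C * B y))) x
    (cint mu (fun y => B y * cexp (A y + x%:C * B y))).
Proof.
move=> mA mB GB Gi.
have le1 s y : x - 1 < s < x + 1 ->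
    expR (Re (A y + s%:C * B y)) <= expR (Re (A y) + (`|x| + 1) * `|Re (B y)|).
  move=> sx; rewrite ler_expR cReD cReMl lerD2l.
  apply: le_trans (ler_norm _) _; rewrite normrM ler_wpM2r//.
  have : `|s - x| <= 1 by rewrite ler_norml; lra.
  have := ler_normD (s - x) x; rewrite subrK; lra.
have G0 y : 0 <= G y.
  by apply: le_trans (GB y); rewrite mulr_ge0 ?expR_ge0// !addr_ge0.
have le2 s y : x - 1 < s < x + 1 -> expR (Re (A y + s%:C * B y)) <= G y.
  move=> sx; apply: le_trans (le1 _ _ sx) (le_trans _ (GB y)).
  by rewrite ler_peMr ?expR_ge0// -addrA lerDl addr_ge0.
have mE s : cmeasurable (fun y => cexp (A y + s%:C * B y)).
  apply: cmeasurable_cexp; apply: cmeasurableD => //; apply: cmeasurableM => //.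
have iE s : x - 1 < s < x + 1 -> cintegrable mu (fun y => cexp (A y + s%:C * B y)).
  move=> sx; apply: le_cintegrable Gi => // y; apply: le_trans (le2 s y sx).
    exact: norm_Re_cexp.
  exact: norm_Im_cexp.
have dE s y : is_cderive (fun s => cexp (A y + s%:C * B y)) s (B y * cexp (A y + s%:C * B y)).
  apply: is_cderive_cexp; apply: is_cderive_eq.
    apply: is_cderiveD; first exact: is_cderive_cst.
    by apply: is_cderiveM; [exact: is_cderive_id|exact: is_cderive_cst].
  by rewrite mulr0 mul1r !add0r.
have bE s y : x - 1 < s < x + 1 ->
    (`|Re (B y)| + `|Im (B y)|) * expR (Re (A y + s%:C * B y)) <= G y.
  move=> sx; apply: le_trans (GB y); rewrite mulrC.
  apply: ler_pM; rewrite ?expR_ge0 ?addr_ge0//; first exact: le1.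
  by rewrite -addrA lerDr.
split.
- apply: (is_derive_under_integral (f := fun s y => Re (cexp (A y + s%:C * B y)))
     (df := fun s y => Re (B y * cexp (A y + s%:C * B y)))) G0 Gi _.
  + by move=> s /iE[].
  + by move=> s y; case: (dE s y).
  + by move=> s y sx; apply: le_trans (norm_ReM_cexp _ _) (bE s y sx).
- apply: (is_derive_under_integral (f := fun s y => Im (cexp (A y + s%:C * B y)))
     (df := fun s y => Im (B y * cexp (A y + s%:C * B y)))) G0 Gi _.
  + by move=> s /iE[].
  + by move=> s y; case: (dE s y).
  + by move=> s y sx; apply: le_trans (norm_ImM_cexp _ _) (bE s y sx).
Qed.

End DifferentiationUnderCint.

(** * Complex Gaussian integrals *)

Section ComplexGaussian.
Variable R : realType.
Local Notation RT := (measurableTypeR R).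
Local Notation leb := (@lebesgue_measure R).

(** Real Gaussian integrals are read off the normal density of variance 1/(2a). *)
Lemma gauss_normal_pdf (a : R) : 0 < a -> exists s : R, s != 0 /\
  forall x, expR (- (a * x ^+ 2)) = Num.sqrt (pi / a) * normal_pdf 0 s x.
Proof.
move=> a0; pose s := Num.sqrt (2 * a)^-1; exists s.
have s2 : s ^+ 2 = (2 * a)^-1 by rewrite sqr_sqrtr// invr_ge0 mulr_ge0// ltW.
have s0 : s != 0 by rewrite gt_eqF// sqrtr_gt0 invr_gt0 mulr_gt0.
split=> // x; rewrite normal_pdfE// /normal_peak /normal_fun s2 subr0.
rewrite (_ : _ *+ 2 = pi / a); last by rewrite -mulr_natr; field; rewrite gt_eqF.
rewrite mulVKf; last by rewrite gt_eqF// sqrtr_gt0 divr_gt0// pi_gt0.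
by congr expR; rewrite -mulr_natr; field; rewrite gt_eqF.
Qed.

Lemma integrable_gauss (a : R) : 0 < a ->
  leb.-integrable setT (EFin \o (fun x : RT => expR (- (a * x ^+ 2)))).
Proof.
move=> /gauss_normal_pdf[s [s0 gE]].
rewrite /comp; under eq_fun do rewrite gE EFinM.
exact: integrableZl (integrable_normal_pdf 0 s).
Qed.

Lemma integral_gauss (a : R) : 0 < a ->
  (\int[leb]_x (expR (- (a * x ^+ 2)))%:E = (Num.sqrt (pi / a))%:E)%E.
Proof.
move=> /gauss_normal_pdf[s [s0 gE]].
under eq_integral do rewrite gE EFinM.
rewrite integralZl//; last exact: integrable_normal_pdf.
by rewrite integral_normal_pdf mule1.
Qed.

(** Half of the decay rate a is spent: a/4 absorbs 1 + x^2, through y <= exp y, and a/4 absorbs the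
    linear term, by completing the square. The rate a/2 remains. *)
Lemma gauss_dominated (a B x : R) : 0 < a ->
  (1 + x ^+ 2) * expR (- (a * x ^+ 2) + B * `|x|) <=
  (1 + 4 / a) * expR (B ^+ 2 / a) * expR (- (a / 2 * x ^+ 2)).
Proof.
move=> a0.
have h1 : 1 + x ^+ 2 <= (1 + 4 / a) * expR (a / 4 * x ^+ 2).
  have h := expR_ge1Dx (a / 4 * x ^+ 2).
  have h0 : 0 <= a / 4 * x ^+ 2 by rewrite mulr_ge0 ?sqr_ge0// divr_ge0// ltW.
  rewrite mulrDl mul1r lerD//; first lra.
  rewrite -[leLHS](_ : 4 / a * (a / 4 * x ^+ 2) = _); last by field; rewrite gt_eqF.
  by rewrite ler_wpM2l ?divr_ge0// ?ltW//; lra.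
have h2 : B * `|x| <= a / 4 * x ^+ 2 + B ^+ 2 / a.
  rewrite -[x ^+ 2]real_normK ?num_real//; move: `|x| => y.
  have : 0 <= (a * y / 2 - B) ^+ 2 / a by rewrite divr_ge0 ?sqr_ge0// ltW.
  rewrite (_ : _ / a = a / 4 * y ^+ 2 + B ^+ 2 / a - B * y); last by field; rewrite gt_eqF.
  by rewrite subr_ge0.
apply: (@le_trans _ _ ((1 + 4 / a) * expR (a / 4 * x ^+ 2) *
    expR (- (a * x ^+ 2) + (a / 4 * x ^+ 2 + B ^+ 2 / a)))).
  apply: ler_pM; rewrite ?expR_ge0 ?addr_ge0 ?sqr_ge0//.
  by rewrite ler_expR lerD2l.
rewrite -!mulrA ler_wpM2l//; first by rewrite addr_ge0// divr_ge0// ltW.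
rewrite -!expRD ler_expR le_eqVlt; apply/orP; left; apply/eqP; field.
by rewrite gt_eqF.
Qed.

Lemma integrable_gauss_dominated (a B : R) : 0 < a ->
  leb.-integrable setT (EFin \o (fun x : RT =>
    (1 + 4 / a) * expR (B ^+ 2 / a) * expR (- (a / 2 * x ^+ 2)))).
Proof.
move=> a0; rewrite /comp; under eq_fun do rewrite EFinM.
by apply: integrableZl => //; apply: integrable_gauss; rewrite divr_gt0.
Qed.

Lemma cvg_gauss0 (a : R) : 0 < a ->
  expR (- (a * n%:R ^+ 2)) @[n --> \oo] --> (0 : R).
Proof.
move=> a0; apply: (@squeeze_cvgr _ _ _ _ (fun=> 0) (fun n : nat => 2 / a * harmonic n)).
- near=> n; rewrite expR_ge0/=.
  have n1 : 1 <= n%:R :> R by rewrite ler1n; near: n; exact: nbhs_infty_gt.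
  have n2 : n%:R <= n%:R ^+ 2 :> R by rewrite expr2 ler_peMr// (le_trans _ n1).
  rewrite expRN -[2 / a]invrK -invfM lef_pV2 ?posrE ?expR_gt0//; last first.
    by rewrite mulr_gt0// invr_gt0 divr_gt0.
  apply: le_trans (expR_ge1Dx _).
  rewrite -[leLHS](_ : a / 2 * n.+1%:R = _); last by field; rewrite gt_eqF.
  rewrite -natr1; apply: (@le_trans _ _ (a / 2 * (n%:R ^+ 2 + n%:R ^+ 2))).
    by apply: ler_wpM2l; [rewrite divr_ge0// ltW|lra].
  by rewrite -[leLHS](_ : a * n%:R ^+ 2 = _); [lra|field].
- exact: cvg_cst.
- by rewrite -[X in _ --> X](mulr0 (2 / a)); apply: cvgMr; exact: cvg_harmonic.
Unshelve. all: by end_near. Qed.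

Lemma cvg_Rintegral_symmetric_itv (u : R^nat) (g : RT -> R) :
  u n @[n --> \oo] --> +oo -> leb.-integrable setT (EFin \o g) ->
  \int[leb]_(x in `[- u n, u n]) g x @[n --> \oo] --> \int[leb]_x g x.
Proof.
move=> uy ig; have mg : measurable_fun setT g.
  by apply/measurable_EFinP; exact: measurable_int ig.
under eq_fun do rewrite Rintegral_mkcond.
apply: fine_cvg; rewrite fineK; last exact: integrable_fin_num.
apply: (@dominated_cvg _ _ _ leb setT measurableT
  (fun n x => (((g : R -> R) \_ `[- u n, u n]) x)%:E) _ (fun x => `|(g x)%:E|%E)).
- move=> n; apply/measurable_EFinP; apply/(measurable_restrictT _ _).1 => //.
  exact: measurable_funTS.
- move=> x _; apply: cvg_near_cst; near=> n.
  rewrite patchE mem_set//= in_itv/= -ler_norml.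
  by near: n; move/cvgryPge : uy; exact.
- by move=> x _.
- exact: integrable_abse.
- move=> n x _; rewrite patchE; case: ifP => // _.
  by rewrite abse0.
Unshelve. all: by end_near. Qed.

Lemma Rintegral_itv_derive (F f : R -> R) (a b : R) : a < b ->
  (forall x : R, is_derive x 1 F (f x)) -> continuous f ->
  \int[leb]_(x in `[a, b]) f x = F b - F a.
Proof.
move=> ab dF cf; have cF : continuous F.
  by move=> x; apply/differentiable_continuous/derivable1_diffP; exact: ex_derive.
rewrite /Rintegral (@continuous_FTC2 _ f F)//.
- by apply: continuous_subspaceT => x; exact: cf.
- split.
  + by move=> x _; exact: ex_derive.
  + by apply: cvg_at_right_filter; exact: cF.
  + by apply: cvg_at_left_filter; exact: cF.
- by move=> x _; rewrite derive1E; exact: derive_val.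
Qed.

(** The form in which integration by parts is used: the boundary terms at n and -n decay like a
    Gaussian. *)
Lemma Rintegral_derive_eq0 (G g : R -> R) (C a : R) : 0 < a ->
  (forall x : R, is_derive x 1 G (g x)) -> continuous g ->
  leb.-integrable setT (EFin \o (g : RT -> R)) ->
  (forall x, `|G x| <= C * expR (- (a * x ^+ 2))) ->
  \int[leb]_x g x = 0.
Proof.
move=> a0 dG cg ig Gb.
have h1 := cvg_Rintegral_symmetric_itv cvgr_idn ig.
have h2 : G n%:R - G (- n%:R) @[n --> \oo] --> (0 : R).
  apply: norm_cvg0.
  apply: (@squeeze_cvgr _ _ _ _ (fun=> 0) (fun n : nat => 2 * C * expR (- (a * n%:R ^+ 2)))).
  - near=> n; rewrite normr_ge0/=; apply: le_trans (ler_normB _ _) _.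
    apply: le_trans (lerD (Gb _) (Gb _)) _; rewrite sqrrN; lra.
  - exact: cvg_cst.
  - by rewrite -[X in _ --> X](mulr0 (2 * C)); apply: cvgMr; exact: cvg_gauss0.
suff h3 : \int[leb]_(x in `[- n%:R, n%:R]) g x @[n --> \oo] --> (0 : R).
  exact: (cvg_unique _ h1 h3).
apply: cvg_trans h2; apply: near_eq_cvg; near=> n.
have n0 : 0 < n%:R :> R by rewrite ltr0n; near: n; exact: nbhs_infty_gt.
by rewrite (Rintegral_itv_derive _ dG)//; lra.
Unshelve. all: by end_near. Qed.

(** The derivative [h] of g supplies the continuity of g that the fundamental theorem of calculus
    requires. *)
Lemma cint_cderive_eq0 (G g h : R -> R[i]) (C a : R) : 0 < a ->
  (forall x : R, is_cderive G x (g x)) -> (forall x : R, is_cderive g x (h x)) ->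
  cintegrable leb (g : RT -> R[i]) ->
  (forall x, `|Re (G x)| <= C * expR (- (a * x ^+ 2))) ->
  (forall x, `|Im (G x)| <= C * expR (- (a * x ^+ 2))) ->
  cint leb (g : RT -> R[i]) = 0.
Proof.
move=> a0 dG dg [i1 i2] b1 b2; apply: eq_complexE.
  apply: (@Rintegral_derive_eq0 (fun x => Re (G x)) _ C a) => //.
  - by move=> x; case: (dG x).
  - by move=> x; case: (is_cderive_continuous (dg x)).
apply: (@Rintegral_derive_eq0 (fun x => Im (G x)) _ C a) => //.
- by move=> x; case: (dG x).
- by move=> x; case: (is_cderive_continuous (dg x)).
Qed.

Implicit Types u b : R[i].

Definition gexp u b (x : R) : R[i] := cexp (- u * (x ^+ 2)%:C + b * x%:C).

Lemma is_cderive_gexp u b x :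
  is_cderive (gexp u b) x ((b - 2 * u * x%:C) * gexp u b x).
Proof.
apply: is_cderive_cexp; apply: is_cderive_eq.
  apply: is_cderiveD.
    apply: is_cderiveM; first exact: is_cderive_cst.
    rewrite (_ : (fun s : R => (s ^+ 2)%:C) = (fun s => s%:C * s%:C)).
      apply: is_cderiveM; exact: is_cderive_id.
    by apply/funext => s; rewrite expr2 rmorphM.
  by apply: is_cderiveM; [exact: is_cderive_cst|exact: is_cderive_id].
by rewrite /=; ring.
Qed.

Lemma Re_gexp_exponent u b x :
  Re (- u * (x ^+ 2)%:C + b * x%:C) = - (Re u * x ^+ 2) + Re b * x.
Proof. by rewrite cReD !cReM cReN cImN /=; ring. Qed.

Lemma gexp_le u b x : expR (Re (- u * (x ^+ 2)%:C + b * x%:C)) <=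
  expR (- (Re u * x ^+ 2) + `|Re b| * `|x|).
Proof.
by rewrite Re_gexp_exponent ler_expR lerD2l -normrM ler_norm.
Qed.

Let mx : cmeasurable ((fun x => x%:C) : RT -> R[i]).
Proof. by split => //=; exact: measurable_id. Qed.

Let mx2 : cmeasurable ((fun x => (x ^+ 2)%:C) : RT -> R[i]).
Proof. by split => //=; apply: (@measurable_funX _ _ R). Qed.

Definition gauss_bound u b : R :=
  (1 + 4 / Re u) * expR (`|Re b| ^+ 2 / Re u).

(* Covers [1], [x] and [x ^ 2] times the Gaussian. *)
Lemma cintegrable_gexpM u b (q : R -> R[i]) (c : R) : 0 < Re u ->
  cmeasurable (q : RT -> R[i]) -> 0 <= c ->
  (forall x, `|Re (q x)| + `|Im (q x)| <= c * (1 + x ^+ 2)) ->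
  [/\ cintegrable leb (fun x : RT => q x * gexp u b x),
   forall x, `|Re (q x * gexp u b x)| <=
     c * gauss_bound u b * expR (- (Re u / 2 * x ^+ 2)) &
   forall x, `|Im (q x * gexp u b x)| <=
     c * gauss_bound u b * expR (- (Re u / 2 * x ^+ 2))].
Proof.
move=> u0 mq c0 qb.
have mg : cmeasurable (gexp u b : RT -> R[i]).
  by apply: cmeasurable_cexp; apply: cmeasurableD; apply: cmeasurableM => //;
    exact: cmeasurable_cst.
have E x : (`|Re (q x)| + `|Im (q x)|) * expR (Re (- u * (x ^+ 2)%:C + b * x%:C)) <=
    c * gauss_bound u b * expR (- (Re u / 2 * x ^+ 2)).
  apply: le_trans (_ : c * ((1 + x ^+ 2) * expR (- (Re u * x ^+ 2) + `|Re b| * `|x|)) <= _).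
    rewrite mulrA; apply: ler_pM; rewrite ?expR_ge0 ?addr_ge0//.
    exact: gexp_le.
  by rewrite -mulrA ler_wpM2l// gauss_dominated.
have E1 x : `|Re (q x * gexp u b x)| <= c * gauss_bound u b * expR (- (Re u / 2 * x ^+ 2)).
  exact: le_trans (norm_ReM_cexp _ _) (E x).
have E2 x : `|Im (q x * gexp u b x)| <= c * gauss_bound u b * expR (- (Re u / 2 * x ^+ 2)).
  exact: le_trans (norm_ImM_cexp _ _) (E x).
split=> //; apply: (@le_cintegrable _ RT R leb _ _ _ E1 E2); first exact: cmeasurableM.
rewrite /comp; under eq_fun do rewrite EFinM.
by apply: integrableZl => //; apply: integrable_gauss; rewrite divr_gt0.
Qed.

Lemma sqr_ge_norm (x : R) : `|x| <= 1 + x ^+ 2.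
Proof.
rewrite -[x ^+ 2]real_normK ?num_real//; move: `|x| => y.
have := sqr_ge0 (y - 2^-1); rewrite sqrrB; lra.
Qed.

Let m1 : cmeasurable ((fun=> 1) : RT -> R[i]).
Proof. exact: cmeasurable_cst. Qed.

Let bound0 (x : R) : `|Re (1 : R[i])| + `|Im (1 : R[i])| <= 1 * (1 + x ^+ 2).
Proof. by rewrite /= normr1 normr0 addr0 mul1r lerDl sqr_ge0. Qed.

Let bound1 (x : R) : `|Re x%:C| + `|Im x%:C| <= 1 * (1 + x ^+ 2).
Proof. by rewrite /= normr0 addr0 mul1r sqr_ge_norm. Qed.

Let bound2 (x : R) : `|Re (x ^+ 2)%:C| + `|Im (x ^+ 2)%:C| <= 1 * (1 + x ^+ 2).
Proof. by rewrite /= normr0 addr0 mul1r ger0_norm ?sqr_ge0// lerDr. Qed.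

Lemma cintegrable_gexp u b : 0 < Re u -> cintegrable leb (gexp u b : RT -> R[i]).
Proof.
move=> u0; have [+ _ _] := cintegrable_gexpM b u0 m1 ler01 bound0.
by rewrite (_ : (fun x => 1 * gexp u b x) = gexp u b)//; apply/funext => x; rewrite mul1r.
Qed.

(** The derivative (b - 2 u x) [gexp u b] integrates to zero. This provides the coefficient of the
    differential equation in b that [cint_gexp] solves. *)
Lemma cint_gexp_mul u b : 0 < Re u ->
  cintegrable leb (fun x : RT => x%:C * gexp u b x) /\
  cint leb (fun x : RT => x%:C * gexp u b x) =
    b / (2 * u) * cint leb (gexp u b : RT -> R[i]).
Proof.
move=> u0; have un0 : u != 0 by apply: slit_neq0; left.
have [i1 _ _] := cintegrable_gexpM b u0 mx ler01 bound1.
split=> //; have i0 := cintegrable_gexp b u0.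
have [_ b1 b2] := cintegrable_gexpM b u0 m1 ler01 bound0.
have h : cint leb (fun x : RT => b * gexp u b x + (- 2 * u) * (x%:C * gexp u b x)) = 0.
  apply: (@cint_cderive_eq0 (fun x => 1 * gexp u b x) _
     (fun x => b * ((b - 2 * u * x%:C) * gexp u b x) +
       (- 2 * u) * (x%:C * ((b - 2 * u * x%:C) * gexp u b x) + 1 * gexp u b x))
     (1 * gauss_bound u b) (Re u / 2)); rewrite ?divr_gt0//.
  - move=> x; apply: is_cderive_eq.
      by apply: is_cderiveM; [exact: is_cderive_cst|exact: is_cderive_gexp].
    by rewrite /=; ring.
  - move=> x; apply: is_cderive_eq.
      apply: is_cderiveD; apply: is_cderiveM; try exact: is_cderive_cst.
        exact: is_cderive_gexp.
      by apply: is_cderiveM; [exact: is_cderive_id|exact: is_cderive_gexp].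
    by rewrite /=; ring.
  - by apply: cintegrableD; exact: cintegrableZ.
rewrite cintD ?cintZ// in h; try exact: cintegrableZ.
have u2 : 2 * u != 0 by rewrite mulf_neq0// pnatr_eq0.
apply: (mulfI u2); rewrite mulrA (mulrCA (2 * u)) mulfV// mulr1.
by apply/eqP; rewrite -subr_eq0 -oppr_eq0; apply/eqP; rewrite -[RHS]h; ring.
Qed.

(** The derivative of x [gexp u 0] integrates to zero. This provides the coefficient of the
    differential equation in u that [cint_gexp0_sqr] solves. *)
Lemma cint_gexp_sqr u : 0 < Re u ->
  cintegrable leb (fun x : RT => (x ^+ 2)%:C * gexp u 0 x) /\
  cint leb (fun x : RT => (x ^+ 2)%:C * gexp u 0 x) =
    (2 * u)^-1 * cint leb (gexp u 0 : RT -> R[i]).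
Proof.
move=> u0; have un0 : u != 0 by apply: slit_neq0; left.
have [i2 _ _] := cintegrable_gexpM 0 u0 mx2 ler01 bound2.
split=> //; have i0 := cintegrable_gexp 0 u0.
have [_ b1 b2] := cintegrable_gexpM 0 u0 mx ler01 bound1.
have h : cint leb (fun x : RT => gexp u 0 x + (- 2 * u) * ((x ^+ 2)%:C * gexp u 0 x)) = 0.
  apply: (@cint_cderive_eq0 (fun x => x%:C * gexp u 0 x) _
     (fun x => (0 - 2 * u * x%:C) * gexp u 0 x +
       (- 2 * u) * ((x%:C * x%:C) * ((0 - 2 * u * x%:C) * gexp u 0 x) +
          (x%:C * 1 + 1 * x%:C) * gexp u 0 x))
     (1 * gauss_bound u 0) (Re u / 2)); rewrite ?divr_gt0//.
  - move=> x; apply: is_cderive_eq.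
      by apply: is_cderiveM; [exact: is_cderive_id|exact: is_cderive_gexp].
    by rewrite /= expr2 rmorphM; ring.
  - rewrite (_ : (fun x : R => gexp u 0 x + _) =
       (fun x => gexp u 0 x + - 2 * u * ((x%:C * x%:C) * gexp u 0 x))); last first.
      by apply/funext => x; rewrite expr2 rmorphM.
    move=> x; apply: is_cderive_eq.
      apply: is_cderiveD; first exact: is_cderive_gexp.
      apply: is_cderiveM; first exact: is_cderive_cst.
      apply: is_cderiveM; last exact: is_cderive_gexp.
      by apply: is_cderiveM; exact: is_cderive_id.
    by rewrite /=; ring.
  - by apply: cintegrableD => //; exact: cintegrableZ.
rewrite cintD ?cintZ// in h; last exact: cintegrableZ.
have u2 : 2 * u != 0 by rewrite mulf_neq0// pnatr_eq0.
apply: (mulfI u2); rewrite mulrA mulfV// mul1r.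
by apply/eqP; rewrite -subr_eq0 -oppr_eq0; apply/eqP; rewrite -[RHS]h; ring.
Qed.

(** Along the segment v from Re u to u the integral F satisfies F' = - v' F / (2 v), so F^2 v is
    constant, equal to pi at the real end. The real part of F never vanishes on the way, so it keeps
    the sign it has there. The two conclusions are what [csqi_unique] needs to select the root. *)
Lemma cint_gexp0_sqr u : 0 < Re u ->
  cint leb (gexp u 0 : RT -> R[i]) ^+ 2 * u = pi%:C /\
  0 < Re (cint leb (gexp u 0 : RT -> R[i])).
Proof.
move=> u0; pose v s : R[i] := (Re u)%:C + s%:C * ((Im u)%:C * 'i).
have vE s : v s = Re u +i* (s * Im u).
  by rewrite /v; apply: eq_complexE; rewrite !complexE /=; ring.
have v0 s : 0 < Re (v s) by rewrite vE.
have vn0 s : v s != 0 by apply: slit_neq0; left.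
pose F s := cint leb (gexp (v s) 0 : RT -> R[i]).
have FE : F = fun s => cint leb (fun x : RT =>
    cexp (- (Re u)%:C * (x ^+ 2)%:C + s%:C * (- ((Im u)%:C * 'i) * (x ^+ 2)%:C))).
  apply/funext => s; apply: eq_cint => x; congr cexp; rewrite /v; ring.
have dF s : is_cderive F s (- ((Im u)%:C * 'i) / (2 * v s) * F s).
  rewrite [X in is_cderive X _ _]FE; apply: is_cderive_eq.
    apply: (@is_cderive_cint_cexp _ RT R leb (fun x : RT => - (Re u)%:C * (x ^+ 2)%:C)
       (fun x : RT => - ((Im u)%:C * 'i) * (x ^+ 2)%:C) s
       (fun x : RT => (1 + `|Im u|) * (1 + 4 / Re u) * expR (0 ^+ 2 / Re u) *
           expR (- (Re u / 2 * x ^+ 2)))).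
    - by apply: cmeasurableM => //; exact: cmeasurable_cst.
    - by apply: cmeasurableM => //; exact: cmeasurable_cst.
    - move=> x; have -> : Re (- ((Im u)%:C * 'i) * (x ^+ 2)%:C) = 0.
        by rewrite !complexE /=; ring.
      have -> : Im (- ((Im u)%:C * 'i) * (x ^+ 2)%:C) = - Im u * x ^+ 2.
        by rewrite !complexE /=; ring.
      rewrite normr0 mulr0 !addr0.
      have -> : Re (- (Re u)%:C * (x ^+ 2)%:C) = - (Re u * x ^+ 2) + 0 * `|x|.
        by rewrite !complexE /=; ring.
      rewrite -!(mulrA (1 + `|Im u|)).
      apply: le_trans (ler_wpM2l _ (gauss_dominated 0 x u0)); last by rewrite addr_ge0.
      rewrite [leLHS]mulrC [leRHS]mulrA ler_pM2r ?expR_gt0//.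
      rewrite normrM normrN (ger0_norm (sqr_ge0 x)).
      have := sqr_ge0 x; have := normr_ge0 (Im u); move: `|Im u| (x ^+ 2) => p q; nra.
    - rewrite /comp; under eq_fun do rewrite -!(mulrA (1 + `|Im u|)) EFinM.
      by apply: integrableZl => //; have := integrable_gauss_dominated 0 u0;
         rewrite /comp; under eq_fun do rewrite -mulrA.
  have [i2 e2] := cint_gexp_sqr (v0 s).
  transitivity (cint leb (fun x : RT => - ((Im u)%:C * 'i) * ((x ^+ 2)%:C * gexp (v s) 0 x))).
    apply: eq_cint => x; rewrite [RHS]mulrA /gexp; congr (_ * cexp _); rewrite /v; ring.
  by rewrite cintZ// e2 mulrA.
have dv s : is_cderive v s ((Im u)%:C * 'i).
  apply: is_cderive_eq.
    apply: is_cderiveD; first exact: is_cderive_cst.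
    by apply: is_cderiveM; [exact: is_cderive_id|exact: is_cderive_cst].
  by rewrite /=; ring.
have dH s : is_cderive (fun s => F s * F s * v s) s 0.
  apply: is_cderive_eq.
    by apply: is_cderiveM; [apply: is_cderiveM; exact: dF|exact: dv].
  by rewrite /=; field; exact: vn0.
have F0 : F 0 = (Num.sqrt (pi / Re u))%:C.
  have E (x : RT) : gexp (v 0) 0 x = (expR (- (Re u * x ^+ 2)))%:C.
    rewrite /gexp -cexpR; congr cexp; rewrite vE; apply: eq_complexE;
      by rewrite !complexE /=; ring.
  rewrite /F (eq_cint leb E); apply: eq_complexE => /=.
    by rewrite /Rintegral integral_gauss.
  by rewrite /Rintegral integral0.
have v1 : v 1 = u by rewrite vE mul1r; case: (u).
have H1 s : F s * F s * v s = pi%:C.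
  rewrite (is_cderive_0_cst s 0 dH) F0 vE mul0r.
  rewrite -rmorphM -expr2 sqr_sqrtr ?divr_ge0 ?pi_ge0 ?ltW//.
  apply: eq_complexE; rewrite !complexE /=; last by ring.
  by field; rewrite gt_eqF.
split; first by rewrite expr2 -[in X in X = _]v1 -/(F 1) H1.
(* If F were i r with r real, then F^2 v = - r^2 v. Multiplying by the conjugate of v and taking
   real parts gives pi Re u = - r^2 |v|^2, which is impossible. *)
have nz s : Re (F s) != 0.
  apply/eqP => R0; have := H1 s; rewrite vE; case: (F s) R0 => wr w /= ->.
  move=> /(congr1 (fun z : R[i] => Re z * Re u + Im z * (s * Im u))) /=.
  have := pi_gt0 R; have := u0; move: (Re u) (s * Im u) w => p q r p0 hpi h.
  have : pi * p = - (r ^+ 2 * (p ^+ 2 + q ^+ 2)) by rewrite -[RHS]addr0 -[LHS](_ : pi * p + 0 * q = _); [rewrite -h; ring|ring].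
  have : 0 < pi * p by rewrite mulr_gt0.
  have : 0 <= r ^+ 2 * (p ^+ 2 + q ^+ 2) by rewrite mulr_ge0 ?addr_ge0 ?sqr_ge0.
  lra.
rewrite ltNge; apply/negP => le0.
have cF : {within `[0, 1], continuous (fun s => Re (F s))}.
  by apply: continuous_subspaceT => s; case: (is_cderive_continuous (dF s)).
have F0gt : 0 < Re (F 0) by rewrite F0 /= sqrtr_gt0 divr_gt0// pi_gt0.
have F1le : Re (F 1) <= 0 by rewrite /F v1.
have h0 : Num.min (Re (F 0)) (Re (F 1)) <= 0 <= Num.max (Re (F 0)) (Re (F 1)).
  by rewrite ge_min F1le orbT/= le_max ltW.
have [s _ Fs] := @IVT R (fun s => Re (F s)) 0 1 0 ler01 cF h0.
by have := nz s; rewrite Fs eqxx.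
Qed.

(** A second differential equation, now in the linear coefficient s b: F' = s b^2 F / (2 u), so F
    exp(- s^2 b^2 / (4 u)) is constant. Its value at s = 0 is the centred integral. *)
Lemma cint_gexp u b : 0 < Re u ->
  cint leb (gexp u b : RT -> R[i]) =
  (Num.sqrt pi)%:C * csqi u * cexp (b ^+ 2 / (4 * u)).
Proof.
move=> u0; have su : slit u by left.
have un0 : u != 0 := slit_neq0 su.
have sp : 0 < Num.sqrt pi :> R by rewrite sqrtr_gt0 pi_gt0.
have cu : cint leb (gexp u 0 : RT -> R[i]) = (Num.sqrt pi)%:C * csqi u.
  have [h1 h2] := cint_gexp0_sqr u0.
  have spC : (Num.sqrt pi)%:C != 0 :> R[i].
    by apply/eqP => /(congr1 Re)/= /eqP; rewrite (gt_eqF sp).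
  rewrite -[LHS](mulKf spC) mulrCA; congr (_ * _); apply: csqi_unique => //.
    rewrite exprMn -mulrA h1 -rmorphV ?unitfE ?gt_eqF// -rmorphXn -rmorphM.
    by rewrite exprVn sqr_sqrtr ?pi_ge0// mulVf// gt_eqF// pi_gt0.
  by rewrite -rmorphV ?unitfE ?gt_eqF// cReMl mulr_gt0// invr_gt0.
pose F s := cint leb (gexp u (s%:C * b) : RT -> R[i]).
have FE : F = fun s => cint leb (fun x : RT =>
    cexp (- u * (x ^+ 2)%:C + s%:C * (b * x%:C))).
  by apply/funext => s; apply: eq_cint => x; congr cexp; ring.
have dF s : is_cderive F s (b * (s%:C * b / (2 * u) * F s)).
  pose B := (`|s| + 1) * `|Re b|.
  rewrite [X in is_cderive X _ _]FE; apply: is_cderive_eq.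
    apply: (@is_cderive_cint_cexp _ RT R leb (fun x : RT => - u * (x ^+ 2)%:C)
       (fun x : RT => b * x%:C) s
       (fun x : RT => (1 + `|Re b| + `|Im b|) * (1 + 4 / Re u) * expR (B ^+ 2 / Re u) *
           expR (- (Re u / 2 * x ^+ 2)))).
    - by apply: cmeasurableM => //; exact: cmeasurable_cst.
    - by apply: cmeasurableM => //; exact: cmeasurable_cst.
    - move=> x; have -> : Re (b * x%:C) = Re b * x by rewrite !complexE /=; ring.
      have -> : Im (b * x%:C) = Im b * x by rewrite !complexE /=; ring.
      have -> : Re (- u * (x ^+ 2)%:C) = - (Re u * x ^+ 2) by rewrite !complexE /=; ring.
      rewrite !normrM [(_ + 1) * _]mulrA -/B -!(mulrA (1 + `|Re b| + `|Im b|)).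
      apply: le_trans (ler_wpM2l _ (gauss_dominated B x u0)); last by rewrite !addr_ge0.
      rewrite [leLHS]mulrC [leRHS]mulrA ler_pM2r ?expR_gt0//.
      have := sqr_ge_norm x; have := normr_ge0 (Im b); have := normr_ge0 (Re b).
      have := sqr_ge0 x.
      move: `|Im b| `|Re b| `|x| (x ^+ 2) => p q r w w0 q0 p0 rw.
      have : p * r <= p * (1 + w) by rewrite ler_wpM2l.
      have : q * r <= q * (1 + w) by rewrite ler_wpM2l.
      lra.
    - rewrite /comp; under eq_fun do rewrite -!(mulrA (1 + `|Re b| + `|Im b|)) EFinM.
      by apply: integrableZl => //; have := integrable_gauss_dominated B u0;
         rewrite /comp; under eq_fun do rewrite -mulrA.
  have [i1 e1] := cint_gexp_mul (s%:C * b) u0.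
  transitivity (cint leb (fun x : RT => b * (x%:C * gexp u (s%:C * b) x))).
    by apply: eq_cint => x; rewrite [RHS]mulrA /gexp; congr (_ * cexp _); ring.
  by rewrite cintZ// e1.
pose E s := cexp (- (b ^+ 2 / (4 * u)) * (s%:C * s%:C)).
have dH s : is_cderive (fun s => F s * E s) s 0.
  apply: is_cderive_eq.
    apply: is_cderiveM; first exact: dF.
    apply: is_cderive_cexp; apply: is_cderiveM; first exact: is_cderive_cst.
    by apply: is_cderiveM; exact: is_cderive_id.
  by rewrite -/(E s) /=; field; rewrite un0 ?pnatr_eq0.
have := is_cderive_0_cst 1 0 dH.
rewrite /E /F mul0r cu !mulr0 cexp0 mulr1 !mulr1 mul1r => <-.
by rewrite -mulrA -cexpD addNr cexp0 mulr1.
Qed.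

End ComplexGaussian.

(** * The Riemann-Lebesgue lemma *)

Section RiemannLebesgue.
Import HBSimple.
Variables (R : realType) (x0 : R).
Local Notation RT := (measurableTypeR R).
Local Notation leb := (@lebesgue_measure R).

Let s (T : R) (x : RT) : R := sin (T * (x - x0)).

Let measurable_s T : measurable_fun setT (s T).
Proof.
apply: measurableT_comp; last by apply: measurable_funM => //; exact: measurable_funB.
exact: measurable_sin.
Qed.

Let norm_s T x : `|s T x| <= 1.
Proof. exact: norm_sin_le1. Qed.

Let integrableM_s T (A : set RT) (f : RT -> R) : measurable A ->
  leb.-integrable A (EFin \o f) -> leb.-integrable A (EFin \o (fun x => f x * s T x)).
Proof. by move=> mA fi; exact: integrableM_le1. Qed.

(** Half-open, so that its intersection with a generating interval []a, b]] is again of that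
    form. *)
Let half (n : nat) : set RT := `]- n%:R, n%:R]%classic.

Let measurable_half n : measurable (half n).
Proof. exact: measurable_itv. Qed.

Let half_fin n : (leb (half n) < +oo)%E.
Proof.
rewrite /half lebesgue_measure_itv /=; by case: ifP => _; rewrite ?ltry.
Qed.

Let integrable_cst (A : set RT) (k : R) : measurable A -> (leb A < +oo)%E ->
  leb.-integrable A (EFin \o (fun=> k)).
Proof.
move=> mA Aoo; apply: measurable_bounded_integrable => //.
exact: bounded_cst.
Qed.

Let half_sub_fin n (A : set RT) : measurable A -> (leb (A `&` half n) < +oo)%E.
Proof.
move=> mA; apply: le_lt_trans (half_fin n); apply: le_measure; rewrite ?inE//.
exact: measurableI.
Qed.

Let integrable_s T n (A : set RT) : measurable A ->
  leb.-integrable (A `&` half n) (EFin \o s T).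
Proof.
move=> mA; have mAI : measurable (A `&` half n) by exact: measurableI.
have := integrableM_s T mAI (integrable_cst 1 mAI (half_sub_fin n mA)).
by under eq_fun do rewrite mul1r.
Qed.

(** The antiderivative - cos(T (x - x0)) / T gains the factor 1/T, uniformly in the interval. *)
Let itv_bound_s T (c d : R) : 0 < T ->
  `|\int[leb]_(x in `]c, d]) s T x| <= 2 / T.
Proof.
move=> T0; have [cd|dc] := ltP c d; last first.
  by rewrite set_itv_ge ?bnd_simp -?leNgt// Rintegral_set0 normr0 divr_ge0// ltW.
pose F (x : R) := - T^-1 * cos (T * (x - x0)).
have dF (x : R) : is_derive x 1 F (s T x).
  have d1 : is_derive x 1 (fun x : R => T * (x - x0)) T.
    have -> : (fun x : R => T * (x - x0)) = T *: (id - cst x0) by [].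
    by apply: is_derive_eq; rewrite subr0 /GRing.scale/= mulr1.
  have d2 := @is_derive1_comp _ cos (fun x : R => T * (x - x0)) x _ _ (is_derive_cos _) d1.
  have -> : F = (- T^-1) *: (cos \o (fun x : R => T * (x - x0))) by [].
  by apply: is_derive_eq; rewrite /GRing.scale/= /s; field; rewrite gt_eqF.
have cs : continuous (s T : R -> R).
  move=> x; apply: (@continuous_comp _ _ _ (fun x : R => T * (x - x0)) sin).
    by apply: continuousM; [exact: cst_continuous|apply: continuousB; [exact: cvg_id|exact: cst_continuous]].
  exact: continuous_sin.
have ic : leb.-integrable `[c, d] (EFin \o s T).
  apply: continuous_compact_integrable; first exact: segment_compact.
  by apply: continuous_subspaceT => x; exact: cs.
rewrite Rintegral_itv_obnd_cbnd; last first.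
  by apply: integrableS ic => //; apply: subset_itvr; rewrite bnd_simp.
rewrite (Rintegral_itv_derive cd dF)// /F -mulrBr normrM normrN normfV (gtr0_norm T0).
rewrite mulrC ler_pM2r ?invr_gt0//; apply: le_trans (ler_normB _ _) _.
have h := norm_cos_le1; by have := h R (T * (d - x0)); have := h R (T * (c - x0)); lra.
Qed.

(** The sets with this property form a Dynkin class containing the half-open intervals. For
    increasing unions, the part missed by the k-th set has small measure inside [half n], and |sin|
    <= 1 makes its contribution small uniformly in T. *)
Let half_cvg n (A : set RT) : measurable A ->
  \int[leb]_(x in A `&` half n) s T x @[T --> +oo] --> (0 : R).
Proof.
pose H := [set B : set RT | measurable B /\
  \int[leb]_(x in B `&` half n) s T x @[T --> +oo] --> (0 : R)].
suff HE : (@measurable _ RT) `<=` H by move=> /HE[].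
have -> : (@measurable _ RT) = <<s setT, @ocitv R >> by [].
have itvP (a b : R) : \int[leb]_(x in `]a, b]) s T x @[T --> +oo] --> (0 : R).
  apply: norm_cvg0; apply: (@squeeze_cvgr _ _ _ _ (fun=> 0) (fun T : R => 2 * T^-1)).
  - near=> T; rewrite normr_ge0/= itv_bound_s//.
  - exact: cvg_cst.
  - rewrite -[X in _ --> X](mulr0 2); apply: cvgMr.
    by apply/gtr0_cvgV0; [near=> T|exact: cvg_id].
refine (lambda_system_subset (@ocitvI R) _ _ (fun X _ => @subsetT _ X)); last first.
- move=> _ [[a b] _ <-]/=; split; first exact: measurable_itv.
  rewrite (_ : _ `&` _ = `]Num.max a (- n%:R), Num.min b n%:R]%classic).
    exact: itvP.
  apply/seteqP; split => x; rewrite /half /= !in_itv/= gt_max le_min.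
    by move=> [/andP[-> ->] /andP[-> ->]].
  by move=> /andP[/andP[-> ->] /andP[-> ->]].
split => //.
- split; first exact: measurableT.
  by rewrite setTI; exact: itvP.
- move=> B C CB [mB hB] [mC hC]; split; first exact: measurableD.
  have E : (fun T => \int[leb]_(x in (B `\` C) `&` half n) s T x) =
      (fun T => \int[leb]_(x in B `&` half n) s T x - \int[leb]_(x in C `&` half n) s T x).
    apply/funext => T.
    have BE : B `&` half n = ((B `\` C) `&` half n) `|` (C `&` half n).
      by rewrite setUC -setIUl setDUK.
    rewrite [in RHS]BE Rintegral_setU ?addrK//.
    - by apply: measurableI => //; exact: measurableD.
    - exact: measurableI.
    - by rewrite -BE; exact: integrable_s.
    - by apply/disj_set2P; rewrite setIACA setIid setDKI ?set0I.
  by rewrite E -[X in _ --> X](subr0 0); exact: cvgB.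
- move=> F' ndF' HF'; pose F : nat -> set RT := F'.
  have HF i : H (F i) := HF' i.
  have ndF : {homo F : i j / (i <= j)%N >-> (i <= j)%O} := ndF'.
  suff : H (\bigcup_i F i) by [].
  clearbody F; have mF i : measurable (F i) by case: (HF i).
  have mU : measurable (\bigcup_i F i) by exact: bigcupT_measurable.
  split => //; apply/cvgrPdist_lt => e e0.
  have mFn i : measurable (F i `&` half n) by exact: measurableI.
  have : leb (F i `&` half n) @[i --> \oo] --> leb (\bigcup_i (F i `&` half n)).
    apply: nondecreasing_cvg_mu => //; first exact: bigcupT_measurable.
    by move=> i j ij; apply/subsetPset; apply: setSI; apply/subsetPset; exact: ndF.
  rewrite -setI_bigcupl => cF.
  have fU : leb ((\bigcup_i F i) `&` half n) \is a fin_num.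
    by rewrite ge0_fin_numE// half_sub_fin.
  have : fine (leb (F i `&` half n)) @[i --> \oo] --> fine (leb ((\bigcup_i F i) `&` half n)).
    by apply: fine_cvg; rewrite fineK.
  move=> /cvgrPdist_lt/(_ (e / 2)); rewrite divr_gt0// => /(_ isT)[k _ /(_ k (leqnn _)) /= hk].
  have [_ /cvgrPdist_lt/(_ (e / 2))] := HF k; rewrite divr_gt0// => /(_ isT) hT.
  near=> T.
  have hTT : `|0 - \int[leb]_(x in F k `&` half n) s T x| < e / 2 by near: T.
  have UE : (\bigcup_i F i) `&` half n =
      (((\bigcup_i F i) `\` F k) `&` half n) `|` (F k `&` half n).
    by rewrite setUC -setIUl setDUK//; apply: bigcup_sup.
  have mD : measurable (((\bigcup_i F i) `\` F k) `&` half n).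
    by apply: measurableI => //; exact: measurableD.
  have dis : [disjoint ((\bigcup_i F i) `\` F k) `&` half n & F k `&` half n].
    by apply/disj_set2P; rewrite setIACA setIid setDKI ?set0I.
  rewrite UE Rintegral_setU//; last by rewrite -UE; exact: integrable_s.
  rewrite sub0r normrN; apply: le_lt_trans (ler_normD _ _) _.
  rewrite sub0r normrN in hTT; rewrite [ltRHS]splitr; apply: ltrD => //.
  apply: le_lt_trans (_ : fine (leb (((\bigcup_i F i) `\` F k) `&` half n)) < _).
    have iD : leb.-integrable (((\bigcup_i F i) `\` F k) `&` half n) (EFin \o s T).
      by apply: integrable_s; exact: measurableD.
    apply: le_trans (le_normr_Rintegral _ _) _ => //.
    rewrite -[leRHS]mul1r -Rintegral_cst//; apply: le_Rintegral => //.
    - exact: integrable_norm.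
    - by apply: integrable_cst => //; apply: half_sub_fin; exact: measurableD.
  have fk : leb (F k `&` half n) \is a fin_num by rewrite ge0_fin_numE// half_sub_fin.
  have fD : leb (((\bigcup_i F i) `\` F k) `&` half n) \is a fin_num.
    by rewrite ge0_fin_numE// half_sub_fin//; exact: measurableD.
  apply: le_lt_trans hk; rewrite UE measureU//; last exact/disj_set2P.
  by rewrite fineD// addrK ler_norm.
Unshelve. all: by end_near. Qed.

Let cvg_seq_indicators n (g : seq R) (a : R -> R) (A : R -> set RT) :
  (forall y, measurable (A y)) -> forall S : R -> RT -> R,
  (forall T x, S T x = \sum_(y <- g) a y * (\1_(A y) x * s T x)) ->
  (forall T, leb.-integrable (half n) (EFin \o S T)) /\
  \int[leb]_(x in half n) S T x @[T --> +oo] --> (0 : R).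
Proof.
move=> mA; elim: g => [|y g IHg] S SE.
  have -> : S = fun _ _ => 0 by apply/funext => T; apply/funext => x; rewrite SE big_nil.
  split; first by move=> T; exact: integrable0.
  under eq_fun do rewrite Rintegral_cst// mul0r; exact: cvg_cst.
have [iS' cS'] := IHg (fun T x => \sum_(y <- g) a y * (\1_(A y) x * s T x)) (fun _ _ => erefl).
have iA T : leb.-integrable (half n) (EFin \o (fun x => \1_(A y) x * s T x)).
  apply: integrableM_s => //; apply: (le_integrable _ _ _ (integrable_cst 1 _ (half_fin n))) => //.
    by apply/measurable_EFinP; exact: measurable_indic.
  by move=> x _; rewrite lee_fin normr1 ger0_norm// indicE; case: (_ \in _).
have iaA T : leb.-integrable (half n) (EFin \o (fun x => a y * (\1_(A y) x * s T x))).
  by rewrite /comp; under eq_fun do rewrite EFinM; apply: integrableZl => //; exact: iA.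
have SE' T : S T = fun x => a y * (\1_(A y) x * s T x) +
    \sum_(y <- g) a y * (\1_(A y) x * s T x).
  by apply/funext => x; rewrite SE big_cons.
split.
  move=> T; rewrite SE' /comp; under eq_fun do rewrite EFinD.
  by apply: integrableD => //; [exact: iaA|exact: iS'].
have -> : (fun T => \int[leb]_(x in half n) S T x) = (fun T =>
    a y * \int[leb]_(x in A y `&` half n) s T x +
    \int[leb]_(x in half n) \sum_(y <- g) a y * (\1_(A y) x * s T x)).
  apply/funext => T; rewrite SE' RintegralD// RintegralZl//; congr (_ * _ + _).
  rewrite setIC Rintegral_mkcondr; apply: eq_Rintegral => x _.
  by rewrite patchE indicE; case: (_ \in _); rewrite ?mul1r ?mul0r.
rewrite -[X in _ --> X](addr0 0); apply: cvgD => //.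
by rewrite -[X in _ --> X](mulr0 (a y)); apply: cvgMr; exact: half_cvg.
Qed.

(** An error of e/3 is allotted to each of three pieces: the tail of f outside [half n], the L1
    distance from f to a simple function on [half n], and the oscillating integral of that simple
    function. The first two bounds do not depend on T. *)
Lemma riemann_lebesgue (f : RT -> R) : leb.-integrable setT (EFin \o f) ->
  \int[leb]_x (f x * sin (T * (x - x0))) @[T --> +oo] --> (0 : R).
Proof.
move=> fi; apply/cvgrPdist_lt => e e0.
have e3 : 0 < e / 3 by rewrite divr_gt0.
have ni : leb.-integrable setT (EFin \o (fun x => `|f x|)) by exact: integrable_norm.
have := cvg_Rintegral_symmetric_itv cvgr_idn ni.
move=> /cvgrPdist_lt/(_ _ e3)[n _ /(_ n (leqnn _)) /= hn].
have fin' : leb.-integrable (half n) (EFin \o f) by exact: integrableS fi.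
have nin : leb.-integrable (half n) (EFin \o (fun x => `|f x|)) by exact: integrableS ni.
rewrite -Rintegral_itv_obnd_cbnd -/(half n) in hn; last first.
  by rewrite -/(half n).
have [g [gi _]] := approximation_sfun_integrable (measurable_half n) fin'.
have ifg k : leb.-integrable (half n) (EFin \o (fun x => f x - g k x)).
  by rewrite /comp; under eq_fun do rewrite EFinB; apply: integrableB => //; exact: gi.
have infg k : leb.-integrable (half n) (EFin \o (fun x => `|f x - g k x|)).
  exact: integrable_norm.
move=> /fine_cvgP[_] /cvgrPdist_lt/(_ _ e3)[k _ /(_ k (leqnn _)) /= hk].
have {}hk : \int[leb]_(x in half n) `|f x - g k x| < e / 3.
  by move: hk; rewrite sub0r normrN; apply: le_lt_trans; exact: ler_norm.
have gE x T : g k x * s T x = \sum_(y <- finmap.enum_fset (fset_set (range (g k))))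
    y * (\1_(g k @^-1` [set y]) x * s T x).
  rewrite {1}(fimfunE (g k) x) fsbig_finite//= mulr_suml.
  by apply: eq_bigr => y _; rewrite mulrA.
have mk (y : R) : measurable (g k @^-1` [set y] : set RT) by exact: measurable_funPTI.
have [igs cgs] := @cvg_seq_indicators n (finmap.enum_fset (fset_set (range (g k))))
  id (fun y => g k @^-1` [set y]) mk
  (fun T x => g k x * s T x) (fun T x => gE x T).
move: cgs => /cvgrPdist_lt/(_ _ e3) cgs.
near=> T.
have hT : `|0 - \int[leb]_(x in half n) (g k x * s T x)| < e / 3 by near: T.
rewrite sub0r normrN in hT; rewrite sub0r normrN.
have mC : measurable (~` half n) by exact: measurableC.
have ifs : leb.-integrable setT (EFin \o (fun x => f x * s T x)) by exact: integrableM_s.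
have splitI (h : RT -> R) : leb.-integrable setT (EFin \o h) ->
    \int[leb]_x h x = \int[leb]_(x in half n) h x + \int[leb]_(x in ~` half n) h x.
  move=> ih; rewrite -[in LHS](setvU (half n)) setUC Rintegral_setU//; last first.
    by apply/disj_set2P; exact: setICr.
  by rewrite setUCr.
rewrite (splitI _ ifs).
have -> : \int[leb]_(x in half n) (f x * s T x) =
    \int[leb]_(x in half n) (g k x * s T x) + \int[leb]_(x in half n) ((f x - g k x) * s T x).
  rewrite -RintegralD//; last exact: integrableM_s.
  by apply: eq_Rintegral => x _; ring.
have b1 : `|\int[leb]_(x in half n) ((f x - g k x) * s T x)| < e / 3.
  apply: le_lt_trans hk; apply: le_trans (le_normr_Rintegral _ _) _ => //.
    exact: integrableM_s.
  apply: le_Rintegral => //; first by apply: integrable_norm => //; exact: integrableM_s.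
  by move=> x _; rewrite normrM ler_piMr.
have b2 : `|\int[leb]_(x in ~` half n) (f x * s T x)| < e / 3.
  rewrite (splitI _ ni) addrAC subrr add0r in hn.
  apply: le_lt_trans (le_trans _ (ler_norm _)) hn.
  apply: le_trans (le_normr_Rintegral _ _) _ => //; first exact: integrableS ifs.
  apply: le_Rintegral => //.
  - by apply: integrable_norm => //; exact: integrableS ifs.
  - exact: integrableS ni.
  - by move=> x _; rewrite normrM ler_piMr.
apply: le_lt_trans (ler_normD _ _) _; apply: le_lt_trans (lerD (ler_normD _ _) (lexx _)) _.
rewrite -[ltRHS](_ : e / 3 + e / 3 + e / 3 = _); last by field.
by rewrite !ltrD.
Unshelve. all: by end_near. Qed.

End RiemannLebesgue.

(** * Lebesgue measure on tuples *)

Section TupleLebesgue.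
Variable R : realType.
Local Notation RT := (measurableTypeR R).
Local Notation leb := (@lebesgue_measure R).
Local Notation lebt n := (lebesgue_tuple R n).
Local Open Scope ereal_scope.

Definition tadd n (x y : n.-tuple RT) : n.-tuple RT :=
  [tuple (tnth x i + tnth y i)%R | i < n].

Definition tscale n (c : R) (x : n.-tuple RT) : n.-tuple RT :=
  [tuple (c * tnth x i)%R | i < n].

Lemma ge0_integral_tupleS n (f : n.+1.-tuple RT -> \bar R) :
  measurable_fun setT f -> (forall x, 0 <= f x) ->
  \int[lebt n.+1]_x f x = \int[leb]_x \int[lebt n]_y f (tcons (x, y)).
Proof.
move=> mf f0; have mt := @measurable_tcons R n.
rewrite (@ge0_integral_pushforward _ _ _ _ _ _ mt (leb \x lebt n) setT f)//.
rewrite preimage_setT (@fubini_tonelli1 _ _ _ _ _ leb (lebt n) (f \o @tcons R n))//.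
  by apply: measurableT_comp.
by move=> x; exact: f0.
Qed.

Lemma measurable_tadd n d (T : measurableType d) (f g : T -> n.-tuple RT) :
  measurable_fun setT f -> measurable_fun setT g ->
  measurable_fun setT (fun x => tadd (f x) (g x)).
Proof.
move=> /measurable_fun_tnthP mf /measurable_fun_tnthP mg.
apply/measurable_fun_tnthP => i.
rewrite (_ : _ \o _ = (fun x => tnth (f x) i + tnth (g x) i)%R); last first.
  by apply/funext => x/=; rewrite tnth_mktuple.
apply: (@measurable_funD _ _ R); [exact: mf|exact: mg].
Qed.

Lemma measurable_tscale n c : measurable_fun setT (@tscale n c).
Proof.
apply/measurable_fun_tnthP => i.
rewrite (_ : _ \o _ = (fun x => c * tnth x i)%R); last first.
  by apply/funext => x/=; rewrite tnth_mktuple.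
by apply: (@measurable_funM _ _ R) => //; exact: measurable_tnth.
Qed.

(** The scaled image of Lebesgue measure agrees with Lebesgue measure on intervals, hence everywhere
    by uniqueness. *)
Lemma ge0_integral_affine (f : RT -> \bar R) (c a : R) : (0 < c)%R ->
  measurable_fun setT f -> (forall x, 0 <= f x) ->
  \int[leb]_x f x = c%:E * \int[leb]_x f (c * x + a)%R.
Proof.
move=> c0 mf f0; pose g (x : RT) : RT := (c * x + a)%R.
have mg : measurable_fun setT g by apply: (@measurable_funD _ _ R) => //; exact: measurable_funM.
pose k : {nonneg R} := NngNum (ltW c0).
rewrite -[X in (_ * X)]/(\int[leb]_(x in g @^-1` setT) (f \o g) x).
rewrite -(@ge0_integral_pushforward _ _ _ _ _ _ mg leb setT f)//.
rewrite -[c%:E]/(k%:num%:E) -ge0_integral_mscale//.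
apply: eq_measure_integral => A mA _; apply: lebesgue_measure_unique => //= X.
case=> -[/= u v] _ <- /=.
rewrite /mscale/= /pushforward /g
  (_ : _ @^-1` _ = `](c^-1 * (u - a))%R, (c^-1 * (v - a))%R]%classic).
  rewrite !lebesgue_measure_itv/= !lte_fin ltr_pM2l ?invr_gt0// ltrD2r.
  case: ifP => // _; last by rewrite mule0.
  by rewrite -!EFinD -EFinM; congr (_%:E); field; rewrite gt_eqF.
by apply/seteqP; split => x /=; rewrite !in_itv/= ltr_pdivrMl// ler_pdivlMl// ltrBlDr lerBrDr.
Qed.

Lemma tadd_tcons n (x a : R) (y b : n.-tuple RT) :
  tadd (tcons (x, y)) (tcons (a, b)) = tcons ((x + a)%R, tadd y b).
Proof.
apply: eq_from_tnth => i; rewrite tnth_mktuple.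
case: (unliftP ord0 i) => [j|] ->; last by rewrite !tnth0.
by rewrite !tnthS tnth_mktuple.
Qed.

Lemma tconsK n (x : n.+1.-tuple RT) : x = tcons (thead x, [tuple of behead x]).
Proof. by rewrite [LHS]tuple_eta; apply/val_inj. Qed.

Lemma ge0_integral_tuple_translation n (f : n.-tuple RT -> \bar R) (a : n.-tuple RT) :
  measurable_fun setT f -> (forall x, 0 <= f x) ->
  \int[lebt n]_x f (tadd x a) = \int[lebt n]_x f x.
Proof.
elim: n => [|n IHn] in f a *.
  by move=> mf f0; apply: eq_integral => x _; congr f; rewrite (tuple0 x) (tuple0 (tadd _ _)).
move=> mf f0; rewrite !ge0_integral_tupleS//; last first.
  by apply: measurableT_comp => //; apply: measurable_tadd.
have mfc : measurable_fun setT (f \o @tcons R n).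
  by apply: measurableT_comp => //; exact: measurable_tcons.
rewrite (tconsK a); set a1 := thead a; set a2 := [tuple of _].
under eq_integral do under eq_integral do rewrite tadd_tcons.
have mfx x : measurable_fun setT (fun y => f (tcons (x, y))).
  exact: (measurableT_comp mfc (pair1_measurable x)).
under eq_integral => x _.
  rewrite (IHn (fun y => f (tcons ((x + a1)%R, y))))//.
  over.
rewrite [RHS](ge0_integral_affine a1 ltr01)//; last 2 first.
- by apply: (@measurable_fun_fubini_tonelli_F _ _ _ _ _ (lebt n) (f \o @tcons R n)) => // p; exact: f0.
- by move=> x; exact: integral_ge0.
by rewrite mul1e; apply: eq_integral => x _; rewrite mul1r.
Qed.

(** A substitute for the Jacobian, in the style of the uniqueness of Haar measure. The double
    integral of g(T x) f(y + T x) gives the left product when y is integrated first. For fixed y, a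
    translation of x that moves T x by y, with g even, turns it into that of g(y - T x) f(T x),
    which gives the right product. A single g with known integrals thus determines the volume factor
    of T. *)
Lemma ge0_integral_equivariant n (T : n.-tuple RT -> n.-tuple RT)
    (f g : n.-tuple RT -> \bar R) :
  measurable_fun setT T -> (forall h, exists h', forall x, T (tadd x h') = tadd (T x) h) ->
  measurable_fun setT f -> (forall x, 0 <= f x) ->
  measurable_fun setT g -> (forall x, 0 <= g x) ->
  (forall x, g (tscale (-1) x) = g x) ->
  \int[lebt n]_x g (T x) * \int[lebt n]_x f x =
  \int[lebt n]_x g x * \int[lebt n]_x f (T x).
Proof.
move=> mT eqvT mf f0 mg g0 gN.
have mgT : measurable_fun setT (g \o T) by exact: measurableT_comp.
have mfT : measurable_fun setT (f \o T) by exact: measurableT_comp.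
have taddC (x y : n.-tuple RT) : tadd x y = tadd y x.
  by apply: eq_from_tnth => i; rewrite !tnth_mktuple addrC.
rewrite -ge0_integralZr//; last exact: integral_ge0.
pose F (p : n.-tuple RT * n.-tuple RT) := g (T p.1) * f (tadd p.2 (T p.1)).
have mF : measurable_fun setT F.
  apply: emeasurable_funM.
    exact: (measurableT_comp mgT).
  apply: (measurableT_comp mf); apply: measurable_tadd => //.
  exact: (measurableT_comp mT).
have F0 p : 0 <= F p by rewrite mule_ge0.
transitivity (\int[lebt n]_x \int[lebt n]_y F (x, y)).
  apply: eq_integral => x _; rewrite -(ge0_integral_tuple_translation (T x))//.
  rewrite -ge0_integralZl//.
  by apply: measurableT_comp => //; apply: measurable_tadd.
rewrite fubini_tonelli//.
pose G (p : n.-tuple RT * n.-tuple RT) := g (tadd p.2 (tscale (-1) (T p.1))) * f (T p.1).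
have mG : measurable_fun setT G.
  apply: emeasurable_funM; last exact: (measurableT_comp mfT).
  apply: (measurableT_comp mg); apply: measurable_tadd => //.
  by apply: (measurableT_comp (@measurable_tscale _ _)); exact: (measurableT_comp mT).
have G0 p : 0 <= G p by rewrite mule_ge0.
transitivity (\int[lebt n]_y \int[lebt n]_x G (x, y)).
  apply: eq_integral => y _; have [h' Th'] := eqvT y.
  rewrite -[RHS](ge0_integral_tuple_translation h')//; last first.
    exact: (measurableT_comp mG (pair2_measurable y)).
  apply: eq_integral => x _; rewrite /F /G/= Th' [tadd y _]taddC; congr (_ * _).
  rewrite -[LHS]gN; congr g; apply: eq_from_tnth => i.
  by rewrite !tnth_mktuple; ring.
rewrite -fubini_tonelli//.
rewrite -ge0_integralZl//; last exact: integral_ge0.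
apply: eq_integral => x _.
rewrite -(ge0_integral_tuple_translation (tscale (-1) (T x)))//.
rewrite -ge0_integralZr//.
by apply: measurableT_comp => //; apply: measurable_tadd.
Qed.

End TupleLebesgue.

(** * Fubini's theorem for real and complex integrands *)

Section RealFubini.
Context d1 d2 (T1 : measurableType d1) (T2 : measurableType d2) (R : realType).
Variable m1 : {sigma_finite_measure set T1 -> \bar R}.
Variable m2 : {sigma_finite_measure set T2 -> \bar R}.

(** The inner integrals in Fubini's theorem are extended real and finite only almost everywhere;
    passing to [fine] alters them on a null set. *)
Let ae_fine d (T : measurableType d) (m : {measure set T -> \bar R}) (F : T -> \bar R) :
  m.-integrable setT F ->
  m.-integrable setT (fun x => (fine (F x))%:E) /\
  (\int[m]_x (fine (F x))%:E = \int[m]_x F x)%E.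
Proof.
move=> iF; have mF := measurable_int _ iF.
have mf : measurable_fun setT (fun x => (fine (F x))%:E).
  by apply/measurable_EFinP; exact: measurableT_comp.
have i1 : m.-integrable setT (fun x => (fine (F x))%:E).
  apply: (le_integrable measurableT mf _ iF) => x _.
  by case: (F x) => [r| |] //=; rewrite normr0 ?lee_fin ?leey.
split => //; apply: ae_eq_integral => //.
have := integrable_ae measurableT iF; apply: filterS => x /= /(_ I) Fx _.
by rewrite fineK.
Qed.

Lemma integrable_prod12 (f : T1 * T2 -> R) :
  (m1 \x m2)%E.-integrable setT (EFin \o f) ->
  m1.-integrable setT (fun x => (\int[m2]_y f (x, y))%:E) /\
  \int[m1]_x \int[m2]_y f (x, y) = \int[(m1 \x m2)%E]_p f p.
Proof.
move=> fi; have [i1 e1] := ae_fine (integrable_fubini_F fi); split=> //.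
rewrite /Rintegral e1; congr fine; exact: integral12_prod_meas1.
Qed.

Let integrable_G (f : T1 * T2 -> \bar R) : (m1 \x m2)%E.-integrable setT f ->
  m2.-integrable setT (fun y => (\int[m1]_x f (x, y))%E).
Proof.
move=> fi; have mf := measurable_int _ fi; apply/integrableP; split.
  exact: measurable_fubini_G fi.
apply: le_lt_trans ((integrable21ltyP m1 m2 mf).1 fi).
apply: ge0_le_integral => //.
- by apply: measurableT_comp => //; exact: measurable_fubini_G fi.
- apply: (measurable_fun_fubini_tonelli_G (abse \o f)) => //=.
  exact: measurableT_comp.
- by move=> y _; apply: le_abse_integral => //; exact: measurableT_comp.
Qed.

Lemma integral_prod21 (f : T1 * T2 -> R) :
  (m1 \x m2)%E.-integrable setT (EFin \o f) ->
  \int[m2]_y \int[m1]_x f (x, y) = \int[(m1 \x m2)%E]_p f p.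
Proof.
move=> fi; have [_ e1] := ae_fine (integrable_G fi).
rewrite /Rintegral e1; congr fine; exact: integral21_prod_meas1.
Qed.

Lemma integrable_tensor (f : T1 -> R) (g : T2 -> R) :
  m1.-integrable setT (EFin \o f) -> m2.-integrable setT (EFin \o g) ->
  (m1 \x m2)%E.-integrable setT (EFin \o (fun p => f p.1 * g p.2)) /\
  \int[(m1 \x m2)%E]_p (f p.1 * g p.2) = (\int[m1]_x f x) * \int[m2]_y g y.
Proof.
move=> fi gi.
have mf : measurable_fun setT f by apply/measurable_EFinP; exact: measurable_int fi.
have mg : measurable_fun setT g by apply/measurable_EFinP; exact: measurable_int gi.
have fgi : (m1 \x m2)%E.-integrable setT (EFin \o (fun p => f p.1 * g p.2)).
  apply/integrable12ltyP.
    apply/measurable_EFinP; apply: measurable_funM.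
      by apply: measurableT_comp mf _; exact: measurable_fst.
    by apply: measurableT_comp mg _; exact: measurable_snd.
  rewrite (eq_integral (fun x => (`|f x|%:E * \int[m2]_y `|g y|%:E)%E)); last first.
    move=> x _; rewrite -ge0_integralZl//.
      by apply: eq_integral => y _; rewrite /= normrM EFinM.
    by apply/measurable_EFinP; exact: measurableT_comp.
  rewrite ge0_integralZr//; last 2 first.
  - by apply/measurable_EFinP; exact: measurableT_comp.
  - exact: integral_ge0.
  apply: lte_mul_pinfty; first exact: integral_ge0.
    rewrite ge0_fin_numE; last exact: integral_ge0.
    by case/integrableP: fi.
  by case/integrableP: gi.
split=> //; have [_ <-] := integrable_prod12 fgi => /=.
under eq_Rintegral do rewrite RintegralZl//.
by rewrite RintegralZr.
Qed.

End RealFubini.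

Section ComplexFubini.
Context d1 d2 (T1 : measurableType d1) (T2 : measurableType d2) (R : realType).
Variable m1 : {sigma_finite_measure set T1 -> \bar R}.
Variable m2 : {sigma_finite_measure set T2 -> \bar R}.

Lemma cint_prod12 (f : T1 * T2 -> R[i]) : cintegrable (m1 \x m2)%E f ->
  cint m1 (fun x => cint m2 (fun y => f (x, y))) = cint (m1 \x m2)%E f.
Proof.
move=> [f1 f2]; apply: eq_complexE; rewrite /cint /=.
  by have [_ ->] := integrable_prod12 f1.
by have [_ ->] := integrable_prod12 f2.
Qed.

Lemma cint_prod21 (f : T1 * T2 -> R[i]) : cintegrable (m1 \x m2)%E f ->
  cint m2 (fun y => cint m1 (fun x => f (x, y))) = cint (m1 \x m2)%E f.
Proof.
move=> [f1 f2]; apply: eq_complexE; rewrite /cint /=.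
  by rewrite (integral_prod21 f1).
by rewrite (integral_prod21 f2).
Qed.

Lemma cintegrable_tensor (f : T1 -> R[i]) (g : T2 -> R[i]) :
  cintegrable m1 f -> cintegrable m2 g ->
  cintegrable (m1 \x m2)%E (fun p => f p.1 * g p.2) /\
  cint (m1 \x m2)%E (fun p => f p.1 * g p.2) = cint m1 f * cint m2 g.
Proof.
move=> [f1 f2] [g1 g2].
have [i11 e11] := integrable_tensor f1 g1.
have [i12 e12] := integrable_tensor f1 g2.
have [i21 e21] := integrable_tensor f2 g1.
have [i22 e22] := integrable_tensor f2 g2.
have [j1 k1] := integrable_linear 1 (-1) i11 i22.
have [j2 k2] := integrable_linear 1 1 i12 i21.
have h1 p : Re (f p.1 * g p.2) = 1 * (Re (f p.1) * Re (g p.2)) + -1 * (Im (f p.1) * Im (g p.2)).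
  by rewrite cReM mulN1r mul1r.
have h2 p : Im (f p.1 * g p.2) = 1 * (Re (f p.1) * Im (g p.2)) + 1 * (Im (f p.1) * Re (g p.2)).
  by rewrite cImM !mul1r.
split; first by split; [under eq_fun do rewrite h1|under eq_fun do rewrite h2].
apply: eq_complexE; rewrite /cint ?cReM ?cImM /=.
  by rewrite (eq_Rintegral _ (fun p _ => h1 p)) k1 e11 e22 mul1r mulN1r.
by rewrite (eq_Rintegral _ (fun p _ => h2 p)) k2 e12 e21 !mul1r.
Qed.

End ComplexFubini.

(** * Products of one-variable functions on tuples *)

Section TupleProduct.
Variable R : realType.
Local Notation RT := (measurableTypeR R).
Local Notation leb := (@lebesgue_measure R).
Local Notation lebt n := (lebesgue_tuple R n).

Lemma integrable_tupleS n (f : n.+1.-tuple RT -> R) : measurable_fun setT f ->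
  (leb \x lebt n)%E.-integrable setT (EFin \o (f \o @tcons R n)) ->
  (lebt n.+1).-integrable setT (EFin \o f) /\
  \int[lebt n.+1]_x f x = \int[(leb \x lebt n)%E]_p f (tcons p).
Proof.
move=> mf fi; have mt := @measurable_tcons R n.
have mF : measurable_fun setT (EFin \o f) by exact/measurable_EFinP.
split.
  exact: (@integrable_pushforward _ _ _ _ _ _ mt (leb \x lebt n)%E setT _ mF fi measurableT).
congr fine.
exact: (@integral_pushforward _ _ _ _ _ _ mt (leb \x lebt n)%E setT _ mF fi measurableT).
Qed.

Lemma cintegrable_tuple_prod n (F : 'I_n -> RT -> R[i]) :
  (forall i, cintegrable leb (F i)) ->
  cintegrable (lebt n) (fun x => \prod_(i < n) F i (tnth x i)) /\
  cint (lebt n) (fun x => \prod_(i < n) F i (tnth x i)) = \prod_(i < n) cint leb (F i).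
Proof.
elim: n => [|n IHn] in F *; move=> Fi.
  (* In dimension 0 the measure is the Dirac mass at the empty tuple, so the empty product
     integrates to 1. *)
  have i0 (c : R) : (lebt 0).-integrable setT (EFin \o (fun=> c)).
    exact: (@finite_measure_integrable_cst _ _ _ (\d_ [tuple])).
  have e0 (c : R) : \int[lebt 0]_x c = c.
    rewrite (@Rintegral_cst _ _ _ (\d_ [tuple])) //= /dirac indicE mem_set//=.
    by rewrite mulr1.
  split; last first.
    rewrite big_ord0; apply: eq_complexE; rewrite /cint /=.
      by under eq_Rintegral do rewrite big_ord0 /=; rewrite e0.
    by under eq_Rintegral do rewrite big_ord0 /=; rewrite e0.
  split; under eq_fun do rewrite big_ord0; exact: i0.
have [i1 e1] := IHn (fun i => F (lift ord0 i)) (fun i => Fi _).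
have [[i2 i3] e2] := cintegrable_tensor (Fi ord0) i1.
have pE (p : RT * n.-tuple RT) : \prod_(i < n.+1) F i (tnth (tcons p) i) =
    F ord0 p.1 * \prod_(i < n) F (lift ord0 i) (tnth p.2 i).
  rewrite big_ord_recl tnth0; congr (_ * _).
  by apply: eq_bigr => i _; rewrite tnthS.
have [m1 m2] : cmeasurable (fun x : n.+1.-tuple RT => \prod_(i < n.+1) F i (tnth x i)).
  have mFi i : cmeasurable (fun x : n.+1.-tuple RT => F i (tnth x i)).
    have [h1 h2] := cintegrable_measurable (Fi i).
    split; first exact: (measurableT_comp h1 (@measurable_tnth _ _ _ i)).
    exact: (measurableT_comp h2 (@measurable_tnth _ _ _ i)).
  elim: (index_enum _) => [|i s IHs].
    by under eq_fun do rewrite big_nil; exact: cmeasurable_cst.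
  by under eq_fun do rewrite big_cons; exact: cmeasurableM.
have [j1 k1] := @integrable_tupleS n (fun x => Re (\prod_(i < n.+1) F i (tnth x i))) m1
  ltac:(by rewrite /comp; under eq_fun do rewrite pE).
have [j2 k2] := @integrable_tupleS n (fun x => Im (\prod_(i < n.+1) F i (tnth x i))) m2
  ltac:(by rewrite /comp; under eq_fun do rewrite pE).
split=> //; rewrite big_ord_recl -e1 -e2.
apply: eq_complexE; rewrite /cint /=.
  by rewrite k1; under eq_Rintegral do rewrite pE.
by rewrite k2; under eq_Rintegral do rewrite pE.
Qed.

End TupleProduct.

(** * Dilations and rotations of Lebesgue measure *)

Section EuclideanInvariance.
Variables (R : realType) (N : nat).
Local Notation RT := (measurableTypeR R).
Local Notation leb := (@lebesgue_measure R).
Local Notation lebt := (lebesgue_tuple R N).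
Implicit Types x y : N.-tuple RT.

Lemma measurable_tnthf (d : measure_display) (T : measurableType d)
    (f : T -> N.-tuple RT) (i : 'I_N) : measurable_fun setT f ->
  measurable_fun setT (fun x : T => tnth (f x) i : R).
Proof. by move=> /measurable_fun_tnthP; apply. Qed.

Lemma measurable_dot (d : measure_display) (T : measurableType d)
    (f g : T -> N.-tuple RT) : measurable_fun setT f -> measurable_fun setT g ->
  measurable_fun setT (fun x : T => dot (f x) (g x)).
Proof.
move=> mf mg; apply: measurable_sum => i.
by apply: measurable_funM; exact: measurable_tnthf.
Qed.

Lemma dot_ge0 x : 0 <= dot x x.
Proof. by apply: sumr_ge0 => i _; rewrite -expr2 sqr_ge0. Qed.

Lemma sqr_enorm x : enorm x ^+ 2 = dot x x.
Proof. by rewrite sqr_sqrtr// dot_ge0. Qed.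

Lemma tnth_tscale c x i : tnth (tscale c x) i = c * tnth x i.
Proof. by rewrite tnth_mktuple. Qed.

Lemma dot_tscalel c x y : dot (tscale c x) y = c * dot x y.
Proof. by rewrite /dot mulr_sumr; apply: eq_bigr => i _; rewrite tnth_tscale mulrA. Qed.

Lemma dotC x y : dot x y = dot y x.
Proof. by apply: eq_bigr => i _; rewrite mulrC. Qed.

Lemma dot_tscaler c x y : dot x (tscale c y) = c * dot x y.
Proof. by rewrite dotC dot_tscalel dotC. Qed.

Lemma enorm_tscale c x : 0 <= c -> enorm (tscale c x) = c * enorm x.
Proof.
move=> c0; rewrite /enorm dot_tscalel dot_tscaler mulrA -expr2 sqrtrM ?sqr_ge0//.
by rewrite sqrtr_sqr ger0_norm.
Qed.

Lemma radial_projE x : radial_proj x = tscale (Num.sqrt N%:R / enorm x) x.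
Proof. by apply: eq_from_tnth => i; rewrite !tnth_mktuple. Qed.

Lemma tscaleA (c e : R) x : tscale c (tscale e x) = tscale (c * e) x.
Proof. by apply: eq_from_tnth => i; rewrite !tnth_mktuple mulrA. Qed.

Lemma tscale1 x : tscale 1 x = x.
Proof. by apply: eq_from_tnth => i; rewrite !tnth_mktuple mul1r. Qed.

Lemma ge0_integral_gauss_tuple (a : R) : 0 < a ->
  (\int[lebt]_x (expR (- (a * dot x x)))%:E = (Num.sqrt (pi / a) ^+ N)%:E)%E.
Proof.
move=> a0; pose g (y : RT) : R := expR (- (a * y ^+ 2)).
have gi (i : 'I_N) : cintegrable leb (fun y : RT => (g y)%:C).
  by split; [exact: integrable_gauss|exact: (@integrable0 _ _ _ leb setT)].
have gE : cint leb (fun y : RT => (g y)%:C) = (Num.sqrt (pi / a))%:C.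
  by apply: eq_complexE; rewrite /= /Rintegral ?integral_gauss ?integral0.
have pE x : \prod_(i < N) (g (tnth x i))%:C = (expR (- (a * dot x x)))%:C.
  rewrite -rmorph_prod/= -expR_sum sumrN /dot mulr_sumr.
  by under eq_bigr do rewrite expr2.
have [[i1 _] /(congr1 Re) e] := cintegrable_tuple_prod gi.
move: i1 e; under eq_fun do rewrite pE.
under eq_cint do rewrite pE.
rewrite prodr_const card_ord gE -rmorphXn /= => i1 <-.
by rewrite fineK//; exact: integrable_fin_num.
Qed.

Lemma measurable_gauss_tuple (a : R) :
  measurable_fun setT (fun x => (expR (- (a * dot x x)))%:E).
Proof.
apply/measurable_EFinP; apply: measurableT_comp => //.
apply: measurableT_comp => //; apply: measurable_funM => //.
by apply: measurable_dot; exact: measurable_id.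
Qed.

(** The test function is the standard Gaussian: composed with T it becomes a Gaussian of parameter
    c^2, and the ratio of the two integrals is c^(-N). *)
Lemma ge0_integral_equivariantE (T : N.-tuple RT -> N.-tuple RT) (c : R)
    (f : N.-tuple RT -> \bar R) :
  measurable_fun setT T -> (forall h, exists h', forall x, T (tadd x h') = tadd (T x) h) ->
  0 < c -> (forall x, dot (T x) (T x) = c ^+ 2 * dot x x) ->
  measurable_fun setT f -> (forall x, (0 <= f x)%E) ->
  (\int[lebt]_x f (T x) = (c ^- N)%:E * \int[lebt]_x f x)%E.
Proof.
move=> mT eT c0 Tc mf f0.
have := @ge0_integral_equivariant R N T f (fun x => (expR (- (1 * dot x x)))%:E)
  mT eT mf f0 (measurable_gauss_tuple 1).
have -> : (\int[lebt]_x (expR (- (1 * dot (T x) (T x))))%:E =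
    (Num.sqrt (pi / c ^+ 2) ^+ N)%:E)%E.
  under eq_integral do rewrite Tc mul1r.
  by rewrite ge0_integral_gauss_tuple// exprn_gt0.
rewrite ge0_integral_gauss_tuple// divr1 sqrtrM ?pi_ge0// sqrtrV ?sqr_ge0//.
rewrite sqrtr_sqr gtr0_norm// exprMn exprVn => h.
have p0 : 0 < Num.sqrt pi ^+ N :> R by rewrite exprn_gt0// sqrtr_gt0 pi_gt0.
have {}h := h (fun x => expR_ge0 _).
rewrite EFinM -muleA in h.
have gN (x : N.-tuple RT) : (expR (- (1 * dot (tscale (-1) x) (tscale (-1) x))))%:E =
    (expR (- (1 * dot x x)))%:E.
  by rewrite dot_tscalel dot_tscaler !mulN1r opprK.
have p1 : Num.sqrt pi ^+ N != 0 :> R by rewrite gt_eqF.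
rewrite -[LHS]mul1e -(mulVf p1) EFinM -muleA -(h gN).
by rewrite muleA -EFinM mulVf// mul1e.
Qed.

Lemma ge0_integral_scale c (f : N.-tuple RT -> \bar R) : 0 < c ->
  measurable_fun setT f -> (forall x, (0 <= f x)%E) ->
  (\int[lebt]_x f (tscale c x) = (c ^- N)%:E * \int[lebt]_x f x)%E.
Proof.
move=> c0 mf f0; apply: ge0_integral_equivariantE => //.
- exact: measurable_tscale.
- move=> h; exists (tscale c^-1 h) => x; apply: eq_from_tnth => i.
  by rewrite !tnth_mktuple; field; rewrite gt_eqF.
- by move=> x; rewrite dot_tscalel dot_tscaler mulrA.
Qed.

Definition trot (U : 'M[R]_N) x : N.-tuple RT :=
  [tuple \sum_(j < N) U i j * tnth x j | i < N].

Lemma measurable_trot U : measurable_fun setT (trot U).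
Proof.
apply/measurable_fun_tnthP => i.
rewrite (_ : _ \o _ = (fun x => \sum_(j < N) U i j * tnth x j)); last first.
  by apply/funext => x/=; rewrite tnth_mktuple.
apply: (@measurable_sum _ _ R) => j; apply: measurable_funM => //.
exact: measurable_tnth.
Qed.

Let tcol x : 'cV[R]_N := \col_i tnth x i.

Let tcol_trot U x : tcol (trot U x) = U *m tcol x.
Proof.
by apply/matrixP => i j; rewrite !mxE tnth_mktuple; apply: eq_bigr => k _; rewrite mxE.
Qed.

Let dot_tcol x y : dot x y = ((tcol x)^T *m tcol y) 0 0.
Proof. by rewrite mxE; apply: eq_bigr => i _; rewrite !mxE. Qed.

Let tcol_inj x y : tcol x = tcol y -> x = y.
Proof.
by move=> /matrixP xy; apply: eq_from_tnth => i; have := xy i 0; rewrite !mxE.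
Qed.

Lemma dot_trot U x y : U^T *m U = 1%:M -> dot (trot U x) (trot U y) = dot x y.
Proof.
by move=> UU; rewrite !dot_tcol !tcol_trot trmx_mul mulmxA -(mulmxA _ U^T) UU mulmx1.
Qed.

Lemma trot_tscale U c x : trot U (tscale c x) = tscale c (trot U x).
Proof.
apply: eq_from_tnth => i; rewrite !tnth_mktuple mulr_sumr.
by apply: eq_bigr => j _; rewrite tnth_tscale mulrCA.
Qed.

Lemma quadratic_form_trot (M U : 'M[R]_N) (lam : 'I_N -> R) x :
  M = U^T *m diag_mx (\row_i lam i) *m U ->
  \sum_(i < N) \sum_(j < N) M i j * tnth x i * tnth x j =
  \sum_(i < N) lam i * tnth (trot U x) i ^+ 2.
Proof.
move=> ME; transitivity (((tcol x)^T *m M *m tcol x) 0 0).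
  rewrite -mulmxA mxE; apply: eq_bigr => i _; rewrite !mxE mulr_sumr.
  by apply: eq_bigr => j _; rewrite !mxE mulrA [_ * M i j]mulrC.
have -> : (tcol x)^T *m M *m tcol x =
    (tcol (trot U x))^T *m diag_mx (\row_i lam i) *m tcol (trot U x).
  by rewrite ME tcol_trot trmx_mul !mulmxA.
rewrite mxE; apply: eq_bigr => i _.
rewrite mul_mx_diag !mxE mulrAC -expr2 mulrC.
by congr (_ * _).
Qed.

Lemma ge0_integral_trot U (f : N.-tuple RT -> \bar R) : U *m U^T = 1%:M ->
  measurable_fun setT f -> (forall x, (0 <= f x)%E) ->
  (\int[lebt]_x f (trot U x) = \int[lebt]_x f x)%E.
Proof.
move=> UU mf f0; have UU' : U^T *m U = 1%:M by exact: mulmx1C.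
rewrite (@ge0_integral_equivariantE (trot U) 1)//.
- by rewrite expr1n invr1 mul1e.
- exact: measurable_trot.
- move=> h; exists (trot U^T h) => x; apply: tcol_inj.
  rewrite tcol_trot.
  have tcolD y z : tcol (tadd y z) = tcol y + tcol z.
    by apply/matrixP => i j; rewrite !mxE tnth_mktuple.
  by rewrite !tcolD !tcol_trot mulmxDr mulmxA UU mul1mx.
- by move=> x; rewrite dot_trot// expr1n mul1r.
Qed.

End EuclideanInvariance.

(** * Polar coordinates and the surface measure *)

Section PolarCoordinates.
Variables (R : realType) (N : nat).
Hypothesis N_gt0 : (0 < N)%N.
Local Notation RT := (measurableTypeR R).
Local Notation leb := (@lebesgue_measure R).
Local Notation lebt := (lebesgue_tuple R N).
Local Notation omega := (surface_measure R N).
Implicit Types (x y s : N.-tuple RT) (F : N.-tuple RT -> \bar R).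

Lemma measurable_tscalef (d : measure_display) (T : measurableType d)
    (c : T -> R) (f : T -> N.-tuple RT) :
  measurable_fun setT c -> measurable_fun setT f ->
  measurable_fun setT (fun z : T => tscale (c z) (f z)).
Proof.
move=> mc mf; apply/measurable_fun_tnthP => i.
rewrite (_ : _ \o _ = (fun z : T => c z * tnth (f z) i)); last first.
  by apply/funext => z /=; rewrite tnth_mktuple.
by apply: (@measurable_funM _ _ R) => //; exact: measurable_tnthf.
Qed.

Lemma ge0_integral_mrestr (d : measure_display) (T : measurableType d)
    (mu : {measure set T -> \bar R}) (D : set T) (mD : measurable D)
    (f : T -> \bar R) : measurable_fun setT f -> (forall x : T, (0 <= f x)%E) ->
  (\int[mrestr mu mD]_x f x = \int[mu]_(x in D) f x)%E.
Proof.
move=> mf f0.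
rewrite -[in LHS](setvU D) ge0_integral_setU//; first last.
- exact/disj_setPCr.
- by rewrite setvU.
- exact: measurableC.
rewrite null_set_integral ?add0e//.
- by apply: eq_measure_integral => A mA AD /=; rewrite /mrestr setIidl.
- exact: measurableC.
- exact: measurable_funTS.
- by rewrite -[LHS]/(mu (~` D `&` D)) setICl measure0.
Qed.

Lemma ge0_integral_surface F : measurable_fun setT F -> (forall x, (0 <= F x)%E) ->
  (\int[omega]_s F s = (Num.sqrt N%:R)%:E *
    \int[lebt]_(x in punctured_ball (R := R) (N := N)) F (radial_proj x))%E.
Proof.
move=> mF F0; have mp : measurable_fun setT (@radial_proj R N : N.-tuple RT -> N.-tuple RT).
  exact: measurable_radial_proj.
pose k : {nonneg R} := NngNum (sqrtr_ge0 N%:R).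
pose mB : measurable (@punctured_ball R N : set (N.-tuple RT)) :=
  @measurable_punctured_ball R N.
have -> : (\int[omega]_s F s = \int[pushforward (mscale k (mrestr lebt mB))
    (@radial_proj R N : N.-tuple RT -> N.-tuple RT)]_s F s)%E.
  exact: eq_measure_integral.
rewrite (@ge0_integral_pushforward _ _ _ _ _ _ mp _ setT F)// preimage_setT.
have mFp : measurable_fun setT (F \o @radial_proj R N) by exact: measurableT_comp.
rewrite (@ge0_integral_mscale _ _ _ _ _ _ _ (F \o @radial_proj R N) mFp)//=.
by rewrite (@ge0_integral_mrestr _ _ lebt _ mB _ mFp (fun x => F0 _)).
Qed.

(** The origin is fixed by doubling, which multiplies volume by 2^N, different from 1 since N > 0. A
    finite measure with this property is zero, and finiteness follows by comparison with a
    Gaussian. *)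
Lemma null_origin : lebt [set x | enorm x = 0] = 0%E.
Proof.
have mO : measurable [set x : N.-tuple RT | enorm x = 0].
  rewrite (_ : [set x | _] = (@enorm R N) @^-1` [set 0])//.
  by rewrite -[X in measurable X]setTI; exact: (measurable_enorm _ (measurable_set1 0)).
set O := [set x | _] in mO *.
pose f x : \bar R := (\1_O x)%:E.
have mf : measurable_fun setT f by apply/measurable_EFinP; exact: measurable_indic.
have f0 x : (0 <= f x)%E by rewrite lee_fin.
have fE : (\int[lebt]_x f x = lebt O)%E by rewrite integral_indic// setIT.
have := @ge0_integral_scale R N 2 f (ltr0Sn _ 1) mf f0.
have -> : (\int[lebt]_x f (tscale 2 x) = \int[lebt]_x f x)%E.
  apply: eq_integral => x _; congr (_%:E); rewrite !indicE; congr ((nat_of_bool _)%:R).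
  apply/idP/idP; rewrite !inE /O /= enorm_tscale//.
    by move/eqP; rewrite mulf_eq0 pnatr_eq0/= => /eqP.
  by move=> ->; rewrite mulr0.
rewrite fE => h.
have Ooo : (lebt O < +oo)%E.
  apply: (@le_lt_trans _ _ (Num.sqrt (pi / 1) ^+ N)%:E%E); last exact: ltry.
  rewrite -ge0_integral_gauss_tuple// -fE; apply: ge0_le_integral => //.
  - exact: measurable_gauss_tuple.
  - move=> x _; rewrite lee_fin indicE; case: (boolP (x \in O)) => xO.
      by move: xO; rewrite inE /O /= => xO; rewrite -sqr_enorm xO expr0n mulr0 oppr0 expR0.
    exact: expR_ge0.
have Ofin : lebt O \is a fin_num by rewrite ge0_fin_numE.
move: h; rewrite -(fineK Ofin) -EFinM => -[] h; congr (_%:E).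
have : (1 - 2 ^- N) * fine (lebt O) = 0 by rewrite mulrBl mul1r -h subrr.
move/eqP; rewrite mulf_eq0 subr_eq0 => /orP[/eqP h1|/eqP//].
have : (2 ^+ N : R) = 1 by rewrite -[LHS]invrK -h1 invr1.
move/eqP; rewrite -natrX -[1]/(1%:R) eqr_nat => /eqP h2.
by move: N_gt0; rewrite -(ltn_exp2l 0 N (leqnn 2)) expn0 h2.
Qed.

(* The density of [dot x x] when the ray directions are weighted by [omega]. *)
Definition polar_density (rho : R) : R :=
  if 0 < rho then 2^-1 * N%:R `^ ((1 - N%:R) / 2) * rho `^ (N%:R / 2 - 1) else 0.

Lemma polar_density_ge0 rho : 0 <= polar_density rho.
Proof.
by rewrite /polar_density; case: ifP => // _; rewrite !mulr_ge0 ?invr_ge0 ?powR_ge0.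
Qed.

Lemma measurable_polar_density : measurable_fun setT (polar_density : RT -> R).
Proof.
apply: measurable_fun_if => //.
- by apply: measurable_fun_ltr.
- by apply: measurable_funTS; apply: measurable_funM => //; exact: measurable_powR.
Qed.

(** Homogeneity of degree N/2 - 1, in the form produced by the substitution rho = c^2 u. *)
Lemma polar_density_scale (c u : R) : 0 < c ->
  c ^+ 2 * polar_density (c ^+ 2 * u) = c ^+ N * polar_density u.
Proof.
move=> c0; have c20 : 0 < c ^+ 2 by rewrite exprn_gt0.
rewrite /polar_density pmulr_rgt0//; case: ifP => u0; last by rewrite !mulr0.
rewrite powRM ?ltW//.
have -> : c ^+ N = c ^+ 2 * (c ^+ 2) `^ (N%:R / 2 - 1).
  rewrite -[X in X * _]powRr1 ?ltW// -powRD; last by rewrite (gt_eqF c20) implybT.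
  rewrite addrCA subrr addr0 -powR_mulrn ?ltW// -[c ^+ 2]powR_mulrn ?ltW//.
  by rewrite -powRrM mulrCA divff ?mulr1// pnatr_eq0.
by ring.
Qed.

Lemma integral_powR_tail (a p : R) : 0 < a -> 0 < p ->
  (\int[leb]_(u in `[a, +oo[) (u `^ (- p - 1))%:E = (p^-1 * a `^ (- p))%:E)%E.
Proof.
move=> a0 p0.
have dF (u : R) : 0 < u -> is_derive u 1 (fun u => - p^-1 * u `^ (- p)) (u `^ (- p - 1)).
  move=> u0; have d1 := @is_derive1_powR R (- p) u u0.
  have -> : (fun u : R => - p^-1 * u `^ (- p)) = (- p^-1) *: (fun u : R => u `^ (- p)) by [].
  by apply: is_derive_eq; rewrite /GRing.scale/=; field; rewrite gt_eqF.
rewrite (@ge0_continuous_FTC2y _ _ (fun u => - p^-1 * u `^ (- p)) _ 0)//.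
- by rewrite sub0e -EFinN mulNr opprK.
- by move=> u _; exact: powR_ge0.
- apply: continuous_in_subspaceT => u; rewrite inE/= in_itv/= andbT => au.
  have u0 : 0 < u by exact: lt_le_trans au.
  apply/differentiable_continuous/derivable1_diffP.
  by have := @is_derive1_powR R (- p - 1) u u0 => ?; exact: ex_derive.
- rewrite -[X in _ --> X](mulr0 (- p^-1)); apply: cvgMr.
  have -> : (fun u : R => u `^ (- p)) = (fun u => (u `^ p)^-1).
    by apply/funext => u; rewrite powRN.
  apply/gtr0_cvgV0.
    by near=> u; rewrite powR_gt0//; near: u; exact: nbhs_pinfty_gt.
  apply/cvgryPge => A; near=> u.
  have A1 : 0 <= Num.max A 1 by rewrite le_max ler01 orbT.
  apply: le_trans (_ : (Num.max A 1 `^ p^-1) `^ p <= _).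
    by rewrite -powRrM mulVf ?gt_eqF// powRr1// le_max lexx.
  apply: ge0_ler_powR; rewrite ?nnegrE ?powR_ge0 ?ltW//.
- by move=> u au; have := dF u (lt_trans a0 au) => ?; exact: ex_derive.
- have cF : {for a, continuous (fun u : R => - p^-1 * u `^ (- p))}.
    apply/differentiable_continuous/derivable1_diffP.
    by have := dF a a0 => ?; exact: ex_derive.
  exact: cvg_at_right_filter.
- move=> u; rewrite in_itv/= andbT => au; rewrite derive1E.
  by have := dF u (lt_trans a0 au) => ?; exact: derive_val.
Unshelve. all: by end_near. Qed.

Lemma measurable_fun_enorm (d : measure_display) (T : measurableType d)
    (f : T -> N.-tuple RT) : measurable_fun setT f ->
  measurable_fun setT (fun z : T => enorm (f z)).
Proof. by move=> mf; apply: measurableT_comp mf; exact: measurable_enorm. Qed.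

Lemma measurable_fun_sqrt (d : measure_display) (T : measurableType d)
    (f : T -> R) : measurable_fun setT f ->
  measurable_fun setT (fun z : T => Num.sqrt (f z)).
Proof.
move=> mf; apply: measurableT_comp mf; apply: continuous_measurable_fun.
exact: sqrt_continuous.
Qed.

Lemma measurable_fun_inv_enorm (d : measure_display) (T : measurableType d)
    (f : T -> N.-tuple RT) : measurable_fun setT f ->
  measurable_fun setT (fun z : T => (enorm (f z))^-1).
Proof.
move=> mf; rewrite (_ : (fun z => _) = (fun z => enorm (f z) `^ (-1))).
  by apply: (measurableT_comp (measurable_powR _)); exact: measurable_fun_enorm.
by apply/funext => z; rewrite powR_inv1// sqrtr_ge0.
Qed.

Let ball_ind x : R := ((0 < enorm x)%R && (enorm x <= Num.sqrt N%:R)%R)%:R.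

Let measurable_ball_ind : measurable_fun setT (ball_ind : N.-tuple RT -> R).
Proof.
rewrite (_ : ball_ind = \1_(@punctured_ball R N)).
  by apply: measurable_indic; exact: measurable_punctured_ball.
by apply/funext => x; rewrite /ball_ind indicE; congr (_%:R); rewrite mem_setE.
Qed.

Let ball_ind_ge0 x : 0 <= ball_ind x. Proof. exact: ler0n. Qed.

Let RN : R := Num.sqrt N%:R.

(** Unfolds the surface measure into Lebesgue measure on the punctured ball. The norm of x then
    enters only through the direction of the ray, on which F is taken at length sqrt rho. *)
Let surface_cone F rho : measurable_fun setT F -> (forall x, (0 <= F x)%E) ->
  ((polar_density rho)%:E * \int[omega]_s F (tscale (Num.sqrt (rho / N%:R)) s) =
  \int[lebt]_x ((polar_density rho * RN * ball_ind x)%:E *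
     F (tscale (Num.sqrt rho / enorm x) x)))%E.
Proof.
move=> mF F0; have RN0 : 0 < RN by rewrite sqrtr_gt0 ltr0n.
rewrite ge0_integral_surface//; last first.
  by apply: measurableT_comp => //; apply: measurable_tscale.
rewrite muleA -EFinM integral_mkcond -ge0_integralZl//; first last.
- by rewrite lee_fin mulr_ge0// polar_density_ge0.
- by move=> x _; rewrite patchE; case: ifP.
- apply/(measurable_restrictT _ _).1 => //; first exact: measurable_punctured_ball.
  apply: measurable_funTS; apply: measurableT_comp => //.
  apply: (measurableT_comp (@measurable_tscale _ _ _)); exact: measurable_radial_proj.
apply: eq_integral => x _; rewrite patchE.
have -> : (x \in @punctured_ball R N) = (0 < enorm x) && (enorm x <= RN) by rewrite mem_setE.
rewrite /ball_ind -/RN; case: ifPn => xB; last by rewrite mule0 mulr0 mul0e.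
rewrite mulr1 radial_projE tscaleA /polar_density; case: ifPn => rho0; last first.
  by rewrite !mul0r !mul0e.
congr (_ * F (tscale _ _))%E.
case/andP: xB => x0 _.
by rewrite sqrtrM ?ltW// sqrtrV//; field; rewrite !gt_eqF.
Qed.

(** The density is the area ratio (rho / N)^((N-1)/2) of the spheres of squared radius rho and N,
    times the derivative 1 / (2 sqrt rho) of the radius. The right side is a double integral over
    rho and a point x of the ball. Two dilations, of rho for fixed x and of x for fixed radial
    variable, bring F to the form F(y); the weight left on each y other than 0 integrates to 1. *)
Theorem ge0_integral_polar F : measurable_fun setT F -> (forall x, (0 <= F x)%E) ->
  (\int[lebt]_x F x = \int[leb]_rho ((polar_density rho)%:E *
     \int[omega]_s F (tscale (Num.sqrt (rho / N%:R)) s)))%E.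
Proof.
move=> mF F0; have RN0 : 0 < RN by rewrite sqrtr_gt0 ltr0n.
under [RHS]eq_integral do rewrite surface_cone//.
have mcst (d : measure_display) (T : measurableType d) (a : T -> R) (b : T -> N.-tuple RT) :
    measurable_fun setT a -> measurable_fun setT b ->
    measurable_fun setT (fun z : T => F (tscale (a z) (b z))).
  by move=> ma mb; apply: measurableT_comp => //; exact: measurable_tscalef.
pose H (p : RT * N.-tuple RT) := ((polar_density p.1 * RN * ball_ind p.2)%:E *
  F (tscale (Num.sqrt p.1 / enorm p.2) p.2))%E.
have mH : measurable_fun setT H.
  apply: emeasurable_funM.
    apply/measurable_EFinP; apply: measurable_funM; first apply: measurable_funM => //.
      exact: (measurableT_comp measurable_polar_density).
    exact: (measurableT_comp measurable_ball_ind).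
  apply: mcst => //; apply: measurable_funM.
    by apply: measurable_fun_sqrt; exact: measurable_fst.
  exact: measurable_fun_inv_enorm.
have H0 p : (0 <= H p)%E.
  apply: mule_ge0 => //; rewrite lee_fin; apply: mulr_ge0 => //; apply: mulr_ge0.
    exact: polar_density_ge0.
  exact: ltW.
rewrite -[RHS]/(\int[leb]_x \int[lebt]_y H (x, y))%E (@fubini_tonelli _ _ _ _ _ leb lebt H)//.
(* [H] after the substitution rho = |x|^2 u: the argument of F becomes sqrt u times x, free of the
   norm. *)
pose K (p : RT * N.-tuple RT) := ((polar_density p.1 * RN * (ball_ind p.2 * enorm p.2 ^+ N))%:E *
  F (tscale (Num.sqrt p.1) p.2))%E.
have mK : measurable_fun setT K.
  apply: emeasurable_funM.
    apply/measurable_EFinP; apply: measurable_funM; first apply: measurable_funM => //.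
      exact: (measurableT_comp measurable_polar_density).
    apply: measurable_funM; first exact: (measurableT_comp measurable_ball_ind).
    by apply: measurable_funX; exact: measurable_fun_enorm.
  by apply: mcst => //; apply: measurable_fun_sqrt; exact: measurable_fst.
have K0 p : (0 <= K p)%E.
  apply: mule_ge0 => //; rewrite lee_fin; apply: mulr_ge0.
    by apply: mulr_ge0; [exact: polar_density_ge0|exact: ltW].
  by apply: mulr_ge0 => //; rewrite exprn_ge0// sqrtr_ge0.
transitivity (\int[lebt]_y \int[leb]_x K (x, y))%E; last first.
  apply: eq_integral => x _; have [/andP[x0 xN]|xB] := boolP (0 < enorm x <= RN); last first.
    rewrite !(@integral0_eq _ _ _ _ setT)// => rho _; rewrite /H /K /= /ball_ind (negbTE xB).
      by rewrite mulr0 mul0e.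
    by rewrite mul0r mulr0 mul0e.
  rewrite [in RHS](ge0_integral_affine (c := enorm x ^+ 2) 0)//.
  under [in RHS]eq_integral do rewrite addr0.
  - rewrite -ge0_integralZl//.
    + apply: eq_integral => u _; rewrite /H /K /= /ball_ind x0 xN /= muleA -EFinM.
      rewrite sqrtrM ?sqr_ge0// sqrtr_sqr (gtr0_norm x0).
      congr (_%:E * F (tscale _ _))%E; last by field; rewrite gt_eqF.
      have := polar_density_scale u x0; move: (polar_density _) (polar_density u) => p1 p2.
      by move=> pE; transitivity (RN * (enorm x ^+ 2 * p1)); [rewrite pE; ring|ring].
    + apply: (@measurableT_comp _ _ _ _ _ _ (fun u : RT => H (u, x)) _
        (fun u : RT => enorm x ^+ 2 * u : RT)).
        exact: (measurableT_comp mH (pair2_measurable x)).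
      exact: (@measurable_funM _ _ R).
    + by rewrite lee_fin sqr_ge0.
  - by rewrite exprn_gt0.
  - exact: (measurableT_comp mH (pair2_measurable x)).
rewrite -(@fubini_tonelli _ _ _ _ _ leb lebt K)//.
(* [K] after the dilation y = sqrt u x. The volume factor and the rescaled |x|^N each contribute
   u^(-N/2), whence the power u^(-N). *)
pose L (p : RT * N.-tuple RT) :=
  ((polar_density p.1 * p.1 `^ (- N%:R) * RN * ((0 < enorm p.2) && (enorm p.2 <= Num.sqrt p.1 * RN))%:R *
    enorm p.2 ^+ N)%:E * F p.2)%E.
have L0 p : (0 <= L p)%E.
  apply: mule_ge0 => //; rewrite lee_fin; apply: mulr_ge0; last first.
    by rewrite exprn_ge0// sqrtr_ge0.
  apply: mulr_ge0 => //; apply: mulr_ge0; last exact: ltW.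
  by rewrite mulr_ge0 ?powR_ge0 ?polar_density_ge0.
have mL : measurable_fun setT L.
  have m2 : measurable_fun setT (fun p : RT * N.-tuple RT => enorm p.2).
    exact: measurable_fun_enorm.
  apply: emeasurable_funM; last exact: (measurableT_comp mF).
  apply/measurable_EFinP; apply: measurable_funM; last exact: measurable_funX.
  apply: measurable_funM.
    apply: measurable_funM => //; apply: measurable_funM.
      exact: (measurableT_comp measurable_polar_density).
    exact: (measurableT_comp (measurable_powR _)).
  rewrite (_ : (fun p => _) = \1_([set p : RT * N.-tuple RT | 0 < enorm p.2] `&`
      [set p | enorm p.2 <= Num.sqrt p.1 * RN])).
    apply: measurable_indic; apply: measurableI.
      rewrite -[X in measurable X]setTI; apply: (measurable_fun_ltr _ m2) => //.
    rewrite -[X in measurable X]setTI; apply: measurable_fun_ler => //.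
    by apply: measurable_funM => //; apply: measurable_fun_sqrt; exact: measurable_fst.
  apply/funext => p; rewrite indicE; congr ((nat_of_bool _)%:R).
  apply/idP/idP; rewrite inE/=; first by move=> /andP.
  by move=> [-> ->].
transitivity (\int[leb]_x \int[lebt]_y L (x, y))%E; last first.
  apply: eq_integral => u _; have [u0|u0] := ltP 0 u; last first.
    by rewrite !(@integral0_eq _ _ _ _ setT)// => y _;
      rewrite /L /K /= /polar_density ltNge u0 /= !mul0r mul0e.
  pose c := Num.sqrt u; have c0 : 0 < c by rewrite sqrtr_gt0.
  have c2 : c ^+ 2 = u by rewrite sqr_sqrtr// ltW.
  pose G y := ((polar_density u * RN * (ball_ind (tscale c^-1 y) * enorm (tscale c^-1 y) ^+ N))%:E * F y)%E.
  have mG : measurable_fun setT G.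
    apply: emeasurable_funM => //; apply/measurable_EFinP; apply: measurable_funM => //.
    have mc : measurable_fun setT (tscale c^-1 : N.-tuple RT -> N.-tuple RT).
      exact: measurable_tscale.
    apply: measurable_funM; first exact: (measurableT_comp measurable_ball_ind).
    by apply: measurable_funX; exact: measurable_fun_enorm.
  have G0 y : (0 <= G y)%E.
    apply: mule_ge0 => //; rewrite lee_fin; apply: mulr_ge0.
      by apply: mulr_ge0; [exact: polar_density_ge0|exact: ltW].
    by apply: mulr_ge0 => //; rewrite exprn_ge0// sqrtr_ge0.
  transitivity (\int[lebt]_y G (tscale c y))%E; last first.
    apply: eq_integral => y _; rewrite /K /G /= tscaleA mulVf ?gt_eqF// tscale1//.
  rewrite ge0_integral_scale// -ge0_integralZl//; last by rewrite lee_fin invr_ge0 exprn_ge0// ltW.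
  apply: eq_integral => y _; rewrite /L /G /= muleA -EFinM; congr (_%:E * _)%E.
  have ci0 : 0 <= c^-1 by rewrite invr_ge0 (ltW c0).
  rewrite powRN powR_mulrn ?(ltW u0)// /ball_ind enorm_tscale//.
  rewrite pmulr_rgt0 ?invr_gt0// ler_pdivrMl// exprMn -c2 -exprM mulnC exprM.
  rewrite -/c; set b1 := nat_of_bool _; set b2 := nat_of_bool _.
  have -> : b1 = b2 by rewrite /b1 /b2 c2.
  move: (enorm y ^+ N) (polar_density _) => e pd.
  by rewrite expr2 !exprVn; field; rewrite expf_neq0// gt_eqF.
rewrite (@fubini_tonelli _ _ _ _ _ leb lebt L)//.
have mO : measurable [set x : N.-tuple RT | enorm x = 0].
  rewrite (_ : [set x | _] = (@enorm R N) @^-1` [set 0])//.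
  by rewrite -[X in measurable X]setTI; exact: (measurable_enorm _ (measurable_set1 0)).
apply: ae_eq_integral => //.
  exact: (@measurable_fun_fubini_tonelli_G _ _ _ _ _ leb L).
exists [set x | enorm x = 0]; split => //; first exact: null_origin.
move=> y /= /not_implyP[_]; apply: contra_notP => y0.
have {}y0 : 0 < enorm y by rewrite lt_neqAle eq_sym sqrtr_ge0 andbT; apply/eqP.
(* [a] is the least u for which y lies in the ball of squared radius u N, so the weight of y is a
   tail integral from [a] on. *)
pose r := enorm y; pose a := r ^+ 2 / N%:R.
have NR0 : 0 < N%:R :> R by rewrite ltr0n.
have a0 : 0 < a by rewrite divr_gt0// exprn_gt0.
pose C := RN * (2^-1 * N%:R `^ ((1 - N%:R) / 2)) * r ^+ N.
have C0 : 0 <= C by rewrite !mulr_ge0 ?invr_ge0 ?powR_ge0 ?exprn_ge0 ?ltW.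
apply/esym; transitivity (\int[leb]_(u in `[a, +oo[) ((C%:E * F y) * (u `^ (- (N%:R / 2) - 1))%:E))%E; last first.
  rewrite ge0_integralZl//; last 3 first.
  - by apply/measurable_EFinP; apply: measurable_funTS; exact: measurable_powR.
  - by move=> u _; rewrite lee_fin powR_ge0.
  - by rewrite mule_ge0// lee_fin.
  have N20 : 0 < N%:R / 2 :> R by rewrite divr_gt0.
  rewrite (integral_powR_tail a0 N20) [X in (X * _)%E]muleC -muleA -EFinM.
  rewrite (_ : _ * _ = 1) ?mule1//.
  have rE : (r ^+ 2) `^ (- (N%:R / 2)) = r ^- N.
    rewrite powRN -powR_mulrn ?sqrtr_ge0// -powRrM mulrCA divff ?mulr1 ?pnatr_eq0//.
    by rewrite powR_mulrn// sqrtr_ge0.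
  rewrite /a powRM ?invr_ge0 ?sqr_ge0 ?ltW// rE /C.
  rewrite -(powR_inv1 (ltW NR0)) -powRrM mulN1r opprK.
  have -> : RN = N%:R `^ 2^-1 by rewrite powR12_sqrt// ltW.
  have e1 : N%:R `^ 2^-1 * N%:R `^ ((1 - N%:R) / 2) * N%:R `^ (N%:R / 2) = N%:R :> R.
    have ex : 2^-1 + (1 - N%:R) / 2 + N%:R / 2 = 1 :> R by field.
    by rewrite -!powRD ?(gt_eqF NR0) ?implybT// ex powRr1// (ltW NR0).
  have r0 : r ^+ N != 0 by rewrite expf_neq0// gt_eqF.
  move: e1; set p1 := N%:R `^ 2^-1; set p2 := N%:R `^ ((1 - N%:R) / 2); set p3 := N%:R `^ _ => e1.
  transitivity ((p1 * p2 * p3) / N%:R); last by rewrite e1 divff// gt_eqF.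
  by field; rewrite r0 gt_eqF.
rewrite [RHS]integral_mkcond; apply: eq_integral => u _; rewrite patchE mem_setE in_itv/= andbT.
rewrite /L /= y0 /=; have [u0|u0] := ltP 0 u; last first.
  rewrite /polar_density ltNge u0 /= !mul0r mul0e ifF//; apply/negbTE.
  by rewrite -ltNge (le_lt_trans u0).
have -> : (enorm y <= Num.sqrt u * RN) = (a <= u).
  rewrite /a ler_pdivrMr// -(ler_pXn2r (ltn0Sn 1)) ?nnegrE ?sqrtr_ge0 ?mulr_ge0 ?sqrtr_ge0//.
  by rewrite exprMn /RN (sqr_sqrtr (ltW u0)) (sqr_sqrtr (ltW NR0)).
case: ifPn => au; last by rewrite mulr0 mul0r mul0e.
rewrite muleAC -EFinM; congr (_%:E * _)%E; rewrite mulr1 /polar_density u0 /C.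
have -> : - (N%:R / 2) - 1 = (N%:R / 2 - 1) + (- N%:R) :> R by field.
rewrite (@powRD _ u (N%:R / 2 - 1)) ?(gt_eqF u0) ?implybT//.
by rewrite -/r; ring.
Qed.

End PolarCoordinates.

(** * Finiteness of the surface measure *)

Section SurfaceFinite.
Variables (R : realType) (N : nat).
Local Notation RT := (measurableTypeR R).
Local Notation lebt := (lebesgue_tuple R N).
Local Notation omega := (surface_measure R N).

(** On the ball |x|^2 <= N, so its indicator is at most exp(N - |x|^2). *)
Lemma lebesgue_punctured_ball_lty : (lebt (@punctured_ball R N) < +oo)%E.
Proof.
have mB := @measurable_punctured_ball R N.
apply: (@le_lt_trans _ _ ((expR N%:R)%:E * (Num.sqrt (pi / 1) ^+ N)%:E)%E); last exact: ltry.
rewrite -ge0_integral_gauss_tuple// -ge0_integralZl//; first last.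
- exact: measurable_gauss_tuple.
have -> : lebt (@punctured_ball R N) = (\int[lebt]_x (\1_(@punctured_ball R N) x)%:E)%E.
  by rewrite integral_indic// setIT.
apply: ge0_le_integral => //.
- by apply/measurable_EFinP; exact: measurable_indic.
- by apply: emeasurable_funM => //; exact: measurable_gauss_tuple.
- move=> x _; rewrite -EFinM lee_fin indicE; case: (boolP (x \in _)) => xB.
    rewrite -expRD -[leLHS]expR0 ler_expR mul1r subr_ge0 -sqr_enorm.
    move: xB; rewrite inE /punctured_ball/= => /andP[x0 xN].
    by rewrite -[leRHS]sqr_sqrtr// ler_pXn2r// nnegrE sqrtr_ge0.
  by rewrite mulr_ge0 ?expR_ge0.
Qed.

Lemma surface_measure_finite : fin_num_fun (surface_measure R N).
Proof.
move=> A mA; rewrite ge0_fin_numE//; apply: lte_mul_pinfty => //.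
apply: le_lt_trans lebesgue_punctured_ball_lty.
have mB := @measurable_punctured_ball R N.
apply: le_measure; rewrite ?inE//; apply: measurableI => //.
by rewrite -[X in measurable X]setTI; exact: measurable_radial_proj.
Qed.

End SurfaceFinite.

HB.instance Definition _ (R : realType) (N : nat) :=
  Measure_isFinite.Build _ _ _ (surface_measure R N) (@surface_measure_finite R N).

(** * Integration over the sphere *)

Section Surface.
Variables (R : realType) (N : nat).
Hypothesis N_gt0 : (0 < N)%N.
Local Notation RT := (measurableTypeR R).
Local Notation leb := (@lebesgue_measure R).
Local Notation lebt := (lebesgue_tuple R N).
Local Notation omega := (surface_measure R N).
Local Notation S := (sphere R N).
Implicit Types (x y s : N.-tuple RT).

Lemma measurable_sphere : measurable (S : set (N.-tuple RT)).
Proof.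
rewrite (_ : S = @enorm R N @^-1` [set Num.sqrt N%:R])//.
by rewrite -[X in measurable X]setTI; exact: (measurable_enorm _ (measurable_set1 _)).
Qed.

Lemma surface_measure_setC_sphere : omega (~` S) = 0%E.
Proof.
rewrite /surface_measure (_ : _ `&` _ = set0) ?measure0 ?mule0//.
apply/seteqP; split=> // x [] /= h /andP[x0 _]; apply: h.
rewrite /sphere /= radial_projE enorm_tscale ?divr_ge0 ?sqrtr_ge0//.
by rewrite -mulrA mulVf ?mulr1// gt_eqF.
Qed.

(* Agrees with the identity on the sphere, hence [omega]-almost everywhere,
   but is bounded everywhere. *)
Definition sphere_cap s : N.-tuple RT :=
  if enorm s == Num.sqrt N%:R then s else tscale 0 s.

Lemma sphere_capE s : S s -> sphere_cap s = s.
Proof. by move=> sS; rewrite /sphere_cap sS eqxx. Qed.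

Lemma dot_sphere_cap s : dot (sphere_cap s) (sphere_cap s) <= N%:R.
Proof.
rewrite /sphere_cap; case: ifPn => [/eqP sN|_].
  by rewrite -sqr_enorm sN sqr_sqrtr.
by rewrite dot_tscalel mul0r.
Qed.

Lemma norm_tnth_sphere_cap s i : `|tnth (sphere_cap s) i| <= Num.sqrt N%:R.
Proof.
rewrite -sqrtr_sqr ler_sqrt//; apply: le_trans (dot_sphere_cap s).
by rewrite /dot (bigD1 i)//= expr2 lerDl sumr_ge0// => j _; rewrite -expr2 sqr_ge0.
Qed.

Lemma measurable_sphere_cap : measurable_fun setT (sphere_cap : N.-tuple RT -> N.-tuple RT).
Proof.
apply: measurable_fun_ifT.
- by apply: measurable_fun_eqr => //; exact: measurable_enorm.
- exact: measurable_id.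
- exact: measurable_tscale.
Qed.

Lemma ae_sphere_cap : {ae omega, forall s, sphere_cap s = s}.
Proof.
exists (~` S); split; first exact: measurableC measurable_sphere.
  exact: surface_measure_setC_sphere.
by move=> s; apply: contra_not => sS; exact: sphere_capE.
Qed.

Lemma integral_sphere_cap (F : N.-tuple RT -> \bar R) : measurable_fun setT F ->
  (\int[omega]_s F (sphere_cap s) = \int[omega]_s F s)%E.
Proof.
move=> mF; apply: ae_eq_integral => //.
  exact: (measurableT_comp mF measurable_sphere_cap).
by apply: filterS ae_sphere_cap => s -> .
Qed.

Lemma Rintegral_sphere (f : N.-tuple RT -> R) : measurable_fun setT f ->
  \int[omega]_(s in S) f s = \int[omega]_s f (sphere_cap s).
Proof.
move=> mf; rewrite [LHS]Rintegral_mkcond; congr fine.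
apply: ae_eq_integral => //.
- apply/measurable_EFinP; apply/(measurable_restrictT _ _).1; first exact: measurable_sphere.
  exact: measurable_funTS.
- by apply/measurable_EFinP; exact: (measurableT_comp mf measurable_sphere_cap).
exists (~` S); split; first exact: measurableC measurable_sphere.
  exact: surface_measure_setC_sphere.
move=> s; apply: contra_not => sS _ /=.
by rewrite patchE mem_set// sphere_capE.
Qed.

Lemma surface_measure_setT : omega setT = omega S.
Proof.
rewrite -(setvU S) measureU//; first last.
- by rewrite setICl.
- exact: measurable_sphere.
- exact: measurableC measurable_sphere.
by rewrite [X in (X + _)%E]surface_measure_setC_sphere add0e.
Qed.

Lemma surface_measure_setT_area : omega setT = (area R N)%:E.
Proof.
rewrite surface_measure_setT /area fineK//.
exact: surface_measure_finite measurable_sphere.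
Qed.

Lemma Rintegral_surface_cst (c : R) : \int[omega]_s c = c * area R N.
Proof. by rewrite Rintegral_cst// [X in fine X]surface_measure_setT_area. Qed.

(** A sphere of zero area would, by polar coordinates, make the Gaussian integral over R^N
    vanish. *)
Lemma area_gt0 : 0 < area R N.
Proof.
rewrite lt_neqAle -lee_fin -surface_measure_setT_area measure_ge0 andbT.
apply/negP => /eqP h.
have o0 : omega setT = 0%E by rewrite surface_measure_setT_area -h.
have := @ge0_integral_gauss_tuple R N 1 ltr01.
have g0 x : (0 <= (expR (- (1 * dot x x)))%:E)%E by rewrite lee_fin expR_ge0.
rewrite (ge0_integral_polar N_gt0 (measurable_gauss_tuple 1) g0).
rewrite (eq_integral (fun=> 0%E)); last first.
  move=> rho _; rewrite null_set_integral ?mule0//.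
  apply/measurable_EFinP.
  apply: (measurableT_comp (proj1 (measurable_EFinP _ _) (measurable_gauss_tuple 1))).
  exact: measurable_tscale.
rewrite integral0 => -[] /esym/eqP; rewrite expf_eq0 => /andP[_].
by rewrite gt_eqF// sqrtr_gt0 divr_gt0// pi_gt0.
Qed.

Lemma enorm_trot (U : 'M[R]_N) x : U *m U^T = 1%:M -> enorm (trot U x) = enorm x.
Proof. by move=> UU; rewrite /enorm dot_trot//; exact: mulmx1C. Qed.

(** Rotations commute with the radial projection and preserve the punctured ball, so the invariance
    is inherited from Lebesgue measure. *)
Lemma ge0_integral_surface_trot (U : 'M[R]_N) (F : N.-tuple RT -> \bar R) :
  U *m U^T = 1%:M -> measurable_fun setT F -> (forall x, (0 <= F x)%E) ->
  (\int[omega]_s F (trot U s) = \int[omega]_s F s)%E.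
Proof.
move=> UU mF F0; have mU := @measurable_trot R N U.
rewrite !ge0_integral_surface//; last exact: (measurableT_comp mF mU).
congr (_ * _)%E.
rewrite [LHS]integral_mkcond [RHS]integral_mkcond.
rewrite -[RHS](ge0_integral_trot UU); last 2 first.
- apply/(measurable_restrictT _ _).1; first exact: measurable_punctured_ball.
  apply: measurable_funTS; apply: (measurableT_comp mF); exact: measurable_radial_proj.
- by move=> x; rewrite patchE; case: ifP.
apply: eq_integral => x _; rewrite !patchE.
have -> : (trot U x \in @punctured_ball R N) = (x \in @punctured_ball R N).
  by apply/idP/idP; rewrite !inE /punctured_ball /= enorm_trot.
by rewrite !radial_projE enorm_trot// trot_tscale.
Qed.

End Surface.

(** * Fourier and Laplace inversion *)

Section FourierInversion.
Variables (R : realType).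
Local Notation RT := (measurableTypeR R).
Local Notation leb := (@lebesgue_measure R).

Let mTT (T : R) : measurable (`[- T, T]%classic : set RT).
Proof. exact: measurable_itv. Qed.

Let eq_integrable_itv (T : R) (f g : RT -> R) : f =1 g ->
  leb.-integrable `[- T, T] (fun y => (f y)%:E) ->
  leb.-integrable `[- T, T] (fun y => (g y)%:E).
Proof. by move=> /funext ->. Qed.

(** The vertical integral without the factor i of dz = i dy, and with its limit named, which makes
    it stable under linear combinations. Integrability is asked only on bounded segments, because
    the integrands may fail to be absolutely integrable on the whole line. *)
Definition line_cvg (f : RT -> R[i]) (l : R[i]) : Prop :=
  [/\ forall T : R, leb.-integrable `[- T, T] (fun y => (Re (f y))%:E),
      forall T : R, leb.-integrable `[- T, T] (fun y => (Im (f y))%:E),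
      \int[leb]_(y in `[- T, T]) Re (f y) @[T --> +oo] --> Re l &
      \int[leb]_(y in `[- T, T]) Im (f y) @[T --> +oo] --> Im l].

Lemma line_cvgZ c f l : line_cvg f l -> line_cvg (fun y => c * f y) (c * l).
Proof.
move=> [i1 i2 l1 l2].
have ii (a b : R) T : leb.-integrable `[- T, T] (fun y => (a * Re (f y) + b * Im (f y))%:E) /\
    \int[leb]_(y in `[- T, T]) (a * Re (f y) + b * Im (f y)) =
    a * \int[leb]_(y in `[- T, T]) Re (f y) + b * \int[leb]_(y in `[- T, T]) Im (f y).
  have j1 : leb.-integrable `[- T, T] (EFin \o (fun y => a * Re (f y))).
    by have := integrableZl (mTT T) a (i1 T).
  have j2 : leb.-integrable `[- T, T] (EFin \o (fun y => b * Im (f y))).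
    by have := integrableZl (mTT T) b (i2 T).
  split; first by have := integrableD (mTT T) j1 j2.
  by rewrite RintegralD// !RintegralZl.
have e1 y : Re (c * f y) = Re c * Re (f y) + - Im c * Im (f y) by rewrite cReM mulNr.
have e2 y : Im (c * f y) = Im c * Re (f y) + Re c * Im (f y) by rewrite cImM addrC.
split.
- by move=> T; apply: eq_integrable_itv (ii (Re c) (- Im c) T).1 => y; rewrite e1.
- by move=> T; apply: eq_integrable_itv (ii (Im c) (Re c) T).1 => y; rewrite e2.
- rewrite cReM -mulNr.
  under eq_fun do rewrite (eq_Rintegral _ (fun y _ => e1 y)) (ii _ _ _).2.
  by apply: cvgD; exact: cvgMr.
- rewrite cImM addrC.
  under eq_fun do rewrite (eq_Rintegral _ (fun y _ => e2 y)) (ii _ _ _).2.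
  by apply: cvgD; exact: cvgMr.
Qed.

Lemma line_cvgD f g l m : line_cvg f l -> line_cvg g m ->
  line_cvg (fun y => f y + g y) (l + m).
Proof.
move=> [i1 i2 l1 l2] [j1 j2 m1 m2]; split.
- move=> T; apply: (@eq_integrable_itv T (fun y => Re (f y) + Re (g y))).
    by move=> y; rewrite cReD.
  by have := integrableD (mTT T) (i1 T) (j1 T).
- move=> T; apply: (@eq_integrable_itv T (fun y => Im (f y) + Im (g y))).
    by move=> y; rewrite cImD.
  by have := integrableD (mTT T) (i2 T) (j2 T).
- rewrite cReD; have e T : \int[leb]_(y in `[- T, T]) Re (f y + g y) =
    \int[leb]_(y in `[- T, T]) Re (f y) + \int[leb]_(y in `[- T, T]) Re (g y).
    by under eq_Rintegral do rewrite cReD; rewrite RintegralD.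
  by under eq_fun do rewrite e; exact: cvgD.
- rewrite cImD; have e T : \int[leb]_(y in `[- T, T]) Im (f y + g y) =
    \int[leb]_(y in `[- T, T]) Im (f y) + \int[leb]_(y in `[- T, T]) Im (g y).
    by under eq_Rintegral do rewrite cImD; rewrite RintegralD.
  by under eq_fun do rewrite e; exact: cvgD.
Qed.

Lemma eq_line_cvg f g l : f =1 g -> line_cvg f l -> line_cvg g l.
Proof. by move=> /funext ->. Qed.

Let cts_cos (a : R) : continuous (fun y : R => cos (y * a)).
Proof.
move=> y; apply: (@continuous_comp _ _ _ (fun y : R => y * a) (@cos R)).
  exact: cvgMl.
exact: continuous_cos.
Qed.

Let cts_sin (a : R) : continuous (fun y : R => sin (y * a)).
Proof.
move=> y; apply: (@continuous_comp _ _ _ (fun y : R => y * a) (@sin R)).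
  exact: cvgMl.
exact: continuous_sin.
Qed.

Let der_mul (a y : R) : is_derive y 1 (fun y : R => y * a) a.
Proof.
have -> : (fun y : R => y * a) = a *: (id : R -> R).
  by apply/funext => z; rewrite mulrC.
by apply: is_derive_eq; rewrite /GRing.scale/= mulr1.
Qed.

Lemma Rintegral_cos (a T : R) : 0 < T -> a != 0 ->
  \int[leb]_(y in `[- T, T]) cos (y * a) = 2 * sin (T * a) / a.
Proof.
move=> T0 a0; have d (y : R) : is_derive y 1 (fun y : R => a^-1 * sin (y * a)) (cos (y * a)).
  have -> : (fun y : R => a^-1 * sin (y * a)) = a^-1 *: (@sin R \o (fun y : R => y * a)) by [].
  by have := der_mul a y => dm; apply: is_derive_eq; rewrite /GRing.scale/=; field.
rewrite (Rintegral_itv_derive _ d)//; last lra.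
by rewrite mulNr sinN; field.
Qed.

Lemma Rintegral_sin (a T : R) : 0 < T ->
  \int[leb]_(y in `[- T, T]) sin (y * a) = 0.
Proof.
move=> T0; have [->|a0] := eqVneq a 0.
  under eq_Rintegral do rewrite mulr0 sin0.
  by rewrite /Rintegral integral0.
have d (y : R) : is_derive y 1 (fun y : R => (- a^-1) * cos (y * a)) (sin (y * a)).
  have -> : (fun y : R => (- a^-1) * cos (y * a)) = (- a^-1) *: (@cos R \o (fun y : R => y * a)) by [].
  by have := der_mul a y => dm; apply: is_derive_eq; rewrite /GRing.scale/=; field.
rewrite (Rintegral_itv_derive _ d)//; last lra.
by rewrite (mulNr T) cosN subrr.
Qed.

(** On a bounded segment the integrand is jointly integrable, so the orders may be exchanged. The
    phase, integrated first in y, then becomes the Dirichlet kernel. *)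
Lemma truncated_fubini (h : RT -> R) (k : RT * RT -> R) (T : R) :
  leb.-integrable setT (EFin \o h) -> measurable_fun setT k ->
  (forall p, `|k p| <= 1) ->
  leb.-integrable `[- T, T] (fun y => (\int[leb]_x (h x * k (y, x)))%:E) /\
  \int[leb]_(y in `[- T, T]) \int[leb]_x (h x * k (y, x)) =
  \int[leb]_x (h x * \int[leb]_(y in `[- T, T]) k (y, x)).
Proof.
move=> hi mk k1; pose I : RT -> R := \1_(`[- T, T] : set R).
have Ii : leb.-integrable setT (EFin \o I) by exact: integrable_indic_itv.
have mh : measurable_fun setT h by apply/measurable_EFinP; exact: measurable_int hi.
have [ti _] := integrable_tensor Ii (integrable_norm hi).
pose F (p : RT * RT) := I p.1 * (h p.2 * k p).
have mI : measurable_fun setT I by apply/measurable_EFinP; exact: measurable_int Ii.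
have Fi : (leb \x leb)%E.-integrable setT (EFin \o F).
  apply: (le_integrable measurableT _ _ ti).
    apply/measurable_EFinP; apply: measurable_funM.
      exact: (measurableT_comp mI).
    by apply: measurable_funM => //; exact: (measurableT_comp mh).
  move=> p _; rewrite /F lee_fin /= !normrM normr_id.
  by rewrite ler_wpM2l// -[leRHS]mulr1 ler_wpM2l.
have [F1 F2] := integrable_prod12 Fi; have F3 := integral_prod21 Fi.
have ID (f : RT -> R) (y : RT) : I y * f y = ((f : R -> R) \_ `[- T, T]) y.
  by rewrite patchE /I indicE; case: ifP => _; rewrite ?mul1r ?mul0r.
have FE y : \int[leb]_x F (y, x) =
    ((fun y : R => \int[leb]_x (h x * k (y, x))) \_ `[- T, T]) y.
  rewrite patchE /F /= (_ : I y = (y \in `[- T, T]%classic)%:R); last by rewrite /I indicE.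
  case: ifP => _; first by apply: eq_Rintegral => x _; rewrite mul1r.
  under eq_Rintegral do rewrite mul0r.
  by rewrite /Rintegral integral0.
split.
  apply/integrable_mkcond => //; rewrite restrict_EFin /comp.
  by under eq_fun do rewrite -FE.
rewrite [LHS]Rintegral_mkcond; under eq_Rintegral do rewrite -FE.
rewrite F2 -F3; apply: eq_Rintegral => x _ /=.
have Iki : leb.-integrable setT (EFin \o (fun y : RT => I y * k (y, x))).
  apply: integrableM_le1 => //; exact: (measurableT_comp mk (pair2_measurable x)).
rewrite [in RHS]Rintegral_mkcond -RintegralZl//; last first.
  by rewrite (_ : _ \_ _ = (fun y : RT => I y * k (y, x)))//; apply/funext => y; rewrite -ID.
apply: eq_Rintegral => y _; rewrite -(ID (fun y => k (y, x))) /F /=; ring.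
Qed.

Variable x0 : R.

Let kc (p : RT * RT) : R := cos (p.1 * (x0 - p.2)).
Let ks (p : RT * RT) : R := sin (p.1 * (x0 - p.2)).

Let m_phase : measurable_fun setT (fun p : RT * RT => p.1 * (x0 - p.2) : R).
Proof.
apply: measurable_funM; first exact: measurable_fst.
by apply: measurable_funB => //; exact: measurable_snd.
Qed.

Let mkc : measurable_fun setT kc.
Proof. by apply: (measurableT_comp _ m_phase); exact: measurable_cos. Qed.

Let mks : measurable_fun setT ks.
Proof. by apply: (measurableT_comp _ m_phase); exact: measurable_sin. Qed.

Let kc1 p : `|kc p| <= 1. Proof. exact: norm_cos_le1. Qed.
Let ks1 p : `|ks p| <= 1. Proof. exact: norm_sin_le1. Qed.

(** A comparison function with value 1 at [x0] and explicit Fourier transform. Subtracting [h x0]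
    times it from h leaves a function that vanishes at [x0]. *)
Let gau (x : RT) : R := expR (- (1 * (x - x0) ^+ 2)).

Let gau_cos (y : R) : leb.-integrable setT (EFin \o gau) /\
  \int[leb]_x (gau x * kc (y, x)) = Num.sqrt pi * expR (- (4^-1 * y ^+ 2)).
Proof.
(* [b] and [c] are the linear and constant coefficients of - (x - x0)^2 + i y (x0 - x). *)
pose b : R[i] := (2 * x0) +i* (- y); pose c : R[i] := (- x0 ^+ 2) +i* (y * x0).
have R1 : 0 < Re (1 : R[i]) by exact: ltr01.
have e (x : RT) : cexp c * gexp 1 b x = (gau x)%:C * cexp (0 +i* (y * (x0 - x))).
  rewrite /gau -cexpR /gexp -!cexpD; congr cexp.
  by apply: eq_complexE; rewrite !complexE /=; ring.
have gi := cintegrable_gexp b R1.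
split.
  rewrite (_ : gau = fun x => expR (- x0 ^+ 2) * Re (gexp 1 (2 * x0)%:C x)).
    have [h _] := cintegrable_gexp (2 * x0)%:C R1.
    by have := integrableZl measurableT (expR (- x0 ^+ 2)) h.
  apply/funext => x; rewrite /gexp /gau.
  rewrite (_ : _ + _ = (- x ^+ 2 + 2 * x0 * x)%:C).
    by rewrite cexpR /= -expRD; congr expR; ring.
  by apply: eq_complexE; rewrite !complexE /=; ring.
have := cintZ (cexp c) gi; rewrite cint_gexp// => /(congr1 Re).
rewrite (eq_cint _ e) -[1 : R[i]]/(1%:C) => eR.
transitivity (Re (cint leb (fun x : RT => (gau x)%:C * cexp (0 +i* (y * (x0 - x)))))).
  apply: eq_Rintegral => x _; rewrite cReMl /cexp /= expR0 mul1r //.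
rewrite eR.
have -> : csqi 1%:C = 1 :> R[i].
  by apply/esym/csqi_unique; rewrite ?expr1n ?mulr1//; left.
rewrite mulr1 mulrCA -cexpD.
have -> : c + b ^+ 2 / (4 * 1%:C) = (- (4^-1 * y ^+ 2))%:C.
  have -> : (4 * 1%:C)^-1 = (4^-1)%:C :> R[i] by rewrite mulr1 -[4]/(4%:R) -(rmorph_nat (real_complex R)) fmorphV.
  by apply: eq_complexE; rewrite expr2 !complexE /=; field.
by rewrite cexpR cReMl.
Qed.

(** The Lipschitz bound at [x0] makes psi = phi / (x - x0) integrable. Against the Dirichlet kernel,
    phi gives twice the integral of psi sin(T (x - x0)), to which the Riemann-Lebesgue lemma
    applies. *)
Let dirichlet_cvg0 (phi : RT -> R) (K e : R) : 0 < e ->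
  leb.-integrable setT (EFin \o phi) ->
  (forall x, `|x - x0| < e -> `|phi x| <= K * `|x - x0|) ->
  \int[leb]_x (phi x * \int[leb]_(y in `[- T, T]) kc (y, x)) @[T --> +oo] --> (0 : R).
Proof.
move=> e0 phii phiK; have mphi : measurable_fun setT phi.
  by apply/measurable_EFinP; exact: measurable_int phii.
have K0 : 0 <= K.
  have := phiK (x0 + e / 2); rewrite addrAC subrr add0r gtr0_norm ?divr_gt0//.
  have e2 : e / 2 < e by lra.
  move=> /(_ e2) h; have {h} := le_trans (normr_ge0 _) h.
  by rewrite pmulr_lge0// divr_gt0.
(* At [x0] the quotient is 0, since the inverse of 0 is 0. *)
pose psi (x : RT) : R := phi x / (x - x0).
have mpsi : measurable_fun setT psi.
  rewrite (_ : psi = fun x => phi x * ((x - x0) * ((x - x0) ^+ 2) `^ (-1))); last first.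
    apply/funext => x; rewrite /psi; congr (_ * _); rewrite powR_inv1 ?sqr_ge0//.
    have [->|x1] := eqVneq (x - x0) 0; first by rewrite mul0r invr0.
    by field.
  have mx : measurable_fun setT (fun x : RT => x - x0 : R) by apply: measurable_funB.
  apply: measurable_funM => //; apply: measurable_funM => //.
  by apply: (measurableT_comp (measurable_powR _)); exact: measurable_funX.
have psii : leb.-integrable setT (EFin \o psi).
  pose g (x : RT) : R := K * \1_(`[x0 - e, x0 + e] : set R) x + e^-1 * `|phi x|.
  have gi : leb.-integrable setT (EFin \o g).
    have h1 : leb.-integrable setT (fun x : RT => (\1_(`[x0 - e, x0 + e] : set R) x)%:E).
      exact: integrable_indic_itv.
    by case: (integrable_linear K e^-1 h1 (integrable_norm phii)).
  apply: (le_integrable measurableT _ _ gi); first exact/measurable_EFinP.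
  move=> x _; rewrite lee_fin; apply: le_trans (ler_norm _).
  rewrite /psi /g normrM normfV; have [xe|xe] := ltP `|x - x0| e.
    have -> : \1_(`[x0 - e, x0 + e] : set R) x = 1 :> R.
      rewrite indicE mem_set//= in_itv/=; move: xe; rewrite ltr_norml => /andP[? ?].
      by apply/andP; split; lra.
    rewrite mulr1; apply: ler_wpDr; first by rewrite mulr_ge0// invr_ge0 ltW.
    have [->|x1] := eqVneq (x - x0) 0; first by rewrite normr0 invr0 mulr0.
    by rewrite ler_pdivrMr ?normr_gt0// phiK.
  rewrite -[leLHS]add0r; apply: lerD; first by rewrite mulr_ge0// indicE.
  by rewrite mulrC ler_wpM2r// lef_pV2// posrE (lt_le_trans e0).
have := riemann_lebesgue x0 psii => h.
rewrite -(mulr0 (2 : R)).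
have h2 : 2 * \int[leb]_x (psi x * sin (T * (x - x0))) @[T --> +oo] --> (2 * 0 : R) by exact: cvgMr.
apply: cvg_trans h2; apply: near_eq_cvg; near=> T.
have T0 : 0 < T by near: T; exact: nbhs_pinfty_gt.
have si : leb.-integrable setT (EFin \o (fun x : RT => psi x * sin (T * (x - x0)))).
  apply: integrableM_le1 => // [|x]; last exact: norm_sin_le1.
  apply: measurableT_comp; first exact: measurable_sin.
  by apply: measurable_funM => //; exact: measurable_funB.
rewrite -RintegralZl//; apply: eq_Rintegral => x _.
have [->|x1] := eqVneq x x0.
  have -> : phi x0 = 0.
    have := phiK x0; rewrite subrr normr0 mulr0 => /(_ e0).
    by rewrite normr_le0 => /eqP.
  by rewrite /psi subrr invr0 mulr0 !mul0r mulr0.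
have x2 : x - x0 != 0 by rewrite subr_eq0.
have x3 : x0 - x != 0 by rewrite -opprB oppr_eq0.
have := Rintegral_cos T0 x3; rewrite -/kc => ->.
rewrite /psi -opprB mulrN sinN; field.
by rewrite ?x2 ?oppr_eq0.
Unshelve. all: by end_near. Qed.

Let gauss_cvg : \int[leb]_(y in `[- T, T]) \int[leb]_x (gau x * kc (y, x)) @[T --> +oo] --> (2 * pi : R).
Proof.
have ig := @integrable_gauss R 4^-1 ltac:(by rewrite invr_gt0).
have e T : \int[leb]_(y in `[- T, T]) \int[leb]_x (gau x * kc (y, x)) =
    Num.sqrt pi * \int[leb]_(y in `[- T, T]) expR (- (4^-1 * y ^+ 2)).
  under eq_Rintegral do rewrite (gau_cos _).2.
  by rewrite RintegralZl//; apply: integrableS ig.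
under eq_fun do rewrite e.
have -> : 2 * pi = Num.sqrt pi * \int[leb]_y expR (- (4^-1 * y ^+ 2)) :> R.
  rewrite /Rintegral integral_gauss ?invr_gt0//= -sqrtrM ?pi_ge0// invrK.
  have -> : pi * (pi * 4) = (2 * pi) ^+ 2 :> R by ring.
  by rewrite sqrtr_sqr ger0_norm// mulr_ge0// pi_ge0.
apply: cvgMr; apply/cvg_pinftyP => u uy.
exact: cvg_Rintegral_symmetric_itv.
Qed.

(** h is split into [h x0] times the Gaussian [gau], which produces the limit 2 pi [h x0], and a
    remainder that is Lipschitz at [x0] and vanishes there, which contributes nothing. *)
Theorem fourier_inversion (h : RT -> R) (K e : R) : 0 < e ->
  leb.-integrable setT (EFin \o h) ->
  (forall x, `|x - x0| < e -> `|h x - h x0| <= K * `|x - x0|) ->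
  line_cvg (fun y => cint leb (fun x : RT => (h x)%:C * cexp (0 +i* (y * (x0 - x)))))
    (2 * pi * h x0)%:C.
Proof.
move=> e0 hi hK.
have eR y x : Re ((h x)%:C * cexp (0 +i* (y * (x0 - x)))) = h x * kc (y, x).
  by rewrite cReMl /cexp /= expR0 mul1r.
have eI y x : Im ((h x)%:C * cexp (0 +i* (y * (x0 - x)))) = h x * ks (y, x).
  by rewrite cImMl /cexp /= expR0 mul1r.
have ER y : Re (cint leb (fun x : RT => (h x)%:C * cexp (0 +i* (y * (x0 - x))))) =
    \int[leb]_x (h x * kc (y, x)) by apply: eq_Rintegral => x _; rewrite eR.
have EI y : Im (cint leb (fun x : RT => (h x)%:C * cexp (0 +i* (y * (x0 - x))))) =
    \int[leb]_x (h x * ks (y, x)) by apply: eq_Rintegral => x _; rewrite eI.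
split.
- by move=> T; apply: eq_integrable_itv (truncated_fubini T hi mkc kc1).1 => y; rewrite ER.
- by move=> T; apply: eq_integrable_itv (truncated_fubini T hi mks ks1).1 => y; rewrite EI.
- under eq_fun do under eq_Rintegral do rewrite ER.
  pose phi (x : RT) : R := 1 * h x + - h x0 * gau x.
  have gi := (gau_cos 0).1.
  have [phii _] := integrable_linear 1 (- h x0) hi gi.
  have gx0 : gau x0 = 1 by rewrite /gau subrr expr0n/= mulr0 oppr0 expR0.
  (* Cutting the window at 1 turns the quadratic bound on 1 - [gau x] into a linear one. *)
  have phiK x : `|x - x0| < Num.min e 1 -> `|phi x| <= (K + `|h x0|) * `|x - x0|.
    rewrite lt_min => /andP[xe x1].
    have -> : phi x = (h x - h x0) + h x0 * (1 - gau x) by rewrite /phi; ring.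
    apply: le_trans (ler_normD _ _) _; rewrite mulrDl; apply: lerD; first exact: hK.
    rewrite normrM ler_wpM2l//.
    have g1 : gau x <= 1 by rewrite /gau mul1r -[leRHS]expR0 ler_expR oppr_le0 sqr_ge0.
    rewrite ger0_norm ?subr_ge0//.
    have := expR_ge1Dx (- (1 * (x - x0) ^+ 2)); rewrite -/(gau x).
    have : `|x - x0| ^+ 2 <= `|x - x0| by rewrite expr2 -[leRHS]mulr1 ler_wpM2l// ltW.
    rewrite real_normK ?num_real//; lra.
  have m0 : 0 < Num.min e 1 by rewrite lt_min e0 ltr01.
  have c1 := dirichlet_cvg0 m0 phii phiK.
  have c2 : h x0 * \int[leb]_(y in `[- T, T]) \int[leb]_x (gau x * kc (y, x))
      @[T --> +oo] --> h x0 * (2 * pi) by exact: cvgMr.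
  suff c4 : \int[leb]_(y in `[- T, T]) \int[leb]_x (h x * kc (y, x)) @[T --> +oo]
      --> (2 * pi * h x0 : R) by exact: c4.
  have c3 : \int[leb]_x (phi x * \int[leb]_(y in `[- T, T]) kc (y, x)) +
      h x0 * \int[leb]_(y in `[- T, T]) \int[leb]_x (gau x * kc (y, x))
      @[T --> +oo] --> (2 * pi * h x0 : R).
    by rewrite -[X in _ --> X]add0r [2 * pi * _]mulrC; exact: cvgD c1 c2.
  apply: cvg_trans c3; apply: near_eq_cvg; near=> T.
  have [i1 e1] := truncated_fubini T hi mkc kc1.
  have [i2 e2] := truncated_fubini T phii mkc kc1.
  have [i3 e3] := truncated_fubini T gi mkc kc1.
  rewrite -e2 -RintegralZl// -RintegralD//; last first.
    by have := integrableZl (mTT T) (h x0) i3.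
  apply: eq_Rintegral => y _.
  have ki (f : RT -> R) : leb.-integrable setT (EFin \o f) ->
      leb.-integrable setT (EFin \o (fun x : RT => f x * kc (y, x))).
    move=> fi; apply: integrableM_le1 => //.
    exact: (measurableT_comp mkc (pair1_measurable y)).
  rewrite -RintegralZl//; last exact: ki.
  rewrite -RintegralD//; [|exact: ki|].
    by apply: eq_Rintegral => x _; rewrite /phi; ring.
  by have := integrableZl measurableT (h x0) (ki _ gi).
(* The sine kernel is odd in y, so symmetric truncation makes the imaginary part exactly zero for
   every T > 0. *)
- under eq_fun do under eq_Rintegral do rewrite EI.
  apply: (@cvg_trans _ ((0 : R) @[T --> +oo%R])); last exact: cvg_cst.
  apply: near_eq_cvg; near=> T.
  have T0 : 0 < T by near: T; exact: nbhs_pinfty_gt.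
  rewrite (truncated_fubini T hi mks ks1).2.
  have sx (x : RT) : \int[leb]_(y in `[- T, T]) ks (y, x) = 0 by exact: (@Rintegral_sin (x0 - x) T T0).
  under eq_Rintegral do rewrite sx mulr0.
  by rewrite /Rintegral integral0.
Unshelve. all: by end_near. Qed.

End FourierInversion.

(** * Lipschitz bounds at a point *)

Section LipschitzAt.
Variable R : realType.
Implicit Types (f g : R -> R) (x u c : R).

(** The local hypothesis of [fourier_inversion]. It concerns one base point only, so the radial
    density may be singular at 0. *)
Definition lip_at f x : Prop := exists C e : R,
  0 < e /\ forall u, `|u - x| < e -> `|f u - f x| <= C * `|u - x|.

Lemma lip_at_eq f g x (e : R) : 0 < e -> (forall u, `|u - x| < e -> f u = g u) ->
  lip_at f x -> lip_at g x.
Proof.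
move=> e0 fg [C [e1 [e10 h]]]; exists C, (Num.min e e1).
split=> [|u]; rewrite lt_min ?e0// => /andP[ue ue1].
by rewrite -!fg ?subrr ?normr0//; exact: h.
Qed.

Lemma lip_atM f g x : lip_at f x -> lip_at g x -> lip_at (fun u => f u * g u) x.
Proof.
move=> [C [e [e0 h]]] [D [e1 [e10 k]]].
exists (C * (`|g x| + `|D| * e1) + `|f x| * D), (Num.min e e1).
split=> [|u]; rewrite lt_min ?e0// => /andP[ue ue1].
have -> : f u * g u - f x * g x = (f u - f x) * g u + f x * (g u - g x) by ring.
have gu : `|g u| <= `|g x| + `|D| * e1.
  have -> : g u = g x + (g u - g x) by ring.
  apply: le_trans (ler_normD _ _) _; rewrite lerD2l.
  apply: le_trans (k _ ue1) _.
  apply: (@le_trans _ _ (`|D| * `|u - x|)); first by rewrite ler_wpM2r// ler_norm.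
  by rewrite ler_wpM2l// ltW.
apply: le_trans (ler_normD _ _) _; rewrite !normrM mulrDl; apply: lerD.
  rewrite mulrAC; apply: ler_pM => //; exact: h.
by rewrite -mulrA ler_wpM2l// k.
Qed.

Lemma lip_at_derive f x (d : R) : is_derive x 1 f d -> lip_at f x.
Proof.
move=> fd; have fx : derivable f x 1 by exact: ex_derive.
have fE : 'D_1 f x = d by exact: derive_val.
have := fx; rewrite /derivable => /cvg_ex[l hl].
have /cvgrPdist_lt/(_ 1 ltr01) := hl.
rewrite near_withinE => /nbhs_ballP[e /= e0 h].
exists (`|l| + 1), e; split=> // u ue.
have [->|ux] := eqVneq u x; first by rewrite !subrr normr0 mulr0.
have ux0 : u - x != 0 by rewrite subr_eq0.
have := h (u - x); rewrite /ball/= sub0r normrN => /(_ ue ux0).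
rewrite /GRing.scale/= mulr1 subrK => hu.
have -> : f u - f x = ((u - x)^-1 * (f u - f x)) * (u - x) by field.
rewrite normrM ler_wpM2r//.
set v := _ * _ in hu *.
have -> : v = l - (l - v) by ring.
by apply: le_trans (ler_normB _ _) _; rewrite lerD2l ltW.
Qed.

End LipschitzAt.

(** * Inversion of Laplace transforms in the squared radius *)

Section LaplaceInversion.
Variables (R : realType) (N : nat).
Hypothesis N_gt0 : (0 < N)%N.
Local Notation RT := (measurableTypeR R).
Local Notation leb := (@lebesgue_measure R).
Local Notation lebt := (lebesgue_tuple R N).
Local Notation omega := (surface_measure R N).
Local Notation S := (sphere R N).
Implicit Types (x y s : N.-tuple RT).

Let NR0 : 0 < N%:R :> R. Proof. by rewrite ltr0n. Qed.

Lemma lip_at_polar_density (c rho : R) : 0 < rho ->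
  lip_at (fun u => polar_density N u * expR (- (c * u))) rho.
Proof.
move=> r0; apply: lip_atM.
  pose b : R := 2^-1 * N%:R `^ ((1 - N%:R) / 2).
  (* Within distance [rho] of [rho] the variable stays positive, and the density is there a constant
     times a power. *)
  apply: (@lip_at_eq _ (fun u => b * u `^ (N%:R / 2 - 1)) _ _ rho r0).
    move=> u ur; rewrite /polar_density ifT//.
    by move: ur; rewrite ltr_norml => /andP[? _]; lra.
  have d1 := @is_derive1_powR R (N%:R / 2 - 1) rho r0.
  apply: (@lip_at_derive _ _ _ (b *: ((N%:R / 2 - 1) * rho `^ (N%:R / 2 - 1 - 1)))).
apply: (@lip_at_derive _ _ _ (expR (- (c * rho)) * - c)).
have dm : is_derive rho 1 (fun u : R => - (c * u)) (- c).
  have -> : (fun u : R => - (c * u)) = (- c) *: (id : R -> R).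
    by apply/funext => z; rewrite /= -mulNr.
  by apply: is_derive_eq; rewrite /GRing.scale/= mulr1.
have -> : (fun u : R => expR (- (c * u))) = @expR R \o (fun u => - (c * u)) by [].
by apply: is_derive_eq; rewrite /GRing.scale/= mulrC.
Qed.

(** The bound is asked only at capped points: a constant uniform in s is available on the sphere but
    not on all of R^N, and the integral does not see the difference. *)
Lemma lip_at_surface_integral (f : R -> N.-tuple RT -> R) (rho C e : R) : 0 < e ->
  (forall r, measurable_fun setT (f r)) ->
  (forall r, omega.-integrable setT (EFin \o f r)) ->
  (forall r s, `|r - rho| < e ->
    `|f r (sphere_cap s) - f rho (sphere_cap s)| <= C * `|r - rho|) ->
  lip_at (fun r => \int[omega]_s f r s) rho.
Proof.
move=> e0 mf fi fC.
exists (C * area R N), e; split=> // r re.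
have capE u : \int[omega]_s f u s = \int[omega]_s f u (sphere_cap s).
  congr fine; rewrite -(integral_sphere_cap (F := EFin \o f u))//.
  exact/measurable_EFinP.
have capi u : omega.-integrable setT (EFin \o (fun s => f u (sphere_cap s))).
  apply/integrableP; split.
    by apply/measurable_EFinP; exact: (measurableT_comp (mf u) (@measurable_sphere_cap R N)).
  rewrite (integral_sphere_cap (F := fun s => `|(f u s)%:E|%E)).
    by case/integrableP: (fi u).
  by apply: measurableT_comp => //; exact/measurable_EFinP.
rewrite !capE -RintegralB//.
have bi : omega.-integrable setT (EFin \o (fun s => f r (sphere_cap s) - f rho (sphere_cap s))).
  by have := integrableB measurableT (capi r) (capi rho).
apply: le_trans (le_normr_Rintegral measurableT bi) _.
have -> : C * area R N * `|r - rho| = \int[omega]_s (C * `|r - rho|).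
  by rewrite Rintegral_surface_cst//; ring.
apply: le_Rintegral => //.
- exact: integrable_norm.
- exact: finite_measure_integrable_cst.
- by move=> s _; exact: fC.
Qed.

(** Polar coordinates for signed functions, through positive and negative parts, with the result
    stated on the product so that Fubini's theorem applies next. *)
Lemma integrable_polar (F : N.-tuple RT -> R) : lebt.-integrable setT (EFin \o F) ->
  let Phi (p : RT * N.-tuple RT) := polar_density N p.1 * F (tscale (Num.sqrt (p.1 / N%:R)) p.2) in
  (leb \x omega)%E.-integrable setT (EFin \o Phi) /\
  \int[lebt]_x F x = \int[(leb \x omega)%E]_p Phi p.
Proof.
move=> Fi Phi; have mF : measurable_fun setT (EFin \o F) by exact: measurable_int Fi.
have mt : measurable_fun setT (fun p : RT * N.-tuple RT => tscale (Num.sqrt (p.1 / N%:R)) p.2).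
  apply: measurable_tscalef => //; apply: measurable_fun_sqrt.
  by apply: measurable_funM => //; exact: measurable_fst.
have polE (G : N.-tuple RT -> \bar R) : measurable_fun setT G -> (forall x, (0 <= G x)%E) ->
    (\int[lebt]_x G x = \int[leb \x omega]_p ((polar_density N p.1)%:E *
      G (tscale (Num.sqrt (p.1 / N%:R)) p.2)))%E.
  move=> mG G0; have mGt := measurableT_comp mG mt.
  rewrite ge0_integral_polar// fubini_tonelli1/=; first last.
  - by move=> p; apply: mule_ge0 => //; rewrite lee_fin polar_density_ge0.
  - apply: emeasurable_funM => //; apply/measurable_EFinP.
    by apply: measurableT_comp; [exact: measurable_polar_density|exact: measurable_fst].
  apply: eq_integral => rho _; rewrite /fubini_F -ge0_integralZl//.
  - exact: (measurableT_comp mGt (pair1_measurable rho)).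
  - by rewrite lee_fin polar_density_ge0.
have mPhi : measurable_fun setT Phi.
  apply: measurable_funM.
    by apply: measurableT_comp; [exact: measurable_polar_density|exact: measurable_fst].
  by apply/measurable_EFinP; exact: (measurableT_comp mF mt).
split.
  apply/integrableP; split; first exact/measurable_EFinP.
  have [_] := integrableP _ _ _ Fi; rewrite polE//; last exact: measurableT_comp.
  apply: le_lt_trans; rewrite le_eqVlt; apply/orP; left; apply/eqP.
  apply: eq_integral => p _ /=; rewrite normrM EFinM ger0_norm ?polar_density_ge0//.
congr fine; rewrite integralE [RHS]integralE.
congr (_ - _)%E.
  rewrite polE//; last exact: measurable_funepos.
  apply: eq_integral => p _; rewrite !funeposE /= EFinM.
  by rewrite maxe_pMr ?lee_fin ?polar_density_ge0// mule0.
rewrite polE//; last exact: measurable_funeneg.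
apply: eq_integral => p _; rewrite !funenegE.
by rewrite maxe_pMr ?lee_fin ?polar_density_ge0// mule0 muleN -EFinM.
Qed.

Lemma integrable_sphere_cap (f : N.-tuple RT -> R) : measurable_fun setT f ->
  omega.-integrable setT (EFin \o (fun s => f (sphere_cap s))) <->
  omega.-integrable setT (EFin \o f).
Proof.
move=> mf; have mc := @measurable_sphere_cap R N.
have e : (\int[omega]_s `|(f (sphere_cap s))%:E| = \int[omega]_s `|(f s)%:E|)%E.
  rewrite (integral_sphere_cap (F := fun s => `|(f s)%:E|%E))//.
  by apply: measurableT_comp => //; exact/measurable_EFinP.
split=> /integrableP[_ h]; apply/integrableP; split.
- exact/measurable_EFinP.
- by rewrite -e.
- by apply/measurable_EFinP; exact: (measurableT_comp mf mc).
- by rewrite e.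
Qed.

Let ray (rho : R) s : N.-tuple RT := tscale (Num.sqrt (rho / N%:R)) s.

Let mray rho : measurable_fun setT (ray rho).
Proof. exact: measurable_tscale. Qed.

Let dot_ray rho s : 0 < rho -> S s -> dot (ray rho s) (ray rho s) = rho.
Proof.
move=> r0 sS; rewrite dot_tscalel dot_tscaler -sqr_enorm sS mulrA -expr2.
by rewrite !sqr_sqrtr ?divr_ge0 ?ltW// divfK// gt_eqF.
Qed.

(** On the sphere the ray point has squared length rho, so the radial factor g comes out of the
    integral. For rho <= 0 both sides vanish with the density. *)
Let ray_integral (K : N.-tuple RT -> R) (g : R -> R) (rho : R) :
  measurable_fun setT K -> measurable_fun setT (g : RT -> R) ->
  omega.-integrable setT (EFin \o (fun s => K (ray rho s))) ->
  \int[omega]_s (polar_density N rho * (K (ray rho s) * g (dot (ray rho s) (ray rho s)))) =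
  polar_density N rho * g rho * \int[omega]_s K (ray rho s).
Proof.
move=> mK mg Ki; have mKr := measurableT_comp mK (mray rho).
rewrite -RintegralZl//; have [r0|r0] := ltP 0 rho; last first.
  apply: eq_Rintegral => s _.
  by rewrite /polar_density ltNge r0/= !mul0r.
congr fine; apply: ae_eq_integral => //.
- apply/measurable_EFinP; apply: measurable_funM => //; apply: measurable_funM => //.
  apply: (measurableT_comp mg); exact: (measurable_dot (mray rho) (mray rho)).
- by apply/measurable_EFinP; exact: measurable_funM.
exists (~` S); split; first exact: measurableC (@measurable_sphere R N).
  exact: surface_measure_setC_sphere.
move=> s; apply: contra_not => sS _ /=.
by rewrite dot_ray//; congr (_%:E); ring.
Qed.

Let gm (c : R) : measurable_fun setT (fun r : RT => expR (- (c * r))).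
Proof. by apply: measurableT_comp => //; apply: measurableT_comp => //; exact: measurable_funM. Qed.

Let Re_laplace (c y r : R) :
  Re (cexp (- (c +i* y) * r%:C)) = expR (- (c * r)) * cos (y * r).
Proof. by rewrite /cexp /= !mulr0 subr0 add0r !mulNr cosN. Qed.

Let Im_laplace (c y r : R) :
  Im (cexp (- (c +i* y) * r%:C)) = expR (- (c * r)) * - sin (y * r).
Proof. by rewrite /cexp /= !mulr0 subr0 add0r !mulNr sinN. Qed.

Section Real.
Variables (K : N.-tuple RT -> R) (gamma : R).
Hypothesis mK : measurable_fun setT K.
Hypothesis Kint : lebt.-integrable setT
  (EFin \o (fun x => K x * expR (- (gamma * dot x x)))).
Hypothesis Kray : forall rho, omega.-integrable setT
  (EFin \o (fun s => K (tscale (Num.sqrt (rho / N%:R)) s))).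

Let k rho := \int[omega]_s K (ray rho s).
(** The damped radial profile of K: the integral over R^N of K exp(-(gamma + i y) |x|^2) is the
    Fourier transform of [h] at y. *)
Let h (rho : RT) : R := polar_density N rho * expR (- (gamma * rho)) * k rho.

Let slice (v : R -> R) : measurable_fun setT (v : RT -> R) -> (forall r, `|v r| <= 1) ->
  let F x := K x * (expR (- (gamma * dot x x)) * v (dot x x)) in
  leb.-integrable setT (EFin \o (fun r : RT => h r * v r)) /\
  \int[lebt]_x F x = \int[leb]_r (h r * v r).
Proof.
move=> mv v1 F; have mdd : measurable_fun setT (fun x => dot x x : R).
  by apply: measurable_dot; exact: measurable_id.
have mE : measurable_fun setT (fun r : RT => expR (- (gamma * r)) * v r).
  by apply: measurable_funM => //; exact: gm.
have Fi : lebt.-integrable setT (EFin \o F).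
  rewrite /F; under eq_fun do rewrite mulrA.
  by apply: integrableM_le1 => //; exact: (measurableT_comp mv mdd).
have [Pi ->] := integrable_polar Fi.
have [Gi <-] := integrable_prod12 Pi.
have GE r : \int[omega]_s (polar_density N r * F (tscale (Num.sqrt (r / N%:R)) s)) = h r * v r.
  have := @ray_integral K (fun r => expR (- (gamma * r)) * v r) r mK mE (Kray r).
  by rewrite /F /ray => ->; rewrite /h /k /ray; ring.
split; last by apply: eq_Rintegral => r _; exact: GE.
apply: eq_integrable Gi => //.
by move=> r _ /=; rewrite GE.
Qed.

(** The damping exp(- gamma r) is what makes the profile integrable. Fourier inversion recovers the
    damped value at rho, and the modulus exp(gamma rho) of the prefactor removes the damping. *)
Theorem laplace_inversion (rho : R) : 0 < rho ->
  lip_at (fun r => \int[omega]_s K (tscale (Num.sqrt (r / N%:R)) s)) rho ->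
  line_cvg (fun y : RT => cexp (rho%:C * (gamma +i* y)) *
      cint lebt (fun x => (K x)%:C * cexp (- (gamma +i* y) * (dot x x)%:C)))
    (2 * pi * polar_density N rho * \int[omega]_s K (tscale (Num.sqrt (rho / N%:R)) s))%:C.
Proof.
move=> r0 klip.
have hlip : lip_at h rho by apply: lip_atM => //; exact: lip_at_polar_density.
have [C [e [e0 hC]]] := hlip.
have hi : leb.-integrable setT (EFin \o h).
  have [h1 _] := @slice (fun=> 1) ltac:(by []) ltac:(by move=> r; rewrite normr1).
  by apply: eq_integrable h1 => // r _ /=; rewrite mulr1.
have := line_cvgZ (expR (gamma * rho))%:C (fourier_inversion e0 hi hC).
have -> : (expR (gamma * rho))%:C * (2 * pi * h rho)%:C =
    (2 * pi * polar_density N rho * k rho)%:C.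
  rewrite -rmorphM; congr (_%:C); rewrite /h.
  have ee : expR (gamma * rho) * expR (- (gamma * rho)) = 1 by rewrite -expRD subrr expR0.
  transitivity (2 * pi * (expR (gamma * rho) * expR (- (gamma * rho))) * polar_density N rho * k rho); last by rewrite ee; ring.
  by ring.
apply: eq_line_cvg => y.
have mc : measurable_fun setT (fun r : RT => cos (y * r)).
  apply: measurableT_comp; [exact: measurable_cos|exact: measurable_funM].
have ms : measurable_fun setT (fun r : RT => - sin (y * r)).
  apply: measurableT_comp => //.
  apply: measurableT_comp; [exact: measurable_sin|exact: measurable_funM].
have c1 r : `|cos (y * r)| <= 1 by exact: norm_cos_le1.
have s1 r : `|- sin (y * r)| <= 1 by rewrite normrN norm_sin_le1.
have [ic ec] := slice mc c1; have [is_ es] := slice ms s1.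
have -> : cint lebt (fun x => (K x)%:C * cexp (- (gamma +i* y) * (dot x x)%:C)) =
    cint leb (fun r : RT => (h r)%:C * cexp (0 +i* (- (y * r)))).
  apply: eq_complexE.
    transitivity (\int[leb]_r (h r * cos (y * r))); last first.
      by apply: eq_Rintegral => r _; rewrite cReMl /cexp /= cosN expR0 mul1r.
    rewrite -ec; apply: eq_Rintegral => x _; by rewrite cReMl Re_laplace.
  transitivity (\int[leb]_r (h r * - sin (y * r))); last first.
    by apply: eq_Rintegral => r _; rewrite cImMl /cexp /= sinN expR0 mul1r.
  rewrite -es; apply: eq_Rintegral => x _; by rewrite cImMl Im_laplace.
have Hi : cintegrable leb (fun r : RT => (h r)%:C * cexp (0 +i* (- (y * r)))).
  split.
    apply: eq_integrable ic => // r _ /=.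
    by rewrite mul0r subr0 cosN expR0 mul1r.
  apply: eq_integrable is_ => // r _ /=.
  by rewrite mul0r addr0 sinN expR0 mul1r.
have -> : cexp (rho%:C * (gamma +i* y)) =
    (expR (gamma * rho))%:C * cexp (0 +i* (y * rho)).
  rewrite -cexpR -cexpD; congr cexp; apply: eq_complexE; rewrite !complexE /=; ring.
rewrite -mulrA; congr (_ * _); rewrite -cintZ//; apply: eq_cint => r.
rewrite mulrCA -cexpD; congr (_ * cexp _).
by apply: eq_complexE; rewrite !complexE /=; ring.
Qed.

End Real.

(** Real and imaginary parts of K are inverted separately and recombined by linearity. *)
Theorem cint_laplace_inversion (K : N.-tuple RT -> R[i]) (gamma rho : R) :
  cmeasurable K ->
  cintegrable lebt (fun x => K x * (expR (- (gamma * dot x x)))%:C) ->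
  (forall r, cintegrable omega (fun s => K (tscale (Num.sqrt (r / N%:R)) s))) ->
  0 < rho ->
  lip_at (fun r => Re (cint omega (fun s => K (tscale (Num.sqrt (r / N%:R)) s)))) rho ->
  lip_at (fun r => Im (cint omega (fun s => K (tscale (Num.sqrt (r / N%:R)) s)))) rho ->
  line_cvg (fun y : RT => cexp (rho%:C * (gamma +i* y)) *
      cint lebt (fun x => K x * cexp (- (gamma +i* y) * (dot x x)%:C)))
    ((2 * pi * polar_density N rho)%:C *
     cint omega (fun s => K (tscale (Num.sqrt (rho / N%:R)) s))).
Proof.
move=> [mK1 mK2] [i1 i2] ray_i r0 lip1 lip2.
have j1 : lebt.-integrable setT (EFin \o (fun x => Re (K x) * expR (- (gamma * dot x x)))).
  by apply: eq_integrable i1 => // x _ /=; rewrite cReM /= mulr0 subr0.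
have j2 : lebt.-integrable setT (EFin \o (fun x => Im (K x) * expR (- (gamma * dot x x)))).
  by apply: eq_integrable i2 => // x _ /=; rewrite cImM /= mulr0 add0r.
have L1 := laplace_inversion mK1 j1 (fun r => (ray_i r).1) r0 lip1.
have L2 := laplace_inversion mK2 j2 (fun r => (ray_i r).2) r0 lip2.
have := line_cvgD L1 (line_cvgZ 'i L2).
set l := _ + _; set m := _ * cint _ _.
have -> : l = m.
  by rewrite /l /m; apply: eq_complexE; rewrite !complexE /=; ring.
apply: eq_line_cvg => y.
rewrite mulrCA -mulrDr; congr (_ * _).
have cE (u : N.-tuple RT -> R) : measurable_fun setT u ->
    lebt.-integrable setT (EFin \o (fun x => u x * expR (- (gamma * dot x x)))) ->
    cintegrable lebt (fun x => (u x)%:C * cexp (- (gamma +i* y) * (dot x x)%:C)).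
  move=> mu ui; have mdd : measurable_fun setT (fun x => dot x x : R).
    by apply: measurable_dot; exact: measurable_id.
  apply: (@le_cintegrable _ _ _ _ _ (fun x => `|u x * expR (- (gamma * dot x x))|)).
  - apply: cmeasurableM; first by split.
    apply: cmeasurable_cexp; apply: cmeasurableM; first exact: cmeasurable_cst.
    by split.
  - move=> x; rewrite cReMl Re_laplace !normrM ler_wpM2l//.
    by rewrite -[leRHS]mulr1 ler_wpM2l// norm_cos_le1.
  - move=> x; rewrite cImMl Im_laplace !normrM ler_wpM2l//.
    by rewrite normrN -[leRHS]mulr1 ler_wpM2l// norm_sin_le1.
  - exact: integrable_norm.
have I1 := cE _ mK1 j1; have I2 := cE _ mK2 j2.
rewrite -cintZ// -cintD//; last exact: cintegrableZ.
apply: eq_cint => x; rewrite mulrA -mulrDl; congr (_ * _).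
by apply: eq_complexE; rewrite !complexE /=; ring.
Qed.

End LaplaceInversion.

(** * One replica *)

Section Lipschitz.
Variable R : realType.

Lemma lip_MVT (f df : R -> R) (x e B : R) : (forall u : R, is_derive u 1 f (df u)) ->
  (forall u, `|u - x| < e -> `|df u| <= B) ->
  forall u, `|u - x| < e -> `|f u - f x| <= B * `|u - x|.
Proof.
move=> fd dB u ue.
have cf : continuous f.
  by move=> v; apply/differentiable_continuous/derivable1_diffP; exact: ex_derive.
have MV (a b : R) : a <= b -> exists2 c, c \in `[a, b]%R & f b - f a = df c * (b - a).
  move=> ab; apply: MVT_segment => //; exact: continuous_subspaceT.
have [xu|/ltW ux] := leP x u.
  have [c + ->] := MV _ _ xu; rewrite in_itv/= => /andP[xc cu].
  rewrite normrM ler_wpM2r// dB//; apply: le_lt_trans ue.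
  by rewrite !ger0_norm; lra.
have [c + h] := MV _ _ ux; rewrite in_itv/= => /andP[xc cu].
rewrite distrC h normrM [`|x - u|]distrC ler_wpM2r// dB//; apply: le_lt_trans ue.
by rewrite !ler0_norm; lra.
Qed.

Lemma expR_lip (M u v : R) : u <= M -> v <= M ->
  `|expR u - expR v| <= expR M * `|u - v|.
Proof.
wlog vu : u v / v <= u.
  move=> h uM vM; have [vu|/ltW uv] := leP v u; first exact: h.
  by rewrite distrC [`|u - v|]distrC; exact: h.
move=> uM _; rewrite !ger0_norm ?subr_ge0 ?ler_expR//.
have h := expR_ge1Dx (v - u).
have e : expR v = expR u * expR (v - u) by rewrite -expRD addrC subrK.
rewrite e -[X in X - _]mulr1 -mulrBr; apply: ler_pM; rewrite ?expR_ge0 ?ler_expR//.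
  by rewrite subr_ge0 -expR0 ler_expR subr_le0.
by lra.
Qed.

End Lipschitz.

Section OneReplica.
Variables (R : realType) (N : nat).
Hypothesis N_gt0 : (0 < N)%N.
Local Notation RT := (measurableTypeR R).
Local Notation leb := (@lebesgue_measure R).
Local Notation lebt := (lebesgue_tuple R N).
Local Notation omega := (surface_measure R N).
Implicit Types (x s : N.-tuple RT).

Let NR0 : 0 < N%:R :> R. Proof. by rewrite ltr0n. Qed.

Lemma cint_sphere_cap (f : N.-tuple RT -> R[i]) : cmeasurable f ->
  cintegrable omega (fun s => f (sphere_cap s)) ->
  cintegrable omega f /\ cint omega (fun s => f (sphere_cap s)) = cint omega f.
Proof.
move=> [f1 f2] [i1 i2]; split.
  split; first exact: (integrable_sphere_cap f1).1 i1.
  exact: (integrable_sphere_cap f2).1 i2.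
apply: eq_complexE; congr fine.
  apply: (integral_sphere_cap (F := fun s => (Re (f s))%:E)); exact/measurable_EFinP.
apply: (integral_sphere_cap (F := fun s => (Im (f s))%:E)); exact/measurable_EFinP.
Qed.

(** The coefficients are complex so that the same form serves for the eigenvalues and for the poles
    [pole w i]. *)
Definition cquad (mu : 'I_N -> R[i]) x : R[i] := \sum_(i < N) mu i * (tnth x i ^+ 2)%:C.

Lemma cmeasurable_cquad mu : cmeasurable (cquad mu).
Proof.
have m2 i : measurable_fun setT (fun x : N.-tuple RT => tnth x i ^+ 2 : R).
  by apply: measurable_funX; apply: measurable_tnth.
split; rewrite /cquad.
  under eq_fun do rewrite Re_sum.
  apply: measurable_sum => i; under eq_fun do rewrite cReM /= mulr0 subr0.
  exact: measurable_funM.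
under eq_fun do rewrite Im_sum.
apply: measurable_sum => i; under eq_fun do rewrite cImM /= mulr0 add0r.
exact: measurable_funM.
Qed.

Lemma cquad_tscale mu c x : cquad mu (tscale c x) = (c ^+ 2)%:C * cquad mu x.
Proof.
rewrite /cquad mulr_sumr; apply: eq_bigr => i _.
by rewrite tnth_tscale exprMn rmorphM/= mulrCA.
Qed.

Definition cquad_bound (mu : 'I_N -> R[i]) : R := \sum_(i < N) (`|Re (mu i)| + `|Im (mu i)|) * N%:R.

Lemma sqr_tnth_sphere_cap s i : tnth (sphere_cap s) i ^+ 2 <= N%:R.
Proof.
have h := @norm_tnth_sphere_cap R N s i.
rewrite -real_normK ?num_real// -[leRHS](sqr_sqrtr (ltW NR0)).
by rewrite ler_pXn2r// nnegrE sqrtr_ge0.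
Qed.

Lemma norm_cquad_cap mu s : `|Re (cquad mu (sphere_cap s))| <= cquad_bound mu /\
  `|Im (cquad mu (sphere_cap s))| <= cquad_bound mu.
Proof.
rewrite /cquad Re_sum Im_sum /cquad_bound; split.
  apply: le_trans (ler_norm_sum _ _ _) _; apply: ler_sum => i _.
  rewrite cReM /= mulr0 subr0 normrM [`|_ ^+ 2|]ger0_norm ?sqr_ge0//.
  by apply: ler_pM; rewrite ?sqr_ge0 ?sqr_tnth_sphere_cap// lerDl.
apply: le_trans (ler_norm_sum _ _ _) _; apply: ler_sum => i _.
rewrite cImM /= mulr0 add0r normrM [`|_ ^+ 2|]ger0_norm ?sqr_ge0//.
by apply: ler_pM; rewrite ?sqr_ge0 ?sqr_tnth_sphere_cap// lerDr.
Qed.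

Lemma cintegrable_cexp_cquad mu (c : R) :
  cintegrable omega (fun s => cexp (c%:C * cquad mu (sphere_cap s))).
Proof.
have [m1 m2] := cmeasurable_cquad mu; have mc := @measurable_sphere_cap R N.
have hB s : expR (Re (c%:C * cquad mu (sphere_cap s))) <= expR (`|c| * cquad_bound mu).
  rewrite cReMl ler_expR (le_trans (ler_norm _))// normrM ler_wpM2l//.
  exact: (norm_cquad_cap mu s).1.
apply: (@le_cintegrable _ _ _ _ _ (fun=> expR (`|c| * cquad_bound mu))).
- apply: cmeasurable_cexp; apply: cmeasurableM; first exact: cmeasurable_cst.
  by split; [exact: (measurableT_comp m1)|exact: (measurableT_comp m2)].
- by move=> s; apply: le_trans (norm_Re_cexp _) (hB s).
- by move=> s; apply: le_trans (norm_Im_cexp _) (hB s).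
- exact: finite_measure_integrable_cst.
Qed.

Section Replica.
Variables (mu : 'I_N -> R[i]) (gamma : R).
Hypothesis mu_lt : forall i, Re (mu i) < gamma.

Let K x := cexp (cquad mu x).

Let mK : cmeasurable K.
Proof. by apply: cmeasurable_cexp; exact: cmeasurable_cquad. Qed.

Let K_cap c : cintegrable omega (fun s => K (tscale c (sphere_cap s))).
Proof.
rewrite /K; under eq_fun do rewrite cquad_tscale.
exact: cintegrable_cexp_cquad.
Qed.

Let mKt c : cmeasurable (fun s => K (tscale c s)).
Proof.
have mt : measurable_fun setT (fun s : N.-tuple RT => tscale c s).
  exact: measurable_tscale.
by case: mK => m1 m2; split; [exact: (measurableT_comp m1)|exact: (measurableT_comp m2)].
Qed.

Let gexp_prod (u : R[i]) x :
  K x * cexp (- u * (dot x x)%:C) = \prod_(i < N) gexp (u - mu i) 0 (tnth x i).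
Proof.
rewrite /K -cexpD /gexp -cexp_sum; congr cexp.
rewrite /cquad /dot rmorph_sum/= mulr_sumr -big_split/=; apply: eq_bigr => i _.
by rewrite mul0r addr0 -expr2; ring.
Qed.

Let gexp_u (u : R[i]) : gamma <= Re u -> forall i, 0 < Re (u - mu i).
Proof. by move=> gu i; rewrite cReD cReN subr_gt0 (lt_le_trans (mu_lt i)). Qed.

Let K_gauss : cintegrable lebt (fun x => K x * (expR (- (gamma * dot x x)))%:C).
Proof.
have gi i := cintegrable_gexp 0 (@gexp_u gamma%:C (lexx _) i).
have [h _] := cintegrable_tuple_prod gi.
rewrite (_ : (fun x => _) = (fun x => \prod_(i < N) gexp (gamma%:C - mu i) 0 (tnth x i)))//.
apply/funext => x; rewrite -gexp_prod -cexpR; congr (_ * cexp _).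
by rewrite rmorphN rmorphM/= mulNr.
Qed.

(** Along a ray K is [cexp] of r A, with A a bounded quantity depending only on the point of the
    sphere, so the mean value theorem gives a constant uniform over the sphere. [part] stands for
    either component. *)
Let lip_K (rho : R) (part : R[i] -> R) : 0 < rho -> (part = Re \/ part = Im) ->
  lip_at (fun r => \int[omega]_s part (K (tscale (Num.sqrt (r / N%:R)) s))) rho.
Proof.
move=> r0 hp; pose B := cquad_bound mu.
(* B bounds both parts of A, and 2 rho bounds r on the window |r - rho| < rho. *)
pose D := (B + B) * expR (2 * rho * B).
apply: (@lip_at_surface_integral R N _ rho D rho r0).
- by move=> r; case: hp => ->; [exact: (mKt _).1|exact: (mKt _).2].
- by move=> r; have [[i1 i2] _] := cint_sphere_cap (mKt (Num.sqrt (r / N%:R))) (K_cap _); case: hp => ->.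
move=> r s rr; pose A : R[i] := (N%:R^-1)%:C * cquad mu (sphere_cap s).
have [h1 h2] := norm_cquad_cap mu s.
have N1 : N%:R^-1 <= 1 :> R by rewrite invf_le1// ler1n.
have A1 : `|Re A| <= B.
  rewrite cReMl normrM ger0_norm ?invr_ge0// -[leRHS]mul1r; exact: ler_pM.
have A2 : `|Im A| <= B.
  rewrite cImMl normrM ger0_norm ?invr_ge0// -[leRHS]mul1r; exact: ler_pM.
have KE u : `|u - rho| < rho -> K (tscale (Num.sqrt (u / N%:R)) (sphere_cap s)) = cexp (u%:C * A).
  rewrite ltr_norml => /andP[u0 _].
  rewrite /K cquad_tscale sqr_sqrtr ?divr_ge0//; last lra.
  by rewrite rmorphM/= -mulrA.
rewrite !KE ?subrr ?normr0//.
have dA (u : R) : is_cderive (fun u => cexp (u%:C * A)) u (A * cexp (u%:C * A)).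
  have h := is_cderive_cexp (is_cderiveM (is_cderive_id u) (is_cderive_cst A u)).
  by apply: is_cderive_eq h _; rewrite mulr0 add0r mul1r.
have bA u : `|u - rho| < rho -> (`|Re A| + `|Im A|) * expR (Re (u%:C * A)) <= D.
  rewrite ltr_norml => /andP[u0 u1]; apply: ler_pM; rewrite ?expR_ge0 ?addr_ge0//.
    exact: lerD.
  rewrite ler_expR cReMl; apply: le_trans (ler_norm _) _; rewrite normrM.
  by apply: ler_pM => //; rewrite ger0_norm; lra.
case: hp => ->.
  apply: (lip_MVT (fun u => (dA u).1)) rr => u ur.
  exact: le_trans (norm_ReM_cexp _ _) (bA u ur).
apply: (lip_MVT (fun u => (dA u).2)) rr => u ur.
exact: le_trans (norm_ImM_cexp _ _) (bA u ur).
Qed.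

(** The integral over R^N factors into centred complex Gaussians of coefficients gamma + i y - mu_i,
    convergent because Re mu_i < gamma. Each gives sqrt pi times an inverse square root, and the
    powers of sqrt pi are moved to the limit. *)
Theorem one_replica (rho : R) : 0 < rho ->
  line_cvg (fun y : RT => cexp (rho%:C * (gamma +i* y)) *
      \prod_(i < N) csqi ((gamma +i* y) - mu i))
    ((2 * pi * polar_density N rho * (Num.sqrt pi)^-1 ^+ N)%:C *
     cint omega (fun s => cexp ((rho / N%:R)%:C * cquad mu (sphere_cap s)))).
Proof.
move=> r0.
have rayi r := (cint_sphere_cap (mKt (Num.sqrt (r / N%:R))) (K_cap _)).1.
have h := @cint_laplace_inversion R N N_gt0 K gamma rho mK K_gauss rayi r0
  (lip_K r0 (or_introl erefl)) (lip_K r0 (or_intror erefl)).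
have := line_cvgZ ((Num.sqrt pi)^-1 ^+ N)%:C h.
set l := _ * _; set m := _ * cint _ _; have -> : l = m.
  rewrite /l /m mulrA -rmorphM/= [_ ^+ N * _]mulrC; congr (_ * _).
  rewrite -(cint_sphere_cap (mKt (Num.sqrt (rho / N%:R))) (K_cap _)).2; apply: eq_cint => s.
  by rewrite /K cquad_tscale sqr_sqrtr// divr_ge0// ltW.
apply: eq_line_cvg => y; rewrite mulrCA; congr (_ * _).
have gi i := cintegrable_gexp 0 (@gexp_u (gamma +i* y) (lexx _) i).
rewrite (eq_cint _ (gexp_prod _)) (cintegrable_tuple_prod gi).2.
rewrite (eq_bigr (fun i => (Num.sqrt pi)%:C * csqi ((gamma +i* y) - mu i))); last first.
  move=> i _; rewrite cint_gexp; last exact: gexp_u.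
  by rewrite expr0n/= mul0r cexp0 mulr1.
rewrite big_split/= prodr_const card_ord mulrA -rmorphXn -rmorphM/= -exprMn.
by rewrite mulVf ?expr1n ?mul1r// gt_eqF// sqrtr_gt0 pi_gt0.
Qed.

End Replica.
End OneReplica.

(** * Two replicas *)

Section Vertical.
Variable R : realType.
Local Notation RT := (measurableTypeR R).

Lemma line_cvg_vertical (gamma : R) (f : R[i] -> R[i]) (l : R[i]) :
  line_cvg (fun y : RT => f (gamma +i* y)) l ->
  vertical_integrable gamma f /\ vertical_integral gamma f = 'i * l.
Proof.
move=> [i1 i2 l1 l2].
have c1 : Re (segment_integral gamma f T) @[T --> +oo] --> - Im l.
  rewrite /segment_integral; under eq_fun do rewrite cReM /= mul0r mul1r sub0r.
  exact: cvgN.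
have c2 : Im (segment_integral gamma f T) @[T --> +oo] --> Re l.
  by rewrite /segment_integral; under eq_fun do rewrite cImM /= mul0r mul1r add0r.
split.
  split; first by move=> T; split; [exact: i1|exact: i2].
    by apply/cvg_ex; eexists; exact: c1.
  by apply/cvg_ex; eexists; exact: c2.
rewrite /vertical_integral (cvg_lim _ c1)// (cvg_lim _ c2)//.
by apply: eq_complexE; rewrite !complexE /=; ring.
Qed.

End Vertical.

(** * The integrands as products of inverse square roots *)

Section Integrands.
Variables (R : realType) (N : nat).
Hypothesis N_gt0 : (0 < N)%N.
Variables (lam : 'I_N -> R) (beta t gamma : R).
Hypothesis beta_gt0 : 0 < beta.

Let NR0 : 0 < N%:R :> R. Proof. by rewrite ltr0n. Qed.

Let half_log (x : R[i]) (L : 'I_N -> R[i]) :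
  cexp ((N%:R / 2)%:C * ((2 * beta)%:C * x - (N%:R^-1)%:C * \sum_(i < N) L i)) =
  cexp ((N%:R * beta)%:C * x) * \prod_(i < N) cexp (- (2^-1)%:C * L i).
Proof.
rewrite -cexp_sum -cexpD; congr cexp; rewrite -mulr_sumr.
rewrite mulrBr !mulrA -!rmorphM/= mulNr; congr (_%:C * _ - _%:C * _).
  by field.
by field; rewrite gt_eqF.
Qed.

Lemma expGE z : expG lam beta z =
  cexp ((N%:R * beta)%:C * z) * \prod_(i < N) csqi (z - (lam i)%:C).
Proof. exact: half_log. Qed.

(** The square of |t| / (2 beta N), the margin by which [gamma] must exceed the eigenvalues. *)
Definition shift2 : R := t ^+ 2 / (4 * beta ^+ 2 * N%:R ^+ 2).

Lemma expGtildeE z w : expGtilde lam beta t z w =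
  cexp ((N%:R * beta)%:C * (z + w)) *
  \prod_(i < N) csqi ((z - (lam i)%:C) * (w - (lam i)%:C) - shift2%:C).
Proof. exact: half_log. Qed.

Hypothesis gap : forall i, lam i + `|t| / (2 * beta * N%:R) < gamma.

Lemma shift2_lt i : 0 <= shift2 < (gamma - lam i) ^+ 2.
Proof.
have b0 : 0 < 2 * beta * N%:R by rewrite !mulr_gt0.
have -> : shift2 = (`|t| / (2 * beta * N%:R)) ^+ 2.
  rewrite expr_div_n real_normK ?num_real// /shift2; congr (_ / _); ring.
rewrite sqr_ge0/= ltr_pXn2r// ?nnegrE ?divr_ge0 ?(ltW b0)//.
  by rewrite ltrBrDl.
have := gap i; have : 0 <= `|t| / (2 * beta * N%:R) by rewrite divr_ge0// ltW.
lra.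
Qed.

Lemma gap_gt0 i : lam i < gamma.
Proof.
have b0 : 0 < 2 * beta * N%:R by rewrite !mulr_gt0.
have := gap i; have : 0 <= `|t| / (2 * beta * N%:R) by rewrite divr_ge0// ltW.
lra.
Qed.

(* For fixed [w], the pole of the [i]-th factor of the two-replica integrand,
   seen as a function of [z]. *)
Definition pole (w : R[i]) (i : 'I_N) : R[i] :=
  (lam i)%:C + shift2%:C / (w - (lam i)%:C).

Section OnLine.
Variable w : R[i].
Hypothesis Rew : Re w = gamma.

Let v i : R[i] := w - (lam i)%:C.

Let Rev i : Re (v i) = gamma - lam i.
Proof. by rewrite cReD cReN Rew. Qed.

Let v_gt0 i : 0 < Re (v i).
Proof. by rewrite Rev subr_gt0 gap_gt0. Qed.

Let v_neq0 i : v i != 0.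
Proof. by apply: slit_neq0; left. Qed.

Let Re_inv (u : R[i]) : u != 0 -> Re u^-1 = Re u / (Re u ^+ 2 + Im u ^+ 2).
Proof. by case: u => a b _. Qed.

(** With v = w - lam_i and c = [shift2], Re (c / v) = c Re v / |v|^2 <= c / Re v < Re v, because c <
    (Re v)^2. This is where the margin on gamma enters. *)
Lemma Re_pole_lt i : Re (pole w i) < gamma.
Proof.
have /andP[s0 s1] := shift2_lt i.
have vi := v_gt0 i.
rewrite /pole cReD cReMl -/(v i) Re_inv// -ltrBrDl /=.
rewrite -(Rev i) in s1 *; move: s1 vi; move: (Re (v i)) (Im (v i)) => a b s1 a0.
have d0 : 0 < a ^+ 2 + b ^+ 2 by rewrite ltr_wpDr ?sqr_ge0// exprn_gt0.
rewrite mulrA ltr_pdivrMr//; apply: (@lt_le_trans _ _ (a ^+ 2 * a)).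
  by rewrite ltr_pM2r.
by rewrite mulrC ler_wpM2l ?(ltW a0)// lerDl sqr_ge0.
Qed.

(** Each factor splits as (z - lam_i)(w - lam_i) - c = (z - [pole w i]) (w - lam_i), with both terms
    in the right half-plane, so [csqiM] distributes the root once the product is known to avoid the
    cut. *)
Lemma expGtilde_line (z : R[i]) : Re z = gamma ->
  expGtilde lam beta t z w =
  (cexp ((N%:R * beta)%:C * z) * \prod_(i < N) csqi (z - pole w i)) *
  (cexp ((N%:R * beta)%:C * w) * \prod_(i < N) csqi (w - (lam i)%:C)).
Proof.
move=> Rez; rewrite expGtildeE mulrDr cexpD mulrACA -big_split/=; congr (_ * _).
apply: eq_bigr => i _.
have e : (z - (lam i)%:C) * (w - (lam i)%:C) - shift2%:C = (z - pole w i) * v i.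
  have vi := v_neq0 i; rewrite /pole -/(v i); move: vi; rewrite /v => vi; field.
  exact: vi.
rewrite e csqiM//.
  by rewrite cReD cReN Rez subr_gt0 Re_pole_lt.
rewrite -e /slit; set u := _ - _.
have -> : Re u = (gamma - lam i) ^+ 2 - Im z * Im w - shift2.
  by rewrite /u !complexE /= Rez Rew; ring.
have -> : Im u = (gamma - lam i) * (Im w + Im z).
  by rewrite /u !complexE /= Rez Rew; ring.
have /andP[_ s1] := shift2_lt i.
have a0 : gamma - lam i != 0 by rewrite subr_eq0 gt_eqF// gap_gt0.
(* The product is real only when Im z = - Im w, and its real part is then (gamma - lam_i)^2 + (Im
   w)^2 - c, which is positive. *)
have [h|h] := eqVneq (Im w + Im z) 0; last by right; rewrite mulf_neq0.
left; have -> : Im z = - Im w by lra.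
by have := sqr_ge0 (Im w); rewrite [Im w ^+ 2]expr2; lra.
Qed.

End OnLine.
End Integrands.

(** * Inversion in the second variable *)

Section OuterIntegral.
Variables (R : realType) (N : nat).
Hypothesis N_gt0 : (0 < N)%N.
Local Notation RT := (measurableTypeR R).
Local Notation leb := (@lebesgue_measure R).
Local Notation lebt := (lebesgue_tuple R N).
Local Notation omega := (surface_measure R N).
Implicit Types (x y s : N.-tuple RT).

Let NR0 : 0 < N%:R :> R. Proof. by rewrite ltr0n. Qed.

Variables (lam : 'I_N -> R) (beta th gamma : R).
Hypothesis beta_gt0 : 0 < beta.
Hypothesis lam_lt : forall i, lam i < gamma.

Definition rquad x : R := \sum_(i < N) lam i * tnth x i ^+ 2.

Lemma rquad_tscale c x : rquad (tscale c x) = c ^+ 2 * rquad x.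
Proof.
rewrite /rquad mulr_sumr; apply: eq_bigr => i _.
by rewrite tnth_tscale exprMn mulrCA.
Qed.

Lemma measurable_rquad : measurable_fun setT rquad.
Proof.
apply: measurable_sum => i; apply: measurable_funM => //.
by apply: measurable_funX; exact: measurable_tnth.
Qed.

Let L : R := \sum_(i < N) `|lam i| * N%:R.

Let L0 : 0 <= L. Proof. by apply: sumr_ge0 => i _; rewrite mulr_ge0. Qed.

Lemma norm_rquad_sphere_cap s :
  `|rquad (sphere_cap s)| <= \sum_(i < N) `|lam i| * N%:R.
Proof.
apply: le_trans (ler_norm_sum _ _ _) _; apply: ler_sum => i _.
by rewrite normrM [`|_ ^+ 2|]ger0_norm ?sqr_ge0// ler_wpM2l// sqr_tnth_sphere_cap.
Qed.

Let norm_rquad_cap s : `|rquad (sphere_cap s)| <= L := norm_rquad_sphere_cap s.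

Let norm_dot_cap s x : `|dot (sphere_cap s) x| <= \sum_(i < N) Num.sqrt N%:R * `|tnth x i|.
Proof.
apply: le_trans (ler_norm_sum _ _ _) _; apply: ler_sum => i _.
by rewrite normrM ler_wpM2r// norm_tnth_sphere_cap.
Qed.

Let norm_dot_cap2 s x : `|dot (sphere_cap s) (sphere_cap x)| <= N%:R * N%:R.
Proof.
apply: le_trans (norm_dot_cap _ _) _.
have -> : N%:R * N%:R = \sum_(i < N) (N%:R : R).
  by rewrite sumr_const card_ord mulr_natr.
apply: ler_sum => i _; rewrite -[leRHS](sqr_sqrtr (ltW NR0)) expr2.
by rewrite ler_wpM2l ?sqrtr_ge0// norm_tnth_sphere_cap.
Qed.

(** Only s is capped, which bounds its terms uniformly; y runs over all of R^N and is controlled by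
    the Gaussian weight. *)
Let expo y s : R := beta * rquad (sphere_cap s) + rquad y + th * dot (sphere_cap s) y.

Let H y s : R := expR (expo y s).

Let mH : measurable_fun setT (fun p : N.-tuple RT * N.-tuple RT => H p.1 p.2).
Proof.
have mc := @measurable_sphere_cap R N.
have mc2 : measurable_fun setT (fun p : N.-tuple RT * N.-tuple RT => sphere_cap p.2).
  exact: (measurableT_comp mc measurable_snd).
apply: measurableT_comp => //; apply: measurable_funD.
  apply: measurable_funD; last exact: (measurableT_comp measurable_rquad measurable_fst).
  by apply: measurable_funM => //; exact: (measurableT_comp measurable_rquad mc2).
by apply: measurable_funM => //; apply: measurable_dot => //; exact: measurable_fst.
Qed.

Let expo_le y s : expo y s <= beta * L + \sum_(i < N)
  (lam i * tnth y i ^+ 2 + `|th| * Num.sqrt N%:R * `|tnth y i|).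
Proof.
rewrite /expo big_split/= addrA; apply: lerD; first apply: lerD => //.
  by rewrite ler_wpM2l ?(ltW beta_gt0)// (le_trans (ler_norm _)).
apply: le_trans (ler_norm _) _; rewrite normrM.
under eq_bigr do rewrite -mulrA.
by rewrite -mulr_sumr ler_wpM2l// norm_dot_cap.
Qed.

Let H_cap y : omega.-integrable setT (EFin \o H y).
Proof.
apply: (@le_integrable _ _ _ omega _ _ _ (EFin \o (fun=> expR (beta * L + \sum_(i < N)
    (lam i * tnth y i ^+ 2 + `|th| * Num.sqrt N%:R * `|tnth y i|))))) => //.
- by apply/measurable_EFinP; exact: (measurableT_comp mH (pair1_measurable y)).
- move=> s _; rewrite lee_fin [leLHS]ger0_norm; last exact: expR_ge0.
  by apply: le_trans (ler_norm _); rewrite ler_expR expo_le.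
- exact: finite_measure_integrable_cst.
Qed.

(** Integrating out the first replica leaves a kernel in y that is not the exponential of a
    quadratic form. Hence [one_replica] gives way to [laplace_inversion], whose hypotheses are
    checked for this kernel. *)
Let K y : R := \int[omega]_s H y s.

Let mK : measurable_fun setT K.
Proof.
apply: measurableT_comp => //.
apply: (@measurable_fun_fubini_tonelli_F _ _ _ _ _ omega
  (fun p : N.-tuple RT * N.-tuple RT => (H p.1 p.2)%:E)); first exact/measurable_EFinP.
by move=> p; rewrite lee_fin expR_ge0.
Qed.

Let a i : R := gamma - lam i.
Let a_gt0 i : 0 < a i. Proof. by rewrite subr_gt0. Qed.
(** Bounds the coefficient [th] times s_i of the linear term in y_i, for s on the sphere. *)
Let B : R := `|th| * Num.sqrt N%:R.
Let g (i : 'I_N) (x : RT) : R := expR (- (a i * x ^+ 2) + B * `|x|).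

Let g_int i : leb.-integrable setT (EFin \o g i).
Proof.
apply: (le_integrable measurableT _ _ (integrable_gauss_dominated B (a_gt0 i))).
  apply/measurable_EFinP; apply: measurableT_comp => //; apply: measurable_funD.
    apply: measurableT_comp => //; apply: measurable_funM => //; exact: measurable_funX.
  by apply: measurable_funM => //; exact: measurableT_comp.
move=> x _; rewrite lee_fin ger0_norm ?expR_ge0//.
apply: le_trans (ler_norm _); apply: le_trans (gauss_dominated B x (a_gt0 i)).
by rewrite ler_peMl ?expR_ge0// lerDl sqr_ge0.
Qed.

Let D_int : lebt.-integrable setT (EFin \o (fun y => \prod_(i < N) g i (tnth y i))).
Proof.
have gi i : cintegrable leb (fun x : RT => (g i x)%:C).
  by split; [exact: g_int|exact: (@integrable0 _ _ _ leb setT)].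
have [[h _] _] := cintegrable_tuple_prod gi.
apply: eq_integrable h => // y _ /=.
by rewrite -(rmorph_prod (real_complex R)).
Qed.

Let H_le y s : H y s * expR (- (gamma * dot y y)) <=
  expR (beta * L) * \prod_(i < N) g i (tnth y i).
Proof.
rewrite /H -expRD -expR_sum -expRD ler_expR.
apply: le_trans (lerD (expo_le y s) (lexx _)) _.
rewrite -addrA lerD2l /dot mulr_sumr -sumrN -big_split/=.
by apply: ler_sum => i _; rewrite /a /B -expr2 le_eqVlt; apply/orP; left; apply/eqP; ring.
Qed.

Let D2_int : (lebt \x omega)%E.-integrable setT
  (EFin \o (fun p : N.-tuple RT * N.-tuple RT =>
     expR (beta * L) * \prod_(i < N) g i (tnth p.1 i))).
Proof.
have c1 : omega.-integrable setT (EFin \o (fun=> 1)) by exact: finite_measure_integrable_cst.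
have [h _] := integrable_tensor D_int c1.
have := integrableZl measurableT (expR (beta * L)) h.
apply: eq_integrable => // p _ /=.
by rewrite mulr1.
Qed.

Let mE (c : R) : measurable_fun setT (fun y : N.-tuple RT => expR (- (c * dot y y))).
Proof. by have := measurable_gauss_tuple (R := R) (N := N) c => /measurable_EFinP. Qed.

Let HE_int : (lebt \x omega)%E.-integrable setT
  (EFin \o (fun p : N.-tuple RT * N.-tuple RT => H p.1 p.2 * expR (- (gamma * dot p.1 p.1)))).
Proof.
apply: (le_integrable measurableT _ _ D2_int).
  apply/measurable_EFinP; apply: measurable_funM => //.
  exact: (measurableT_comp (mE gamma) measurable_fst).
move=> p _; rewrite lee_fin ger0_norm; last by rewrite mulr_ge0 ?expR_ge0.
by apply: le_trans (ler_norm _); exact: H_le.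
Qed.

Let K_gauss : lebt.-integrable setT (EFin \o (fun y => K y * expR (- (gamma * dot y y)))).
Proof.
have [h _] := integrable_prod12 HE_int.
apply: eq_integrable h => // y _ /=.
by rewrite RintegralZr//; exact: H_cap.
Qed.

Let M (c : R) : R := beta * L + c ^+ 2 * L + `|th| * (`|c| * (N%:R * N%:R)).

Let expo_ray c y s : expo (tscale c (sphere_cap y)) s <= M c.
Proof.
rewrite /expo /M rquad_tscale dot_tscaler.
apply: lerD; first apply: lerD.
- by rewrite ler_wpM2l ?(ltW beta_gt0)// (le_trans (ler_norm _)).
- by rewrite ler_wpM2l ?sqr_ge0// (le_trans (ler_norm _)).
by apply: le_trans (ler_norm _) _; rewrite normrM ler_wpM2l// normrM ler_wpM2l.
Qed.

Let K_ge0 y : 0 <= K y.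
Proof. by apply: Rintegral_ge0 => s _; exact: expR_ge0. Qed.

Let K_ray r : omega.-integrable setT (EFin \o (fun s => K (tscale (Num.sqrt (r / N%:R)) s))).
Proof.
move: (Num.sqrt _) => c; have mt : measurable_fun setT (fun s : N.-tuple RT => tscale c s).
  exact: measurable_tscale.
have mKt : measurable_fun setT (fun s => K (tscale c s)) by exact: (measurableT_comp mK mt).
refine ((integrable_sphere_cap mKt).1 _).
apply: (@le_integrable _ _ _ omega _ _ _ (EFin \o (fun=> expR (M c) * area R N))) => //.
- by apply/measurable_EFinP; exact: (measurableT_comp mKt (@measurable_sphere_cap R N)).
- move=> s _; rewrite lee_fin ger0_norm//; apply: le_trans (ler_norm _).
  have ci : omega.-integrable setT (EFin \o (fun=> expR (M c))).
    exact: finite_measure_integrable_cst.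
  rewrite -Rintegral_surface_cst.
  apply: (@le_Rintegral _ _ _ omega setT _ _ measurableT (H_cap _) ci) => u _.
  by rewrite ler_expR expo_ray.
- exact: finite_measure_integrable_cst.
Qed.

Let sqrt_lip (u v : R) : 0 <= u -> 0 < v ->
  `|Num.sqrt u - Num.sqrt v| <= (Num.sqrt v)^-1 * `|u - v|.
Proof.
move=> u0 v0; have sv : 0 < Num.sqrt v by rewrite sqrtr_gt0.
have su := sqrtr_ge0 u.
have -> : u - v = (Num.sqrt u - Num.sqrt v) * (Num.sqrt u + Num.sqrt v).
  by rewrite -subr_sqr !sqr_sqrtr// ltW.
rewrite normrM mulrCA -[leLHS]mulr1 ler_wpM2l//.
rewrite ger0_norm; last by rewrite addr_ge0// ltW.
by rewrite mulrC ler_pdivlMr// mul1r lerDr.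
Qed.

(** Along a ray the quadratic part of the exponent is linear in r and the coupling is linear in sqrt
    r, so the exponent is Lipschitz at a positive rho; [expR_lip] transfers this to the
    exponential. *)
Let lip_K (rho : R) : 0 < rho ->
  lip_at (fun r => \int[omega]_s K (tscale (Num.sqrt (r / N%:R)) s)) rho.
Proof.
move=> r0; have rN0 : 0 < rho / N%:R by rewrite divr_gt0.
(* [M0] bounds the exponent for r up to 2 rho, and [C0] below is the Lipschitz constant of the
   exponent at rho. *)
pose M0 := beta * L + 2 * (rho / N%:R) * L +
  `|th| * (Num.sqrt (2 * (rho / N%:R)) * (N%:R * N%:R)).
pose C0 := N%:R^-1 * L + `|th| * ((Num.sqrt (rho / N%:R))^-1 * N%:R^-1 * (N%:R * N%:R)).
apply: (@lip_at_surface_integral R N _ rho (expR M0 * C0 * area R N) rho r0).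
- move=> r; apply: (measurableT_comp mK).
  exact: measurable_tscale.
- exact: K_ray.
move=> r s rr; rewrite /K -RintegralB//; try exact: H_cap.
set c := Num.sqrt (r / N%:R); set c0 := Num.sqrt (rho / N%:R).
have hi : omega.-integrable setT (EFin \o (fun u =>
    H (tscale c (sphere_cap s)) u - H (tscale c0 (sphere_cap s)) u)).
  by have := integrableB measurableT (H_cap (tscale c (sphere_cap s)))
     (H_cap (tscale c0 (sphere_cap s))).
apply: le_trans (le_normr_Rintegral measurableT hi) _.
have -> : expR M0 * C0 * area R N * `|r - rho| = \int[omega]_u (expR M0 * (C0 * `|r - rho|)).
  by rewrite Rintegral_surface_cst//; ring.
apply: le_Rintegral => //; first exact: integrable_norm.
  exact: finite_measure_integrable_cst.
move: rr; rewrite ltr_norml => /andP[r1 r2].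
have rp : 0 < r by lra.
have rN : 0 <= r / N%:R by rewrite divr_ge0// ltW.
have MM e : 0 <= e -> e <= 2 * rho -> M (Num.sqrt (e / N%:R)) <= M0.
  move=> e0 e1; have eN : e / N%:R <= 2 * (rho / N%:R) by rewrite mulrA ler_pM2r ?invr_gt0.
  have eN0 : 0 <= e / N%:R by rewrite divr_ge0// ltW.
  rewrite /M /M0 sqr_sqrtr// [`|Num.sqrt _|]ger0_norm ?sqrtr_ge0//.
  apply: lerD; first by rewrite lerD2l ler_wpM2r.
  rewrite ler_wpM2l// ler_wpM2r ?mulr_ge0 ?ler0n// ler_sqrt//.
  by rewrite mulr_ge0// ltW.
move=> u _; apply: le_trans (_ : expR M0 * `|expo (tscale c (sphere_cap s)) u -
    expo (tscale c0 (sphere_cap s)) u| <= _).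
  apply: expR_lip; apply: le_trans (expo_ray _ _ _) _; apply: MM; lra.
rewrite ler_wpM2l ?expR_ge0// /expo !rquad_tscale !dot_tscaler /c /c0 !sqr_sqrtr ?(ltW rN0)//.
rewrite (_ : _ - _ = N%:R^-1 * (r - rho) * rquad (sphere_cap s) +
  th * ((Num.sqrt (r / N%:R) - Num.sqrt (rho / N%:R)) * dot (sphere_cap u) (sphere_cap s))); last by ring.
apply: le_trans (ler_normD _ _) _; rewrite /C0 [leRHS]mulrDl; apply: lerD.
  rewrite !normrM [`|N%:R^-1|]ger0_norm ?invr_ge0 ?ler0n// mulrAC ler_wpM2r//.
  by rewrite ler_wpM2l ?invr_ge0 ?ler0n.
rewrite !normrM -!mulrA ler_wpM2l//.
apply: le_trans (_ : ((Num.sqrt (rho / N%:R))^-1 * `|r / N%:R - rho / N%:R|) * (N%:R * N%:R) <= _).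
  by apply: ler_pM => //; exact: sqrt_lip.
rewrite -mulrBl normrM [`|N%:R^-1|]ger0_norm ?invr_ge0 ?ler0n//.
by rewrite le_eqVlt; apply/orP; left; apply/eqP; ring.
Qed.

(** Each one-dimensional Gaussian is an integral over a coordinate y_i coupled to s_i; together they
    form an integral over R^N. The bound [H_le] makes the integrand jointly integrable, so s can be
    integrated first. *)
Let gauss_swap (w : R[i]) : Re w = gamma ->
  cint omega (fun s => (expR (beta * rquad (sphere_cap s)))%:C *
    \prod_(i < N) cint leb (gexp (w - (lam i)%:C) (th * tnth (sphere_cap s) i)%:C)) =
  cint lebt (fun y => (K y)%:C * cexp (- w * (dot y y)%:C)).
Proof.
move=> Rew; pose Psi (p : N.-tuple RT * N.-tuple RT) :=
  (H p.1 p.2)%:C * cexp (- w * (dot p.1 p.1)%:C).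
have mdd : measurable_fun setT (fun p : N.-tuple RT * N.-tuple RT => dot p.1 p.1 : R).
  by apply: measurable_dot; exact: measurable_fst.
have Re_w y : Re (- w * (dot y y)%:C) = - (gamma * dot y y).
  by rewrite !complexE /= Rew; ring.
have Psi_int : cintegrable (lebt \x omega)%E Psi.
  apply: (@le_cintegrable _ _ _ _ _ (fun p : N.-tuple RT * N.-tuple RT =>
     H p.1 p.2 * expR (- (gamma * dot p.1 p.1)))) => //.
  - apply: cmeasurableM; first by split.
    apply: cmeasurable_cexp; apply: cmeasurableM; first exact: cmeasurable_cst.
    by split.
  - move=> p; rewrite cReMl normrM ger0_norm; last exact: expR_ge0.
    by rewrite ler_wpM2l ?expR_ge0// -Re_w norm_Re_cexp.
  - move=> p; rewrite cImMl normrM ger0_norm; last exact: expR_ge0.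
    by rewrite ler_wpM2l ?expR_ge0// -Re_w norm_Im_cexp.
have Rewl i : 0 < Re (w - (lam i)%:C).
  by rewrite cReD cReN Rew subr_gt0 lam_lt.
transitivity (cint omega (fun s => cint lebt (fun y => Psi (y, s)))).
  apply: eq_cint => s.
  have gi i := cintegrable_gexp (th * tnth (sphere_cap s) i)%:C (Rewl i).
  have [pi1 <-] := cintegrable_tuple_prod gi.
  rewrite -cintZ//; apply: eq_cint => y; rewrite /Psi /H /= -!cexpR /gexp.
  rewrite -cexp_sum -!cexpD; congr cexp.
  rewrite /expo /rquad /dot !rmorphD/= -addrA -addrA; congr (_ + _).
  rewrite [(th * _)%:C]rmorphM/= !rmorph_sum/= !mulr_sumr -!big_split/=.
  by apply: eq_bigr => i _; rewrite !rmorphM/=; ring.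
rewrite (cint_prod21 Psi_int) -(cint_prod12 Psi_int); apply: eq_cint => y.
rewrite [RHS]mulrC; transitivity (cint omega (fun s => cexp (- w * (dot y y)%:C) * (H y s)%:C)).
  by apply: eq_cint => s; rewrite /Psi mulrC.
rewrite cintZ; first by congr (_ * _); apply: eq_complexE; rewrite //= /Rintegral integral0.
by split; [exact: H_cap|exact: (@integrable0 _ _ _ omega setT)].
Qed.

Theorem gauss_sphere_inversion (rho : R) : 0 < rho ->
  line_cvg (fun y : RT => cexp (rho%:C * (gamma +i* y)) *
      cint omega (fun s => (expR (beta * rquad (sphere_cap s)))%:C *
        \prod_(i < N) cint leb (gexp ((gamma +i* y) - (lam i)%:C) (th * tnth (sphere_cap s) i)%:C)))
    (2 * pi * polar_density N rho * \int[omega]_x \int[omega]_s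
      expR (beta * rquad (sphere_cap s) + rquad (tscale (Num.sqrt (rho / N%:R)) x) +
        th * dot (sphere_cap s) (tscale (Num.sqrt (rho / N%:R)) x)))%:C.
Proof.
move=> r0; have := laplace_inversion N_gt0 mK K_gauss K_ray r0 (lip_K r0).
by apply: eq_line_cvg => y; rewrite gauss_swap.
Qed.

End OuterIntegral.

(** * Evaluation of both contour integrals *)

Section TwoReplicas.
Variables (R : realType) (N : nat).
Hypothesis N_gt0 : (0 < N)%N.
Local Notation RT := (measurableTypeR R).
Local Notation leb := (@lebesgue_measure R).
Local Notation omega := (surface_measure R N).
Implicit Types (x s : N.-tuple RT).
Variables (lam : 'I_N -> R) (beta t gamma : R).
Hypothesis beta_gt0 : 0 < beta.
Hypothesis gap : forall i, lam i + `|t| / (2 * beta * N%:R) < gamma.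

Let NR0 : 0 < N%:R :> R. Proof. by rewrite ltr0n. Qed.
(** The inversion point, since (N/2) 2 beta z = rho z. As rho / N = beta, points of the sphere are
    scaled by sqrt beta. *)
Let rho : R := N%:R * beta.
Let rho_gt0 : 0 < rho. Proof. exact: mulr_gt0. Qed.
Let rhoN : rho / N%:R = beta. Proof. by rewrite /rho mulrAC divff ?mul1r// gt_eqF. Qed.

Let lam_lt i : lam i < gamma. Proof. exact: (gap_gt0 N_gt0 beta_gt0 gap). Qed.

(* [2 pi] times the normalisation that the vertical integrals of one replica
   have in common. *)
Definition vertical_const : R :=
  2 * pi * polar_density N (N%:R * beta) * (Num.sqrt pi)^-1 ^+ N.

Lemma vertical_const_neq0 : vertical_const != 0.
Proof.
rewrite gt_eqF// /vertical_const !mulr_gt0 ?pi_gt0 ?exprn_gt0 ?invr_gt0 ?sqrtr_gt0 ?pi_gt0//.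
by rewrite /polar_density ifT// !mulr_gt0 ?invr_gt0 ?powR_gt0.
Qed.

Let expR_cquad s : cexp (beta%:C * cquad (fun i => (lam i)%:C) (sphere_cap s)) =
  (expR (beta * rquad lam (sphere_cap s)))%:C.
Proof.
rewrite -cexpR; congr cexp; rewrite rmorphM /rquad /cquad rmorph_sum/=; congr (_ * _).
by apply: eq_bigr => i _; rewrite [RHS]rmorphM.
Qed.

Theorem vertical_expG : vertical_integrable gamma (expG lam beta) /\
  vertical_integral gamma (expG lam beta) = 'i * (vertical_const *
    \int[omega]_s expR (beta * rquad lam (sphere_cap s)))%:C.
Proof.
apply: line_cvg_vertical.
have h := @one_replica R N N_gt0 (fun i => (lam i)%:C) gamma lam_lt rho rho_gt0.
rewrite rhoN -/vertical_const (eq_cint _ expR_cquad) in h.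
rewrite rmorphM/= (_ : (\int[_]_s _)%:C = cint omega (fun s =>
    (expR (beta * rquad lam (sphere_cap s)))%:C)); last first.
  by apply: eq_complexE; rewrite //= /Rintegral integral0.
by apply: eq_line_cvg h => y; rewrite expGE.
Qed.

(** Chosen so that th^2 / 4 = beta c: the exponent b^2 / (4u) of the Gaussian integral, with b = th
    s_i and u = w - lam_i, is then beta c s_i^2 / u. Rescaling the second replica by sqrt beta turns
    the coupling into t / N, and the sign of t is kept. *)
Let th : R := t / (beta * N%:R) * Num.sqrt beta.

(** The shift of the pole becomes a Gaussian integral over y_i, which turns the inner result into
    the form that [gauss_sphere_inversion] inverts. *)
Let pole_factor (w : R[i]) s : Re w = gamma ->
  \prod_(i < N) csqi (w - (lam i)%:C) * cexp (beta%:C * cquad (pole lam beta t w) (sphere_cap s)) =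
  ((Num.sqrt pi)^-1 ^+ N)%:C * ((expR (beta * rquad lam (sphere_cap s)))%:C *
   \prod_(i < N) cint leb (gexp (w - (lam i)%:C) (th * tnth (sphere_cap s) i)%:C)).
Proof.
move=> Rew; have v0 i : 0 < Re (w - (lam i)%:C) by rewrite cReD cReN Rew subr_gt0 lam_lt.
have vn0 i : w - (lam i)%:C != 0 by apply: slit_neq0; left.
under [X in _ = _ * (_ * X)]eq_bigr do rewrite cint_gexp// -mulrA.
rewrite big_split/= prodr_const card_ord.
have p0 : Num.sqrt pi != 0 :> R by rewrite gt_eqF// sqrtr_gt0 pi_gt0.
have pE : ((Num.sqrt pi)^-1 ^+ N)%:C * (Num.sqrt pi)%:C ^+ N = 1 :> R[i].
  by rewrite -rmorphXn -rmorphM/= -exprMn mulVf// expr1n.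
rewrite big_split/=; set A := (_ ^+ N)%:C in pE *; set A' := _%:C ^+ N in pE *.
set E := (expR _)%:C; set Q := \prod_(i < N) csqi _; set Q' := \prod_(i < N) cexp _.
transitivity (A * A' * (Q * (E * Q'))); last by ring.
rewrite pE mul1r; congr (_ * _); rewrite /E /Q'.
rewrite -cexp_sum -expR_cquad -cexpD; congr cexp.
rewrite /cquad !mulr_sumr -big_split/=; apply: eq_bigr => i _.
rewrite /pole mulrDl mulrDr; congr (_ + _).
have th2 : (th * tnth (sphere_cap s) i)%:C ^+ 2 =
    (4 * beta * shift2 N beta t * tnth (sphere_cap s) i ^+ 2)%:C.
  rewrite -rmorphXn/= exprMn /th exprMn sqr_sqrtr ?ltW// /shift2; congr (_ %:C).
  by field; rewrite !gt_eqF.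
have split4 (b c e : R) : (4 * b * c * e)%:C = 4 * b%:C * c%:C * e%:C.
  by rewrite !rmorphM/= -(rmorph_nat (real_complex R)).
rewrite th2 split4.
by have vi := vn0 i; field.
Qed.

Let inner_limit (w : R[i]) : R[i] :=
  (cexp (rho%:C * w) * \prod_(i < N) csqi (w - (lam i)%:C)) *
  (vertical_const%:C *
   cint omega (fun s => cexp (beta%:C * cquad (pole lam beta t w) (sphere_cap s)))).

Let inner_vertical (w : R[i]) : Re w = gamma ->
  vertical_integrable gamma (fun z => expGtilde lam beta t z w) /\
  vertical_integral gamma (fun z => expGtilde lam beta t z w) = 'i * inner_limit w.
Proof.
move=> Rew; apply: line_cvg_vertical.
have pl := Re_pole_lt N_gt0 beta_gt0 gap Rew.
have h := @one_replica R N N_gt0 (pole lam beta t w) gamma pl rho rho_gt0.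
rewrite rhoN -/vertical_const in h.
apply: eq_line_cvg (line_cvgZ _ h) => y.
by rewrite (expGtilde_line N_gt0 beta_gt0 gap Rew)// mulrC.
Qed.

Let inner_limitE (w : R[i]) : Re w = gamma -> inner_limit w =
  (vertical_const * (Num.sqrt pi)^-1 ^+ N)%:C * (cexp (rho%:C * w) *
   cint omega (fun s => (expR (beta * rquad lam (sphere_cap s)))%:C *
     \prod_(i < N) cint leb (gexp (w - (lam i)%:C) (th * tnth (sphere_cap s) i)%:C))).
Proof.
move=> Rew; rewrite /inner_limit.
have p0 : Num.sqrt pi != 0 :> R by rewrite gt_eqF// sqrtr_gt0 pi_gt0.
pose F s := (expR (beta * rquad lam (sphere_cap s)))%:C *
     \prod_(i < N) cint leb (gexp (w - (lam i)%:C) (th * tnth (sphere_cap s) i)%:C).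
have ci := @cintegrable_cexp_cquad R N N_gt0 (pole lam beta t w) beta.
pose q : R[i] := ((Num.sqrt pi)^-1 ^+ N)%:C.
have q0 : q != 0 by rewrite /q fmorph_eq0 expf_neq0// invr_eq0.
pose P := \prod_(i < N) csqi (w - (lam i)%:C).
have FE s : F s = (q^-1 * P) * cexp (beta%:C * cquad (pole lam beta t w) (sphere_cap s)).
  by rewrite -mulrA pole_factor// -/q mulKf.
rewrite -/F -/P (eq_cint _ FE) cintZ// [(vertical_const * _)%:C]rmorphM/= -/q.
by field.
Qed.

(** The inner value is known only for Re w = gamma, which is all that the outer integral uses. The
    second inversion contributes 2 pi times the density, which with the leftover powers of sqrt pi
    is another [vertical_const]. *)
Theorem vertical_expGtilde :
  [/\ forall y : R, vertical_integrable gamma (fun z => expGtilde lam beta t z (gamma +i* y)),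
      vertical_integrable gamma (fun w =>
        vertical_integral gamma (fun z => expGtilde lam beta t z w)) &
      vertical_integral gamma (fun w =>
        vertical_integral gamma (fun z => expGtilde lam beta t z w)) =
      'i * ('i * (vertical_const ^+ 2 * \int[omega]_x \int[omega]_s
        expR (beta * rquad lam (sphere_cap s) + beta * rquad lam x +
              t / N%:R * dot (sphere_cap s) x))%:C)].
Proof.
have h := gauss_sphere_inversion N_gt0 th beta_gt0 lam_lt rho_gt0.
have h2 := line_cvgZ ('i * (vertical_const * (Num.sqrt pi)^-1 ^+ N)%:C) h.
split; first by move=> y; exact: (inner_vertical (w := gamma +i* y) erefl).1.
all: have := @line_cvg_vertical R gamma (fun w =>
        vertical_integral gamma (fun z => expGtilde lam beta t z w)) _
    (eq_line_cvg _ h2).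
- case=> // y; rewrite (inner_vertical (w := gamma +i* y) erefl).2 inner_limitE//.
  by rewrite -mulrA.
- case=> [y|_ ->].
    by rewrite (inner_vertical (w := gamma +i* y) erefl).2 inner_limitE// -mulrA.
  set I1 := Rintegral _ _ _; set I2 := Rintegral _ _ _.
  have -> : I1 = I2.
    apply: eq_Rintegral => x _; apply: eq_Rintegral => s _.
    rewrite rquad_tscale dot_tscaler rhoN sqr_sqrtr ?(ltW beta_gt0)//.
    congr (expR (_ + _)); rewrite /th -mulrA [Num.sqrt _ * (_ * _)]mulrA -expr2.
    rewrite sqr_sqrtr ?(ltW beta_gt0)//.
    by field; rewrite !gt_eqF.
  have iM (b c : R) : 'i * ('i * b%:C * c%:C) = 'i * ('i * (b * c)%:C) by rewrite rmorphM/= !mulrA.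
  rewrite iM; congr ('i * ('i * _)); congr (_%:C).
  by rewrite /vertical_const -/rho expr2; ring.
Qed.

End TwoReplicas.

(** * Rotation to the eigenbasis *)

Section Diagonalisation.
Variables (R : realType) (N : nat).
Hypothesis N_gt0 : (0 < N)%N.
Local Notation RT := (measurableTypeR R).
Local Notation omega := (surface_measure R N).
Local Notation S := (sphere R N).
Implicit Types (x s : N.-tuple RT).

Let NR0 : 0 < N%:R :> R. Proof. by rewrite ltr0n. Qed.

Variables (a U : 'M[R]_N) (lam : 'I_N -> R) (beta t : R).
Hypothesis UU : U *m U^T = 1%:M.
Hypothesis diagE : sym_matrix a = U^T *m diag_mx (\row_i lam i) *m U.

(** A quadratic form depends only on the symmetric part of its matrix: the double sum is averaged
    with its copy in which i and j are exchanged. *)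
Lemma hamiltonian_trot s : hamiltonian a s = - rquad lam (trot U s).
Proof.
rewrite /rquad -(quadratic_form_trot s diagE) /hamiltonian; congr (- _).
have sN : Num.sqrt N%:R != 0 :> R by rewrite gt_eqF// sqrtr_gt0.
set A := \sum_(i < N) _; set B := RHS.
have -> : B = (2 * Num.sqrt N%:R)^-1 * (A + A).
  rewrite [in X in _ + X]/A exchange_big/= /A -big_split/= mulr_sumr.
  apply: eq_bigr => i _; rewrite -big_split/= mulr_sumr; apply: eq_bigr => j _.
  by rewrite mxE; field.
by field.
Qed.

Lemma sphere_cap_trot s : sphere_cap (trot U s) = trot U (sphere_cap s).
Proof. by rewrite /sphere_cap enorm_trot//; case: ifP => // _; rewrite trot_tscale. Qed.

Lemma Rintegral_sphere_trot (f : N.-tuple RT -> R) : measurable_fun setT f ->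
  (forall x, 0 <= f x) ->
  \int[omega]_(s in S) f (trot U s) = \int[omega]_s f (sphere_cap s).
Proof.
move=> mf f0; have mU := @measurable_trot R N U.
rewrite Rintegral_sphere; last exact: (measurableT_comp mf mU).
under eq_Rintegral do rewrite -sphere_cap_trot.
congr fine; apply: (ge0_integral_surface_trot (F := fun s => (f (sphere_cap s))%:E)) => //.
- by apply/measurable_EFinP; exact: (measurableT_comp mf (@measurable_sphere_cap R N)).
- by move=> s; rewrite lee_fin.
Qed.

Lemma integral_hamiltonian : \int[omega]_(s in S) expR (- beta * hamiltonian a s) =
  \int[omega]_s expR (beta * rquad lam (sphere_cap s)).
Proof.
under eq_Rintegral do rewrite hamiltonian_trot mulrNN.
apply: (Rintegral_sphere_trot (f := fun s => expR (beta * rquad lam s))).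
  by apply: measurableT_comp => //; apply: measurable_funM => //; exact: measurable_rquad.
by move=> x; exact: expR_ge0.
Qed.

(** Both replicas are rotated by the same orthogonal matrix, so the overlap is preserved. The inner
    integral is rotated for fixed s1, and the outer one afterwards. *)
Lemma integral_hamiltonian2 :
  \int[omega]_(s1 in S) \int[omega]_(s2 in S)
    expR (- beta * (hamiltonian a s1 + hamiltonian a s2) + t * overlap s1 s2) =
  \int[omega]_x \int[omega]_s
    expR (beta * rquad lam (sphere_cap s) + beta * rquad lam x +
          t / N%:R * dot (sphere_cap s) x).
Proof.
pose G x s := expR (beta * rquad lam s + beta * rquad lam x + t / N%:R * dot s x).
pose k x := \int[omega]_s G x (sphere_cap s).
have mG : measurable_fun setT (fun p : N.-tuple RT * N.-tuple RT => G p.1 p.2).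
  apply: measurableT_comp => //; apply: measurable_funD; last first.
    by apply: measurable_funM => //; apply: measurable_dot => //; exact: measurable_fst.
  by apply: measurable_funD; apply: measurable_funM => //;
    apply: (measurableT_comp (@measurable_rquad R N lam)).
have mk : measurable_fun setT k.
  apply: measurableT_comp => //.
  apply: (@measurable_fun_fubini_tonelli_F _ _ _ _ _ omega
    (fun p : N.-tuple RT * N.-tuple RT => (G p.1 (sphere_cap p.2))%:E)).
    apply/measurable_EFinP.
    have mp : measurable_fun setT (fun p : N.-tuple RT * N.-tuple RT => (p.1, sphere_cap p.2)).
      apply: measurable_fun_pair; first exact: measurable_fst.
      exact: (measurableT_comp (@measurable_sphere_cap R N) measurable_snd).
    exact: (measurableT_comp mG mp).
  by move=> p; rewrite lee_fin expR_ge0.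
have k0 x : 0 <= k x by apply: Rintegral_ge0 => s _; exact: expR_ge0.
transitivity (\int[omega]_(s1 in S) k (trot U s1)).
  apply: eq_Rintegral => s1 _; rewrite /k.
  rewrite -(@Rintegral_sphere_trot (G (trot U s1))); last 2 first.
  - exact: (measurableT_comp mG (pair1_measurable _)).
  - by move=> x; exact: expR_ge0.
  apply: eq_Rintegral => s2 _; rewrite /G !hamiltonian_trot dot_trot; last exact: mulmx1C.
  by congr expR; rewrite /overlap dotC; field; rewrite gt_eqF.
rewrite (Rintegral_sphere_trot mk k0).
have mEk : measurable_fun setT (EFin \o k) by exact/measurable_EFinP.
exact: (congr1 fine (integral_sphere_cap mEk)).
Qed.

(** Makes the denominators nonzero: the exponent is bounded on the sphere, which has positive
    area. *)
Lemma integral_expR_rquad_gt0 : 0 < \int[omega]_s expR (beta * rquad lam (sphere_cap s)).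
Proof.
pose L := `|beta| * \sum_(i < N) `|lam i| * N%:R.
have bL s : `|beta * rquad lam (sphere_cap s)| <= L.
  by rewrite normrM ler_wpM2l// norm_rquad_sphere_cap.
have ci (c : R) : omega.-integrable setT (EFin \o (fun=> c)).
  exact: finite_measure_integrable_cst.
apply: (@lt_le_trans _ _ (\int[omega]_s expR (- L))).
  by rewrite Rintegral_surface_cst// mulr_gt0 ?expR_gt0// area_gt0.
apply: le_Rintegral => //; last first.
  by move=> s _; rewrite ler_expR lerNl (le_trans _ (bL s))// -normrN ler_norm.
apply: (le_integrable measurableT _ _ (ci (expR L))).
  apply/measurable_EFinP; apply: measurableT_comp => //; apply: measurable_funM => //.
  exact: (measurableT_comp (@measurable_rquad R N lam) (@measurable_sphere_cap R N)).
move=> s _; rewrite lee_fin !ger0_norm ?expR_ge0// ler_expR.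
exact: le_trans (ler_norm _) (bL s).
Qed.

End Diagonalisation.

(** The contour integrals are improper limits, so their convergence is asserted with the identity.
    The branch points in [Gtilde] depend on t only through t^2, which is why the margin is written
    with |t|, for both signs of t. *)
Theorem lemma4 (d : measure_display) (Omega : measurableType d) (R : realType)
    (P : probability Omega R) (N : nat) (N_gt0 : (0 < N)%N)
    (g : 'I_N -> 'I_N -> {RV P >-> R})
    (g_gauss : forall i j, standard_gaussian (g i j))
    (g_indep : mutually_independent (fun p : 'I_N * 'I_N => g p.1 p.2))
    (beta t : R) (beta_gt0 : 0 < beta)
    (o : Omega) (a : 'M[R]_N) (aE : a = \matrix_(i, j) g i j o)
    (lam : 'I_N -> R) (lamP : ordered_eigenvalues (sym_matrix a) lam)
    (gamma : R)
    (gamma_gt : lam (Ordinal N_gt0) + `|t| / (2 * beta * N%:R) < gamma) :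
  [/\ vertical_integrable gamma (expG lam beta),
      forall y : R,
        vertical_integrable gamma
          (fun z => expGtilde lam beta t z (gamma +i* y)),
      vertical_integrable gamma (fun w =>
        vertical_integral gamma (fun z => expGtilde lam beta t z w)) &
      (overlap_laplace a beta t)%:C =
      vertical_integral gamma (fun w =>
        vertical_integral gamma (fun z => expGtilde lam beta t z w)) /
      vertical_integral gamma (expG lam beta) ^+ 2].
Proof.
have [char_lam lam_le] := lamP.
have gap i : lam i + `|t| / (2 * beta * N%:R) < gamma.
  by apply: le_lt_trans gamma_gt; rewrite lerD2r lam_le.
have symM : (sym_matrix a)^T = sym_matrix a.
  by apply/matrixP => i j; rewrite !mxE addrC.
have [U [UU diagE]] := symmetric_spectral symM char_lam.
have [iG vG] := vertical_expG N_gt0 beta_gt0 gap.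
have [iz iw vGt] := vertical_expGtilde N_gt0 beta_gt0 gap.
split=> //; rewrite vG vGt /overlap_laplace /partition_function.
rewrite (integral_hamiltonian N_gt0 beta UU diagE) (integral_hamiltonian2 N_gt0 beta t UU diagE).
have q0 := vertical_const_neq0 N_gt0 beta_gt0.
have a0 : area R N != 0 by rewrite gt_eqF// area_gt0.
have Z0 := integral_expR_rquad_gt0 N_gt0 lam beta.
move: Z0; set Z := Rintegral _ _ _; set k := Rintegral _ _ _ => /gt_eqF/negbT Z0.
move: (vertical_const N beta) q0 => q q0.
rewrite (_ : ((area R N)^-1 * Z) ^- 2 * (area R N) ^- 2 * k = (q ^+ 2 * k) / (q * Z) ^+ 2); last first.
  by field; rewrite q0 a0 Z0.
rewrite rmorphM/= fmorphV rmorphXn/= exprMn mulrA -expr2.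
(* The two integrations of the numerator and the square in the denominator each produce i^2, so the
   signs cancel. *)
have -> : 'i ^+ 2 = -1 :> R[i] by apply: eq_complexE; rewrite expr2 !complexE /=; ring.
by rewrite !mulN1r invrN mulrNN.
Qed.
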